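(* For every $r$ with $0<r<2$ there exists a constant $L(r)\in(0,\infty)$, depending only on $r$, such that the following holds. Let $s>0$ be defined by $\frac1s+\frac12=\frac1r$. Let $n\ge 2$, let $T\subset\mathbb{R}^n$ be nonempty, let $X_1,\dots,X_n$ be independent symmetric real random variables with tails $\mathbf{P}(|X_k|>u)=\exp(-u^r)$ for $u>0$, and put $X_t=\sum_{k=1}^n t_kX_k$ for $t=(t_1,\dots,t_n)\in T$. For a permutation $\pi$ of $\{1,\dots,n\}$ set $$T_\pi=\left\{\left(t_{\pi(k)}\left(\log\frac nk\right)^{1/s}\right)_{k=1}^n \;:\; (t_1,\dots,t_n)\in T\right\}\subset\mathbb{R}^n .$$ Then $$\frac1{L(r)}\,\mathbf{E}_\pi\,\gamma_2(T_\pi,d_2)\;\le\;\mathbf{E}\sup_{t\in T}X_t\;\le\;L(r)\,\mathbf{E}_\pi\,\gamma_2(T_\pi,d_2),$$ where $\mathbf{E}_\pi$ denotes expectation over a uniformly distributed random permutation $\pi$ of $\{1,\dots,n\}$.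
   Context: For an index set $T$, $\mathbf{E}\sup_{t\in T}X_t:=\sup\{\mathbf{E}\sup_{t\in S}X_t : S\subset T \text{ finite (nonempty)}\}$. $d_2$ is the Euclidean metric on $\mathbb{R}^n$, and $\log$ is the natural logarithm. A sequence of partitions $(\mathcal{A}_j)_{j\ge0}$ of a set $T$ is increasing if for every $j$ and every $B\in\mathcal{A}_{j+1}$ there is $A\in\mathcal{A}_j$ with $B\subset A$; it is admissible if it is increasing, $\mathcal{A}_0=\{T\}$ and $|\mathcal{A}_j|\le 2^{2^j}$ for all $j$. For $t\in T$, $A_j(t)$ is the unique element of $\mathcal{A}_j$ containing $t$. For $\alpha>0$ and a metric space $(T,d)$, $$\gamma_\alpha(T,d)=\inf\sup_{t\in T}\sum_{j\ge0}2^{j/\alpha}\Delta_d(A_j(t)),$$ where $\Delta_d(A)$ is the $d$-diameter of $A$ and the infimum is over all admissible sequences of partitions of $T$. *)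

(* Defs.v *)
From HB Require Import structures.
From mathcomp Require Import all_boot all_order all_algebra all_fingroup.
From mathcomp Require Import all_classical all_reals all_analysis.

Set Implicit Arguments.
Unset Strict Implicit.
Unset Printing Implicit Defensive.

Import Order.TTheory GRing.Theory Num.Theory.
Import numFieldNormedType.Exports.

Local Open Scope classical_set_scope.
Local Open Scope card_scope.
Local Open Scope ring_scope.

(* Partitions of [T] are sets of blocks; [partition] (from classical_sets)
   requires the blocks to be nonempty, pairwise disjoint and to cover [T]. *)
Definition admissible (V : Type) (T : set V) (A : nat -> set (set V)) : Prop :=
  [/\ forall j, partition (A j) id T,
      forall j B, A j.+1 B -> exists2 C, A j C & B `<=` C,
      A 0%N = [set T]
    & forall j, A j #<= `I_(2 ^ (2 ^ j))].

Section gamma.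
Context {R : realType} {V : Type}.
Local Open Scope ereal_scope.

Definition diameter (d : V -> V -> R) (A : set V) : \bar R :=
  ereal_sup [set (d p.1 p.2)%:E | p in A `*` A].

(* [pblock (A j) id t] is the block of [A j] containing [t]. *)
Definition gamma (alpha : R) (T : set V) (d : V -> V -> R) : \bar R :=
  ereal_inf [set ereal_sup
      [set \sum_(0 <= j <oo)
             (2 `^ (j%:R / alpha))%:E * diameter d (pblock (A j) id t)
      | t in T]
    | A in admissible T].

End gamma.

Definition d2 (R : realType) (n : nat) (x y : 'rV[R]_n) : R :=
  Num.sqrt (\sum_(k < n) (x ord0 k - y ord0 k) ^+ 2).

(* The index [k : 'I_n] stands for [k.+1] in the range 1, ..., n. *)
Definition Tperm (R : realType) (n : nat) (s : R) (T : set 'rV[R]_n)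
    (p : 'S_n) : set 'rV[R]_n :=
  [set \row_(k < n) (t ord0 (p k) * ln (n%:R / k.+1%:R) `^ s^-1) | t in T].

Definition Eperm (R : realType) (n : nat) (f : 'S_n -> \bar R) : \bar R :=
  ((#|{: 'S_n}|%:R^-1)%:E * \sum_(p : 'S_n) f p)%E.

Section probability.
Context {d : measure_display} {Omega : measurableType d} {R : realType}.
Variable P : probability Omega R.
Local Open Scope ereal_scope.

Definition independent_RVs (I : finType) (X : I -> {RV P >-> R}) : Prop :=
  forall (J : {set I}) (B : I -> set R), (forall i, measurable (B i)) ->
    P (\bigcap_(i in [set i | i \in J]) (X i @^-1` B i)) =
    \prod_(i in J) P (X i @^-1` B i).

Definition symmetric_RV (X : {RV P >-> R}) : Prop :=
  forall B : set R, measurable B ->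
    P (X @^-1` B) = P ((fun w => (- X w)%R) @^-1` B).

Definition linear_process (n : nat) (X : 'I_n -> {RV P >-> R})
    (t : 'rV[R]_n) (w : Omega) : R :=
  (\sum_(k < n) t ord0 k * X k w)%R.

Definition Esup (V : Type) (T : set V) (X : V -> Omega -> R) : \bar R :=
  ereal_sup [set 'E_P[fun w => sup [set X t w | t in S]]
            | S in [set S | [/\ S `<=` T, finite_set S & S !=set0]]].

End probability.

(* Main.v *)
(* Since 1/r = 1/s + 1/2, a variable with tail exp(-u^r) is, up to constants, a
   product Y * g of independent factors with tails exp(-u^s) and exp(-u^2): the
   product exceeds u when Y > u^(r/s) and g > u^(r/2).  Hence E sup X_t is
   comparable with E sup_t sum_k t_k Y_k g_k.  The order statistics of
   Y_1, ..., Y_n are essentially log(n/k)^(1/s), in a uniformly random order, so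
   that conditionally on Y the process is Gaussian and indexed by T_pi, and
   gamma_2(T_pi, d_2) measures its supremum by the majorizing measure theorem.

   The supremum over a finite set being sublinear in the absolute values of the
   coefficients (contraction principle), the comparison of tails and of sampling
   with and without replacement are statements on sublinear functionals.  All
   probability takes place in averages over finite sets: the X_k are replaced
   by their quantile discretizations, which recover E sup X_t in the limit, and
   in the lower bound a Gaussian variable is replaced by a normalized sum of
   signs.  The lower majorizing measure bound follows from Sudakov minoration
   and concentration for such sums, fed into van Handel's argument, where
   an interpolation functional replaces the greedy choice of centers. *)
Require Import Defs.
From mathcomp Require Import all_boot all_order all_algebra all_fingroup.
From mathcomp Require Import all_classical all_reals all_analysis.
From mathcomp Require Import measurable_realfun zify ring lra.

Set Implicit Arguments.
Unset Strict Implicit.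
Unset Printing Implicit Defensive.

Import Order.TTheory GRing.Theory Num.Theory.
Import numFieldNormedType.Exports.

Local Open Scope classical_set_scope.
Local Open Scope ring_scope.

(** * Averages and maxima over finite sets *)

(** Sudakov minoration fails for general sums of signs: for unit vectors the maximum stays bounded
    however many there are. It needs coefficients that are small compared with the separation.
    Splitting each coordinate into [N.+1] signs of weight [N.+1 ^ (-1/2)] makes them small, but only
    from a threshold on [N] that depends on the finite family at hand. Hence [gauss_sup] asks for
    bounds valid from some [N0] on, and no limit theorem enters.

    The two bounds use different stand-ins for a Gaussian variable. The lower bound needs the
    structure of the cube (flips, concentration) and only an upper estimate of the tail, which sums
    of signs have. The upper bound needs a lower estimate of the tail, which is explicit for the
    quantiles of exponent 2; these are still subgaussian, so that chaining applies to them.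

    Finite laws have bounded support, so a tail can dominate another only if its discretization is
    fine enough on the range of the other. This is the origin of the thresholds [m0] and [m'] in
    [comparison_lower] and [comparison_upper]. *)

Definition avg {R : realType} {A : finType} (f : A -> R) : R :=
  #|A|%:R^-1 * \sum_a f a.

Definition smax {R : realType} {V : Type} (s : seq V) (f : V -> R) : R :=
  if s is x :: s' then \big[Num.max/f x]_(y <- s') f y else 0.

Section Average.
Variables (R : realType) (A : finType).
Implicit Types f g : A -> R.

Lemma eq_avg f g : f =1 g -> avg f = avg g.
Proof. by move=> fg; rewrite /avg (eq_bigr g). Qed.

Lemma avg_le f g : (forall a, f a <= g a) -> avg f <= avg g.
Proof.
by move=> fg; rewrite /avg ler_wpM2l ?invr_ge0 ?ler0n//; apply: ler_sum.
Qed.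

Lemma avg_ge0 f : (forall a, 0 <= f a) -> 0 <= avg f.
Proof.
by move=> f0; rewrite /avg mulr_ge0 ?invr_ge0 ?ler0n ?sumr_ge0.
Qed.

Lemma avgD f g : avg (fun a => f a + g a) = avg f + avg g.
Proof. by rewrite /avg big_split mulrDr. Qed.

Lemma avgZ c f : avg (fun a => c * f a) = c * avg f.
Proof. by rewrite /avg -big_distrr /= mulrCA. Qed.

Lemma avgZr c f : avg (fun a => f a * c) = avg f * c.
Proof. by rewrite mulrC -avgZ; apply: eq_avg => a; rewrite mulrC. Qed.

Lemma avgN f : avg (fun a => - f a) = - avg f.
Proof.
by rewrite -mulN1r -avgZ; apply: eq_avg => a; rewrite mulN1r.
Qed.

Lemma avgB f g : avg (fun a => f a - g a) = avg f - avg g.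
Proof. by rewrite avgD avgN. Qed.

Lemma avg_sum (I : Type) (s : seq I) (P : pred I) (f : I -> A -> R) :
  avg (fun a => \sum_(i <- s | P i) f i a) = \sum_(i <- s | P i) avg (f i).
Proof. by rewrite /avg exchange_big big_distrr. Qed.

Lemma avg_cst (a0 : A) (c : R) : avg (fun _ : A => c) = c.
Proof.
have A0 : #|A|%:R != 0 :> R by rewrite pnatr_eq0 -lt0n; apply/card_gt0P; exists a0.
by rewrite /avg sumr_const -[c *+ _]mulr_natl mulKf.
Qed.

Lemma avg_gt0 (a0 : A) f : (forall a, 0 < f a) -> 0 < avg f.
Proof.
move=> f0; rewrite /avg mulr_gt0 ?invr_gt0 ?ltr0n//.
  by apply/card_gt0P; exists a0.
rewrite (bigD1 a0)//= ltr_pwDl//.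
by rewrite sumr_ge0// => a _; rewrite ltW.
Qed.

Lemma avg_ge_cst (a0 : A) f c : (forall a, c <= f a) -> c <= avg f.
Proof. by move=> fc; rewrite -[leLHS](avg_cst a0); apply: avg_le. Qed.

End Average.

Section Average_products.
Variable R : realType.

Lemma avg_bij (A B : finType) (h : A -> B) (f : B -> R) :
  bijective h -> avg (fun a => f (h a)) = avg f.
Proof.
move=> bh; rewrite /avg (bij_eq_card bh) [in RHS](reindex h)//.
by apply: onW_bij.
Qed.

Lemma avg_pair (A B : finType) (f : A -> B -> R) :
  avg (fun p : A * B => f p.1 p.2) = avg (fun a => avg (f a)).
Proof.
rewrite /avg card_prod natrM invfM -mulrA; congr (_ * _).
by rewrite -(pair_bigA _ f) /= big_distrr.
Qed.

Lemma avg_fst (A B : finType) (b0 : B) (f : A -> R) :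
  avg (fun p : A * B => f p.1) = avg f.
Proof.
by rewrite (avg_pair (fun a _ => f a)); apply: eq_avg => a; rewrite avg_cst.
Qed.

Lemma avg_exchange (A B : finType) (f : A -> B -> R) :
  avg (fun a => avg (f a)) = avg (fun b => avg (fun a => f a b)).
Proof.
rewrite -!avg_pair.
rewrite -(@avg_bij _ _ (fun p : B * A => (p.2, p.1)))//.
by exists (fun p => (p.2, p.1)); case.
Qed.

Lemma avg_pair_ffun (I A B : finType) (f : {ffun I -> A} -> {ffun I -> B} -> R) :
  avg (fun w : {ffun I -> A * B} => f [ffun i => (w i).1] [ffun i => (w i).2]) =
  avg (fun u => avg (f u)).
Proof.
rewrite -avg_pair.
rewrite -(@avg_bij _ _ (fun w : {ffun I -> A * B} =>
  ([ffun i => (w i).1], [ffun i => (w i).2])))//.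
exists (fun p : {ffun I -> A} * {ffun I -> B} => [ffun i => (p.1 i, p.2 i)]).
  by move=> w; apply/ffunP => i; rewrite !ffunE/=; case: (w i).
by move=> [u v]/=; congr (_, _); apply/ffunP => i; rewrite !ffunE.
Qed.

Lemma avg_curry (I J A : finType) (f : {ffun I -> {ffun J -> A}} -> R) :
  avg f = avg (fun w : {ffun I * J -> A} => f [ffun i => [ffun j => w (i, j)]]).
Proof.
rewrite -(@avg_bij _ _ (fun w : {ffun I * J -> A} =>
  [ffun i => [ffun j => w (i, j)]]))//.
exists (fun u : {ffun I -> {ffun J -> A}} => [ffun p => u p.1 p.2]).
  by move=> w; apply/ffunP => -[i j]; rewrite !ffunE.
by move=> u; apply/ffunP => i; apply/ffunP => j; rewrite !ffunE.
Qed.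

Definition upd {I A : finType} (w : {ffun I -> A}) (k : I) (a : A) :
  {ffun I -> A} := [ffun i => if i == k then a else w i].

(** Independence of one coordinate from the others: the involution [h] exchanges the value at [k]
    with the fresh sample. *)
Lemma avg_resample (I A : finType) (k : I) (f : {ffun I -> A} -> R) :
  avg f = avg (fun w => avg (fun a => f (upd w k a))).
Proof.
rewrite -(avg_pair (fun w a => f (upd w k a))).
pose h (p : {ffun I -> A} * A) := (upd p.1 k p.2, p.1 k).
have hK : involutive h.
  move=> [w a]; rewrite /h /=; congr (_, _); last by rewrite ffunE eqxx.
  by apply/ffunP => i; rewrite !ffunE; case: eqP => [->|].
rewrite -(@avg_bij _ _ h) /=; last exact: inv_bij.
case: (pickP [pred a : A | true]) => [a0 _|A0].
  rewrite -(avg_fst a0); apply: eq_avg => -[w a] /=; congr f.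
  by apply/ffunP => i; rewrite !ffunE; case: eqP => // ->.
rewrite /avg !big1 ?mulr0 // => [[w a]|w] _; first by have := A0 a.
by have := A0 (w k).
Qed.

End Average_products.

Section Smax.
Variables (R : realType) (V : eqType).
Implicit Types (s : seq V) (f g : V -> R).

Lemma smax_ge s f x : x \in s -> f x <= smax s f.
Proof.
case: s => // y s; rewrite inE /smax => /orP[/eqP ->|xs].
  elim: s => [|z s ih]; first by rewrite big_nil.
  by rewrite big_cons le_max ih orbT.
elim: s xs => // z s ih; rewrite inE big_cons le_max => /orP[/eqP ->|xs].
  by rewrite lexx.
by rewrite ih ?orbT.
Qed.

Lemma smax_ex s f : s != [::] -> exists2 x, x \in s & smax s f = f x.
Proof.
case: s => // y s _; rewrite /smax; elim: s => [|z s [x xs ih]].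
  by exists y; rewrite ?big_nil ?inE.
rewrite big_cons ih; case: (leP (f z) (f x)) => h.
  by exists x => //; move: xs; rewrite !inE => /orP[->|->]; rewrite ?orbT.
by exists z => //; rewrite !inE eqxx orbT.
Qed.

Lemma smax_le s f c : s != [::] -> (forall x, x \in s -> f x <= c) ->
  smax s f <= c.
Proof. by move=> s0 h; have [x xs ->] := smax_ex f s0; exact: h. Qed.

Lemma smax_le2 s f g : (forall x, x \in s -> f x <= g x) ->
  smax s f <= smax s g.
Proof.
case: s => [|y s] h; first exact: lexx.
by apply: smax_le => // x xs; apply: le_trans (h _ xs) _; apply: smax_ge.
Qed.

Lemma eq_smax s f g : (forall x, x \in s -> f x = g x) ->
  smax s f = smax s g.
Proof.
by move=> h; apply/eqP; rewrite eq_le !smax_le2// => x xs; rewrite h.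
Qed.

Lemma smaxD s f g : smax s (fun x => f x + g x) <= smax s f + smax s g.
Proof.
case: s => [|y s]; first by rewrite /= addr0.
by apply: smax_le => // x xs; apply: lerD; apply: smax_ge.
Qed.

Lemma smaxZ s f c : 0 <= c -> smax s (fun x => c * f x) = c * smax s f.
Proof.
move=> c0; case: (eqVneq s [::]) => [->|s0]; first by rewrite /= mulr0.
apply/eqP; rewrite eq_le; apply/andP; split.
  by apply: smax_le => // x xs; rewrite ler_wpM2l// smax_ge.
by have [x xs ->] := smax_ex f s0; apply: (smax_ge (fun x => c * f x)).
Qed.

Lemma smax_subset s1 s2 f : s1 != [::] -> {subset s1 <= s2} ->
  smax s1 f <= smax s2 f.
Proof. by move=> s0 h; apply: smax_le => // x /h; apply: smax_ge. Qed.

Lemma smax_map (W : eqType) (h : W -> V) (s : seq W) f :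
  smax [seq h x | x <- s] f = smax s (fun x => f (h x)).
Proof. by case: s => //= y s; rewrite big_map. Qed.

End Smax.


(** * Concentration and Sudakov minoration on the discrete cube *)

Section Exponential.
Variable R : realType.
Implicit Types x y q d : R.

(** The tangent line at [z]. Averaged with [z] the mean, it is Jensen's inequality, and it is used
    in this way throughout. *)
Lemma expR_tangent z x : expR z * (1 + (x - z)) <= expR x.
Proof.
have -> : expR x = expR z * expR (x - z) by rewrite -expRD; congr expR; ring.
by rewrite ler_pM2l ?expR_gt0// expR_ge1Dx.
Qed.

Lemma expR_convex q x y : 0 <= q -> q <= 1 ->
  expR ((1 - q) * x + q * y) <= (1 - q) * expR x + q * expR y.
Proof.
move=> q0 q1; set z := _ + _.
have := ler_wpM2l q0 (expR_tangent z y).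
have := ler_wpM2l (_ : 0 <= 1 - q) (expR_tangent z x).
rewrite subr_ge0 => /(_ q1) h1 h2; apply: le_trans (lerD h1 h2).
have -> : (1 - q) * (expR z * (1 + (x - z))) + q * (expR z * (1 + (y - z))) =
  expR z * (1 + ((1 - q) * x + q * y - z)) by ring.
by rewrite -/z subrr addr0 mulr1.

Qed.

Lemma expRN_le x : 0 <= x -> expR (- x) <= (1 + x)^-1.
Proof.
move=> x0; rewrite expRN lef_pV2 ?posrE ?expR_gt0//; last by lra.
exact: expR_ge1Dx.
Qed.

Lemma expR_le_inv x : x < 1 -> expR x <= (1 - x)^-1.
Proof.
move=> x1; rewrite -[x in leLHS]opprK expRN lef_pV2 ?posrE ?expR_gt0//.
  exact: expR_ge1Dx.
by lra.
Qed.

(* The one-coordinate case of [wtransport_expR]. *)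
Lemma two_point d : 0 <= d -> exists q, [/\ 0 <= q, q <= 1 &
  (expR (- d) + expR (- (q * d) + q ^+ 2 / 16)) * (1 + expR d) <= 4].
Proof.
(* The exponent [- (q * d) + q ^+ 2 / 16] is minimal at [q = 8 * d], which is admissible up to
   [d = 1/8]; beyond that [q = 1] is enough. *)
move=> d0; case: (lerP d 8^-1) => hd.
  exists (8 * d); split; [lra|lra|].
  have -> : - (8 * d * d) + (8 * d) ^+ 2 / 16 = - (4 * d ^+ 2) by field.
  have d2 : 0 <= d ^+ 2 by exact: sqr_ge0.
  have e1 := expRN_le d0.
  have e2 : expR (- (4 * d ^+ 2)) <= (1 + 4 * d ^+ 2)^-1 by apply: expRN_le; lra.
  have e3 : expR d <= (1 - d)^-1 by apply: expR_le_inv; lra.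
  have e4 : 1 + expR d <= 2 + d + 2 * d ^+ 2.
    suff : (1 - d)^-1 <= 1 + d + 2 * d ^+ 2 by lra.
    rewrite -[leLHS]mul1r ler_pdivrMr; last by lra.
    have : 0 <= d ^+ 2 * (1 - 2 * d) by apply: mulr_ge0 => //; lra.
    by lra.
  rewrite mulrDl.
  have E : expR (- d) * (1 + expR d) = expR (- d) + 1.
    by rewrite mulrDr mulr1 -expRD addNr expR0.
  rewrite E.
  have e6 : expR (- d) <= 1 - d + d ^+ 2.
    apply: le_trans e1 _; rewrite -[leLHS]mul1r ler_pdivrMr; last by lra.
    by have := mulr_ge0 d0 d2; lra.
  have e7 : expR (- (4 * d ^+ 2)) * (1 + expR d) <= 2 + d - d ^+ 2.
    apply: le_trans (ler_pM (expR_ge0 _) _ e2 e4) _.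
      by have := expR_ge0 d; lra.
    rewrite mulrC ler_pdivrMr; last by lra.
    have d1 : 0 <= d * (1 - d) by rewrite mulr_ge0// subr_ge0; lra.
    have : 0 <= d ^+ 2 * (5 + 4 * (d * (1 - d))) by apply: mulr_ge0 => //; lra.
    by lra.
  lra.
exists 1; split; [lra|lra|].
rewrite mul1r expr1n expRD.
have E : expR (- d) * expR d = 1 by rewrite -expRD addNr expR0.
have e1 : expR (1 / 16) <= 16 / 15 :> R.
  have -> : 16 / 15 = (1 - 1 / 16)^-1 :> R by field.
  by apply: expR_le_inv; lra.
have e2 : expR (- d) <= 8 / 9.
  apply: le_trans (expRN_le d0) _; rewrite -[leLHS]mul1r ler_pdivrMr; lra.
have e0 := expR_ge0 (- d).
have -> : (expR (- d) + expR (- d) * expR (1 / 16)) * (1 + expR d) =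
  (1 + expR (1 / 16)) * (expR (- d) + expR (- d) * expR d) by ring.
rewrite E; apply: le_trans (_ : (1 + 16 / 15) * (8 / 9 + 1) <= _); last by lra.
by apply: ler_pM; have := expR_ge0 (1 / 16 : R); lra.
Qed.

End Exponential.

Section Cube_concentration.
Variables (R : realType) (I : finType).
Notation cube := {ffun I -> bool}.
Implicit Types (f g h : cube -> R) (w : cube) (k : I) (L : seq I).

Definition flip k w : cube := [ffun i => (i == k) (+) w i].

Definition resample k f : cube -> R := fun w => (f w + f (flip k w)) / 2.

Definition resamples L f : cube -> R := foldr resample f L.

Lemma flipK k : involutive (flip k).
Proof. by move=> w; apply/ffunP => i; rewrite !ffunE addKb. Qed.

Lemma flipC k l w : flip k (flip l w) = flip l (flip k w).
Proof. by apply/ffunP => i; rewrite !ffunE addbCA. Qed.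

Lemma resamples_flip L k f w :
  resamples L (fun w => f (flip k w)) w = resamples L f (flip k w).
Proof. by elim: L w => //= l L ih w; rewrite /resample !ih flipC. Qed.

Lemma resamples_le L f g : (forall w, f w <= g w) ->
  forall w, resamples L f w <= resamples L g w.
Proof.
move=> fg; elim: L => //= l L ih w.
by rewrite /resample ler_wpM2r ?invr_ge0 ?ler0n// lerD.
Qed.

Lemma resamples_lin L f g a b w :
  resamples L (fun w => a * f w + b * g w) w =
  a * resamples L f w + b * resamples L g w.
Proof. by elim: L w => //= l L ih w; rewrite /resample !ih; field. Qed.

Lemma resamples_gt0 L f w : (forall w, 0 < f w) -> 0 < resamples L f w.
Proof.
move=> f0; elim: L w => //= l L ih w.
by rewrite /resample divr_gt0 ?ltr0n// addr_gt0.
Qed.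

Lemma avg_resample1 k f : avg (resample k f) = avg f.
Proof.
rewrite /resample avgZr avgD (avg_bij f (inv_bij (flipK k))).
by field.
Qed.

(** [resamples L f] depends only on the coordinates outside [L] (this is [agree]), and each
    resampling preserves the average. *)
Lemma resamples_cst f w : resamples (enum I) f w = avg f.
Proof.
have agree L (u v : cube) : (forall i, i \notin L -> u i = v i) ->
    resamples L f u = resamples L f v.
  elim: L u v => /= [|l L ih] u v uv.
    by congr f; apply/ffunP => i; apply: uv.
  rewrite /resample; have [uvl|uvl] := eqVneq (u l) (v l).
    congr ((_ + _) / 2); apply: ih => i iL.
      have [->//|il] := eqVneq i l; apply: uv.
      by rewrite inE negb_or il.
    rewrite !ffunE; have [->|il] := eqVneq i l; first by rewrite uvl.
    by congr addb; apply: uv; rewrite inE negb_or il.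
  rewrite addrC; congr ((_ + _) / 2); apply: ih => i iL.
    rewrite ffunE; have [->|il] := eqVneq i l.
      by move: uvl; case: (u l) (v l) => [] [].
    by rewrite addFb; apply: uv; rewrite inE negb_or il.
  rewrite ffunE; have [->|il] := eqVneq i l.
    by move: uvl; case: (u l) (v l) => [] [].
  by rewrite addFb; apply: uv; rewrite inE negb_or il.
have -> : avg f = avg (resamples (enum I) f).
  by elim: (enum I) => //= l L ->; rewrite avg_resample1.
rewrite -[LHS](avg_cst w); apply: eq_avg => v; apply: agree => i.
by rewrite mem_enum.
Qed.

(* [wtransport L g f]: [g] lies below the infimum convolution of [f], along the
   coordinates in [L], with the barycentric cost [q ^ 2 / 16] of flipping a
   coordinate with probability [q]. *)
Fixpoint wtransport L g f : Prop :=
  if L is k :: L' then exists h, wtransport L' h f /\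
    forall w q, 0 <= q -> q <= 1 ->
      g w <= (1 - q) * h w + q * h (flip k w) + q ^+ 2 / 16
  else forall w, g w <= f w.

(** An exponential form of Talagrand's convex distance inequality. It tensorizes, so the induction
    adds one coordinate at a time. *)
Lemma wtransport_expR L g f : wtransport L g f -> forall w,
  resamples L (fun w => expR (g w)) w * resamples L (fun w => expR (- f w)) w
    <= 1.
Proof.
elim: L g => /= [|k L ih] g.
  by move=> gf w; rewrite -expRD -expR0 ler_expR subr_le0.
move=> [h [hf gh]] w.
have H := ih _ hf.
set G := resamples L (fun w => expR (g w)).
set a := resamples L (fun w => expR (- f w)).
have a_gt0 u : 0 < a u by apply: resamples_gt0 => ?; exact: expR_gt0.
(* Hölder's inequality with weights [1 - q] and [q], obtained from the convexity of [expR] after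
   subtracting from [h] the logarithmic bounds [p0] and [p1] that the induction hypothesis provides
   at the two ends of the edge. *)
have Gle u q : 0 <= q -> q <= 1 ->
    G u <= (a u)^-1 * expR (- (q * ln (a (flip k u) / a u)) + q ^+ 2 / 16).
  move=> q0 q1.
  set p0 := - ln (a u); set p1 := - ln (a (flip k u)).
  have e0 : expR (- p0) = a u by rewrite opprK lnK ?posrE.
  have e1 : expR (- p1) = a (flip k u) by rewrite opprK lnK ?posrE.
  have -> : - (q * ln (a (flip k u) / a u)) = - p0 + ((1 - q) * p0 + q * p1).
    by rewrite ln_div ?posrE// /p0 /p1; ring.
  rewrite -addrA [expR (- p0 + _)]expRD e0 mulKf ?gt_eqF//.
  set c := _ + q ^+ 2 / 16.
  pose U v := expR (h v); pose V v := expR (h (flip k v)).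
  have : G u <= resamples L (fun v => expR c * (1 - q) * a u * U v +
                          expR c * q * a (flip k u) * V v) u.
    apply: resamples_le => v.
    apply: le_trans (_ : expR ((1 - q) * h v + q * h (flip k v) + q ^+ 2 / 16)
                         <= _).
      by rewrite ler_expR gh.
    have -> : (1 - q) * h v + q * h (flip k v) + q ^+ 2 / 16 =
      c + ((1 - q) * (h v - p0) + q * (h (flip k v) - p1)) by rewrite /c; ring.
    rewrite expRD; apply: le_trans (ler_wpM2l (expR_ge0 _) (expR_convex _ _ _ _)) _ => //.
    by rewrite !expRD e0 e1 /U /V; lra.
  move=> /le_trans; apply; rewrite resamples_lin.
  have -> : resamples L V u = resamples L U (flip k u) by exact: (resamples_flip L k U u).
  have := H u; have := H (flip k u); rewrite -/a => h1 h2.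
  rewrite -[leRHS]mulr1 -!mulrA -mulrDr ler_pM2l ?expR_gt0//.
  have := ler_wpM2l q0 h1; have := ler_wpM2l (_ : 0 <= 1 - q) h2.
  by rewrite subr_ge0 => /(_ q1); rewrite /U; lra.
(* Only the end with the smaller [a] is mixed with its neighbour, with the [q] of [two_point] for
   [d] the logarithm of the ratio; the other end takes [q = 0]. *)
have key u : a u <= a (flip k u) ->
    (G u + G (flip k u)) * (a u + a (flip k u)) <= 4.
  move=> le_a.
  set b := a (flip k u) in le_a *; have b0 : 0 < b by exact: a_gt0.
  have d0 : 0 <= ln (b / a u).
    by rewrite ln_ge0// ler_pdivlMr// mul1r.
  have [q [q0 q1 tp]] := two_point d0.
  have h1 := Gle u q q0 q1.
  have h2 := Gle (flip k u) 0 (lexx _) ler01.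
  rewrite flipK mul0r oppr0 expr0n mul0r addr0 expR0 mulr1 in h2.
  rewrite -/b in h1 h2.
  have Ed : expR (ln (b / a u)) = b / a u by rewrite lnK// posrE divr_gt0.
  rewrite expRN Ed invf_div in tp.
  apply: le_trans tp.
  have u0 := a_gt0 u.
  have -> : forall y, (a u / b + y) * (1 + b / a u) =
    ((a u)^-1 * y + b^-1) * (a u + b).
    by move=> y; field; rewrite !gt_eqF.
  by rewrite ler_pM2r ?addr_gt0// lerD.
rewrite /resample.
suff : (G w + G (flip k w)) * (a w + a (flip k w)) <= 4 by lra.
have [|/ltW le_a] := lerP (a w) (a (flip k w)); first exact: key.
have := key (flip k w); rewrite flipK => /(_ le_a).
by rewrite ![_ (flip k w) + _]addrC.
Qed.

Definition sg (b : bool) : R := if b then 1 else -1.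

Definition lin (u : I -> R) w : R := \sum_i u i * sg (w i).

Lemma lin_flip (u : I -> R) k w : lin u (flip k w) = lin u w - 2 * (u k * sg (w k)).
Proof.
rewrite /lin (bigD1 k)//= [in RHS](bigD1 k)//= ffunE eqxx.
rewrite (eq_bigr (fun i => u i * sg (w i))); first by case: (w k) => /=; ring.
by move=> i ik; rewrite ffunE (negbTE ik).
Qed.

(** The maximizer at [w] is kept after the flip, so a flip of probability [q] loses at most
    [2 * q * x] with [x = u t k * sg (w k)]. The constant 16 completes the square:
    [2 * q * x <= q ^ 2 / 16 + 16 * x ^ 2]. *)
Lemma smax_lin_wtransport (V : eqType) (S : seq V) (u : V -> I -> R) (c : V -> R) L :
  S != [::] ->
  wtransport L (fun w => smax S (fun t => c t + lin (u t) w - 16 * \sum_(k <- L) u t k ^+ 2))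
    (fun w => smax S (fun t => c t + lin (u t) w)).
Proof.
move=> S0; elim: L => /= [|k L ih].
  by move=> w; apply: smax_le2 => t _; rewrite big_nil mulr0 subr0.
eexists; split; first exact: ih.
move=> w q q0 q1.
set h := fun w : cube => smax S (fun t => c t + lin (u t) w - 16 * \sum_(k <- L) u t k ^+ 2).
have [t tS ->] := smax_ex (fun t => c t + lin (u t) w - 16 * \sum_(j <- k :: L) u t j ^+ 2) S0.
rewrite big_cons.
have h1 : c t + lin (u t) w - 16 * \sum_(k <- L) u t k ^+ 2 <= h w.
  exact: (smax_ge (fun t => c t + lin (u t) w - 16 * \sum_(k <- L) u t k ^+ 2)).
have h2 : c t + lin (u t) (flip k w) - 16 * \sum_(k <- L) u t k ^+ 2 <= h (flip k w).
  exact: (smax_ge (fun t => c t + lin (u t) (flip k w) - 16 * \sum_(k <- L) u t k ^+ 2)).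
rewrite lin_flip in h2.
have q1' : 0 <= 1 - q by lra.
have := ler_wpM2l q0 h2; have := ler_wpM2l q1' h1.
have sq : 0 <= (q - 16 * (u t k * sg (w k))) ^+ 2 by exact: sqr_ge0.
have sg2 : sg (w k) ^+ 2 = 1 by rewrite /sg; case: (w k); ring.
move: sq; rewrite sqrrB [(16 * _) ^+ 2]exprMn [(u t k * _) ^+ 2]exprMn sg2.
by rewrite /h; nra.
Qed.

(** In [wtransport_expR] the exponential moment of the smaller function is bounded below by Jensen's
    inequality. What remains controls the deviations of [F] below its mean, uniformly in the number
    of coordinates and of functions. *)
Lemma smax_lin_concentration (V : eqType) (S : seq V) (u : V -> I -> R)
    (c : V -> R) (b : R) :
  S != [::] -> (forall t, t \in S -> \sum_k u t k ^+ 2 <= b) ->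
  let F := fun w => smax S (fun t => c t + lin (u t) w) in
  (avg (fun w => expR (avg F - F w)) <= expR (16 * b) : Prop).
Proof.
move=> S0 ub F.
pose w0 : cube := [ffun=> true].
have W := wtransport_expR (smax_lin_wtransport u c (enum I) S0) w0.
rewrite !resamples_cst in W.
set A := avg (fun w => expR (- F w)) in W.
have A0 : 0 < A by apply: avg_gt0 => // w; exact: expR_gt0.
have B : expR (avg F - 16 * b) <= avg (fun w => expR (smax S
   (fun t => c t + lin (u t) w - 16 * \sum_(k <- enum I) u t k ^+ 2))).
  apply: le_trans (_ : avg (fun w => expR (F w - 16 * b)) <= _).
    set m := avg F - _.
    apply: le_trans (_ : avg (fun w => expR m * (1 + (F w - 16 * b - m))) <= _).
      rewrite avgZ !avgD !(avg_cst w0).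
      by rewrite le_eqVlt; apply/orP; left; apply/eqP; rewrite /m; ring.
    by apply: avg_le => w; exact: expR_tangent.
  apply: avg_le => w; rewrite ler_expR {1}/F.
  have [t tS ->] := smax_ex (fun t => c t + lin (u t) w) S0.
  apply: le_trans (smax_ge _ tS).
  by rewrite lerB// ler_pM2l ?ltr0n// big_enum ub.
rewrite (eq_avg (g := fun w => expR (avg F) * expR (- F w))); last first.
  by move=> w; rewrite expRD.
rewrite avgZ -/A.
have : expR (avg F - 16 * b) * A <= 1.
  by apply: le_trans W; rewrite ler_pM2r.
rewrite expRD expRN mulrAC ler_pdivrMr ?expR_gt0// mul1r; exact.
Qed.

End Cube_concentration.

(** * Gibbs measures on finite label sets *)

Section Gibbs.
Variable R : realType.

Lemma ln_le_subr1 (x : R) : 0 < x -> ln x <= x - 1.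
Proof.
move=> x0; rewrite -ler_expR lnK ?posrE//.
by have := expR_ge1Dx (x - 1); rewrite addrC subrK.
Qed.

Lemma sum_gt0 (L : finType) (F : L -> R) (l0 : L) :
  (forall l, 0 < F l) -> 0 < \sum_l F l.
Proof.
move=> F0; rewrite (bigD1 l0)//= ltr_pwDl// sumr_ge0// => l _.
exact: ltW.
Qed.

(* Flipping the sign of a coordinate with coefficients [v] multiplies the Gibbs
   weight [W l] by [expR (- (2 * b * v l))]. *)
Lemma gibbs_tilt (L : finType) (W v : L -> R) (b : R) (l0 : L) :
  0 < b -> (forall l, 0 < W l) -> (forall l, b * `|v l| <= 1) ->
  let Z := \sum_l W l in
  let W' l := W l * expR (- (2 * b * v l)) in
  (b * expR (- 4) * \sum_l \sum_l' (W l / Z) * (W l' / Z) * (v l - v l') ^+ 2 <=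
  \sum_l v l * (W l / Z) - \sum_l v l * (W' l / \sum_l W' l) : Prop).
Proof.
move=> b0 W0 bv Z W'.
pose e l := expR (- (2 * b * v l)).
have bvl l : - 1 <= b * v l <= 1.
  by rewrite -ler_norml normrM (gtr0_norm b0).
have e_ge l : expR (- 2) <= e l by rewrite ler_expR; have := bvl l; lra.
have e_le l : e l <= expR 2 by rewrite ler_expR; have := bvl l; lra.
have W'0 l : 0 < W' l by rewrite mulr_gt0 ?expR_gt0.
have Z0 : 0 < Z by exact: (sum_gt0 l0).
set Z' := \sum_l W' l; have Z'0 : 0 < Z' by exact: (sum_gt0 l0).
have ZZ : Z' <= expR 2 * Z.
  rewrite /Z' /Z mulr_sumr; apply: ler_sum => l _.
  by rewrite /W' mulrC ler_pM2r//; exact: e_le.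
have key l l' : 2 * b * expR (- 2) * (v l - v l') ^+ 2 <=
    (v l - v l') * (e l' - e l).
  wlog vv : l l' / v l' <= v l.
    move=> H; have [/H//|/ltW/H] := lerP (v l') (v l).
    by have -> : (v l' - v l) ^+ 2 = (v l - v l') ^+ 2 by [ring]; lra.
  have h := expR_tangent (- (2 * b * v l)) (- (2 * b * v l')).
  have h2 : 2 * b * expR (- 2) * (v l - v l') <= e l' - e l.
    apply: le_trans (_ : e l * (2 * b * (v l - v l')) <= _); last first.
      by move: h; rewrite -/(e l) -/(e l'); lra.
    have /(ler_wpM2r _) : expR (- 2) <= e l by [].
    move=> /(_ (2 * b * (v l - v l'))); rewrite mulr_ge0//; last 2 first.
    - by lra.
    - by lra.
    by move=> /(_ isT); lra.
  have : 0 <= v l - v l' by lra.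
  by move=> /ler_wpM2l /(_ _ _ h2); lra.
(* Symmetrized over pairs of labels, the drop of the mean becomes a sum of increments of [v] times
   opposite increments of [e], a decreasing function of [v], so every term is nonnegative. The
   factor [expR (- 4)] combines [expR (- 2)] from [key] with [expR (- 2)] from [ZZ]. *)
pose D := \sum_l \sum_l' W l * W l' * ((v l - v l') * (e l' - e l)).
have DE : \sum_l v l * (W l / Z) - \sum_l v l * (W' l / Z') = D / (2 * (Z * Z')).
  have -> : \sum_l v l * (W l / Z) = (\sum_l v l * W l) / Z.
    by rewrite mulr_suml; apply: eq_bigr => l _; rewrite mulrA.
  have -> : \sum_l v l * (W' l / Z') = (\sum_l v l * W' l) / Z'.
    by rewrite mulr_suml; apply: eq_bigr => l _; rewrite mulrA.
  have -> : D = 2 * ((\sum_l v l * W l) * Z' - (\sum_l v l * W' l) * Z).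
    have -> : (\sum_l v l * W l) * Z' = \sum_l \sum_l' v l * W l * W' l'.
      by rewrite mulr_suml; apply: eq_bigr => l _; rewrite mulr_sumr.
    have -> : (\sum_l v l * W' l) * Z = \sum_l \sum_l' v l * W' l * W l'.
      by rewrite mulr_suml; apply: eq_bigr => l _; rewrite mulr_sumr.
    rewrite -sumrB (eq_bigr (fun l => \sum_l' (v l * W l * W' l' - v l * W' l * W l'))); last first.
      by move=> l _; rewrite sumrB.
    rewrite mulr2n mulrDl mul1r [X in _ = _ + X]exchange_big /= -big_split /=.
    apply: eq_bigr => l _; rewrite -big_split /=; apply: eq_bigr => l' _.
    by rewrite /W' -/(e l) -/(e l'); ring.
  by field; rewrite !gt_eqF.
rewrite DE ler_pdivlMr ?mulr_gt0//.
apply: le_trans (_ : \sum_l \sum_l' W l * W l' * (2 * b * expR (- 2) * (v l - v l') ^+ 2) <= _); last first.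
  apply: ler_sum => l _; apply: ler_sum => l' _.
  by rewrite ler_pM2l ?mulr_gt0.
pose E := \sum_l \sum_l' W l * W l' * (v l - v l') ^+ 2.
have E0 : 0 <= E.
  apply: sumr_ge0 => l _; apply: sumr_ge0 => l' _.
  by rewrite mulr_ge0 ?sqr_ge0// mulr_ge0// ltW.
have -> : \sum_l \sum_l' W l / Z * (W l' / Z) * (v l - v l') ^+ 2 = E / (Z * Z).
  rewrite mulr_suml; apply: eq_bigr => l _; rewrite mulr_suml; apply: eq_bigr => l' _.
  by field; rewrite gt_eqF.
have -> : \sum_l \sum_l' W l * W l' * (2 * b * expR (- 2) * (v l - v l') ^+ 2) =
  2 * b * expR (- 2) * E.
  rewrite mulr_sumr; apply: eq_bigr => l _; rewrite mulr_sumr; apply: eq_bigr => l' _.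
  by ring.
have -> : b * expR (- 4) * (E / (Z * Z)) * (2 * (Z * Z')) =
  (2 * b * E) * (expR (- 4) * (Z' / Z)) by field; rewrite gt_eqF.
have -> : 2 * b * expR (- 2) * E = (2 * b * E) * expR (- 2) by ring.
apply: ler_wpM2l; first by rewrite !mulr_ge0// ltW.
have -> : expR (- 2) = expR (- 4) * expR 2 :> R.
  by rewrite -expRD; congr expR; ring.
by rewrite ler_pM2l ?expR_gt0// ler_pdivrMr.
Qed.

(** [ln Z] is the mean of [x] under [G] plus the entropy of [G], and the entropy is small when [G]
    is concentrated: the heaviest label has mass at least the sum of the squares, and the remaining
    mass costs at most [ln #|L|] per unit. *)
Lemma gibbs_entropy (L : finType) (x : L -> R) (l0 : L) :
  let Z := \sum_l expR (x l) in
  let G l := expR (x l) / Z in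
  (ln Z <= \sum_l G l * x l + ln 2 + (1 - \sum_l G l ^+ 2) * ln #|L|%:R : Prop).
Proof.
move=> Z G.
have Z0 : 0 < Z by apply: (sum_gt0 l0) => l; exact: expR_gt0.
have G0 l : 0 < G l by rewrite divr_gt0// expR_gt0.
have G1 : \sum_l G l = 1 by rewrite -mulr_suml divff// gt_eqF.
have m0 : 0 < #|L|%:R :> R by rewrite ltr0n; apply/card_gt0P; exists l0.
have lnm : 0 <= ln #|L|%:R :> R by rewrite ln_ge0// ler1n -(ltr0n R).
have [ls _ Gmax] : exists2 ls, ls \in enum L & smax (enum L) G = G ls.
  apply: smax_ex; rewrite -size_eq0 -cardT -lt0n; apply/card_gt0P; by exists l0.
have Gls l : G l <= G ls by rewrite -Gmax smax_ge// mem_enum.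
have C_le : \sum_l G l ^+ 2 <= G ls.
  rewrite -[leRHS]mul1r -G1 mulr_suml; apply: ler_sum => l _.
  by rewrite expr2 ler_pM2l.
(* Gibbs' inequality against a law giving mass 1/2 to the heaviest label. *)
pose Q l : R := (l == ls)%:R / 2 + (2 * #|L|%:R)^-1.
have i0 : 0 < (2 * #|L|%:R)^-1 :> R by rewrite invr_gt0 mulr_gt0.
have Q0 l : 0 < Q l by rewrite ltr_wpDl// divr_ge0.
have Q1 : \sum_l Q l = 1.
  rewrite big_split /= -mulr_suml (bigD1 ls)//= eqxx big1 ?addr0; last first.
    by move=> l /negbTE ->.
  rewrite (_ : true%:R = 1)//.
  have -> : \sum_(l : L) (2 * #|L|%:R)^-1 = #|L|%:R * (2 * #|L|%:R)^-1 :> R.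
    by rewrite sumr_const -[LHS]mulr_natl.
  by field; rewrite gt_eqF.
have lnQ l : - ln (Q l) <= ln 2 + (l != ls)%:R * ln #|L|%:R.
  rewrite -lnV ?posrE//; have [->|lls] := eqVneq l ls.
    rewrite mul0r addr0 ler_ln ?posrE ?invr_gt0// /Q eqxx (_ : true%:R = 1)//.
    by rewrite -[leRHS]invrK lef_pV2 ?posrE ?invr_gt0//; lra.
  rewrite mul1r /Q (negbTE lls) mul0r add0r invrK lnM ?posrE//.
have gibbs : \sum_l G l * ln (Q l / G l) <= 0.
  apply: le_trans (_ : \sum_l (Q l - G l) <= _); last by rewrite sumrB Q1 G1 subrr.
  apply: ler_sum => l _.
  have : ln (Q l / G l) <= Q l / G l - 1 by apply: ln_le_subr1; rewrite divr_gt0.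
  move=> /(ler_wpM2l (ltW (G0 l))).
  have -> : G l * (Q l / G l - 1) = Q l - G l by field; rewrite gt_eqF.
  exact.
have lnZ : ln Z = \sum_l G l * x l - \sum_l G l * ln (G l).
  have E : ln Z = \sum_l G l * ln Z by rewrite -mulr_suml G1 mul1r.
  rewrite -sumrB E; apply: eq_bigr => l _.
  have -> : ln (G l) = x l - ln Z by rewrite ln_div ?posrE ?expR_gt0// expRK.
  by ring.
rewrite lnZ -!addrA lerD2l.
apply: le_trans (_ : \sum_l G l * - ln (Q l) <= _).
  rewrite -subr_le0 -sumrN -sumrB.
  rewrite (eq_bigr (fun l => G l * ln (Q l / G l)))//.
  by move=> l _; rewrite ln_div ?posrE//; ring.
apply: le_trans (_ : \sum_l G l * (ln 2 + (l != ls)%:R * ln #|L|%:R) <= _).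
  by apply: ler_sum => l _; rewrite ler_pM2l.
rewrite (eq_bigr (fun l => G l * ln 2 + (G l * (l != ls)%:R) * ln #|L|%:R)); last first.
  by move=> l _; ring.
rewrite big_split /= -mulr_suml -[X in _ + X]mulr_suml G1 mul1r lerD2l.
apply: ler_wpM2r => //.
have : \sum_l G l * (l != ls)%:R + G ls = 1.
  have -> : \sum_l G l * (l != ls)%:R = \sum_(l | l != ls) G l.
    rewrite [RHS]big_mkcond; apply: eq_bigr => l _.
    by case: (l != ls); rewrite ?mulr1 ?mulr0.
  by rewrite -G1 [RHS](bigD1 ls)//= addrC.
by move: C_le; lra.
Qed.

Lemma ln_sum_expR_ge (L : finType) (x : L -> R) (l0 : L) :
  ln #|L|%:R + avg x <= ln (\sum_l expR (x l)).
Proof.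
have m0 : 0 < #|L|%:R :> R by rewrite ltr0n; apply/card_gt0P; exists l0.
have S0 : 0 < \sum_l expR (x l) by apply: (sum_gt0 l0) => l; exact: expR_gt0.
rewrite -ler_expR expRD !lnK ?posrE//.
have : avg (fun l => expR (avg x) * (1 + (x l - avg x))) <= avg (fun l => expR (x l)).
  by apply: avg_le => l; exact: expR_tangent.
rewrite avgZ avgD avgB !(avg_cst l0) subrr addr0 mulr1.
by rewrite {2}/avg ler_pdivlMl.
Qed.

End Gibbs.

Section Bernoulli_sudakov.
Variables (R : realType) (I : finType).
Notation cube := {ffun I -> bool}.

Lemma avg_lin (u : I -> R) : avg (lin u : cube -> R) = 0.
Proof.
rewrite /lin (avg_sum (index_enum I) predT (fun i (w : cube) => u i * sg R (w i))).
rewrite big1// => i _; rewrite avgZ.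
have -> : avg (fun w : cube => sg R (w i)) = 0; last by rewrite mulr0.
have : avg (fun w : cube => sg R (w i)) = - avg (fun w : cube => sg R (w i)).
  rewrite -{1}(avg_bij _ (inv_bij (@flipK I i))) -avgN; apply: eq_avg => w.
  by rewrite ffunE eqxx; case: (w i); rewrite /= ?opprK.
by lra.
Qed.

(** The concentration bound for a family of one function, taken with the opposite coefficients; its
    mean vanishes. *)
Lemma avg_expR_lin (u : I -> R) :
  avg (fun w : cube => expR (lin u w)) <= expR (16 * \sum_i u i ^+ 2).
Proof.
have := @smax_lin_concentration R I unit [:: tt] (fun _ i => - u i) (fun=> 0)
  (\sum_i u i ^+ 2) isT.
have E (w : cube) : smax [:: tt] (fun=> 0 + lin (fun i => - u i) w) = - lin u w.
  rewrite /= big_nil add0r /lin -sumrN; apply: eq_bigr => i _.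
  by rewrite mulNr.
cbv zeta; rewrite (eq_avg E) avgN avg_lin oppr0 => H.
rewrite (eq_avg (g := fun w => expR (0 - smax [:: tt] (fun=> 0 + lin (fun i => - u i) w)))).
  apply: H => _ _; rewrite le_eqVlt; apply/orP; left; apply/eqP.
  by apply: eq_bigr => i _; rewrite sqrrN.
by move=> w; rewrite E sub0r opprK.
Qed.

Variables (L : finType) (u : L -> I -> R) (b : R) (l0 : L).
Hypothesis b0 : 0 < b.
Hypothesis bu : forall l i, b * `|u l i| <= 1.

Let Z (w : cube) := \sum_l expR (b * lin (u l) w).
Let G (w : cube) l := expR (b * lin (u l) w) / Z w.

(* A discrete Gaussian integration by parts. *)
Lemma gibbs_ibp :
  b * expR (- 4) / 2 *
    avg (fun w => \sum_l \sum_l' G w l * G w l' * \sum_i (u l i - u l' i) ^+ 2)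
  <= avg (fun w => \sum_l G w l * lin (u l) w).
Proof.
pose M i (w : cube) := \sum_l u l i * G w l.
have -> : avg (fun w => \sum_l G w l * lin (u l) w) =
    \sum_i avg (fun w : cube => sg R (w i) * M i w).
  rewrite -avg_sum; apply: eq_avg => w.
  rewrite (eq_bigr (fun l => \sum_i sg R (w i) * (u l i * G w l))); last first.
    by move=> l _; rewrite /lin mulr_sumr; apply: eq_bigr => i _; ring.
  rewrite exchange_big /=; apply: eq_bigr => i _.
  by rewrite mulr_sumr.
(* Pairing [w] with [flip i w] changes the sign factor, which turns [M i] into half of its discrete
   derivative in direction [i]; [gibbs_tilt] bounds that derivative. *)
have flipM i : avg (fun w : cube => sg R (w i) * M i w) =
    avg (fun w : cube => sg R (w i) * (M i w - M i (flip i w))) / 2.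
  rewrite -avgZr.
  have -> : avg (fun w : cube => sg R (w i) * (M i w - M i (flip i w)) / 2) =
    avg (fun w : cube => sg R (w i) * M i w) / 2 +
    avg (fun w : cube => sg R (flip i w i) * M i (flip i w)) / 2.
    rewrite -!avgZr -avgD; apply: eq_avg => w.
    by rewrite [in RHS]ffunE eqxx /=; case: (w i) => /=; field.
  rewrite (avg_bij (fun w : cube => sg R (w i) * M i w) (inv_bij (@flipK I i))).
  by field.
rewrite (eq_bigr _ (fun i _ => flipM i)) -mulr_suml.
rewrite [leLHS]mulrAC ler_pM2r ?invr_gt0 ?ltr0n//.
rewrite -avg_sum -avgZ; apply: avg_le => w.
have -> : \sum_l \sum_l' G w l * G w l' * \sum_i (u l i - u l' i) ^+ 2 =
    \sum_i \sum_l \sum_l' G w l * G w l' * (u l i - u l' i) ^+ 2.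
  rewrite [RHS]exchange_big /=; apply: eq_bigr => l _.
  rewrite [RHS]exchange_big /=; apply: eq_bigr => l' _.
  by rewrite mulr_sumr.
rewrite mulr_sumr; apply: ler_sum => i _.
have sg2 : sg R (w i) ^+ 2 = 1 by case: (w i) => /=; ring.
have := @gibbs_tilt R L (fun l => expR (b * lin (u l) w))
   (fun l => sg R (w i) * u l i) b l0 b0.
move=> /(_ (fun l => expR_gt0 _)) H.
apply: le_trans (_ : _ <= _) (le_trans (H _) _).
- rewrite le_eqVlt; apply/orP; left; apply/eqP; congr (_ * _).
  apply: eq_bigr => l _; apply: eq_bigr => l' _; congr (_ * _).
  by rewrite -mulrBr exprMn sg2 mul1r.
- move=> l; rewrite normrM; have -> : `|sg R (w i)| = 1.
    by case: (w i); rewrite /= ?normrN normr1.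
  by rewrite mul1r.
have EW l : expR (b * lin (u l) w) * expR (- (2 * b * (sg R (w i) * u l i))) =
    expR (b * lin (u l) (flip i w)).
  by rewrite -expRD lin_flip; congr expR; ring.
rewrite mulrBr !mulr_sumr (eq_bigr _ (fun l _ => EW l)).
rewrite le_eqVlt; apply/orP; left; apply/eqP; congr (_ - _).
  by apply: eq_bigr => l _; rewrite -mulrA.
by apply: eq_bigr => l _; rewrite EW -mulrA.
Qed.

Lemma gibbs_le_smax :
  avg (fun w => \sum_l G w l * lin (u l) w) <=
  avg (fun w => smax (enum L) (fun l => lin (u l) w)).
Proof.
apply: avg_le => w.
have Z0 : 0 < Z w by apply: (sum_gt0 l0) => l; exact: expR_gt0.
have G1 : \sum_l G w l = 1 by rewrite -mulr_suml divff// gt_eqF.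
rewrite -[leRHS]mul1r -G1 mulr_suml; apply: ler_sum => l _.
rewrite ler_pM2l ?divr_gt0 ?expR_gt0//.
by apply: (smax_ge (fun l => lin (u l) w)); rewrite mem_enum.
Qed.

(** The average of [ln Z] is at least [ln #|L|] by Jensen's inequality, the linear forms being
    centered; [gibbs_entropy] bounds it from above. *)
Lemma gibbs_free_energy :
  (1 - avg (fun w => 1 - \sum_l G w l ^+ 2)) * ln #|L|%:R - ln 2 <=
  b * avg (fun w => \sum_l G w l * lin (u l) w).
Proof.
pose w0 : cube := [ffun=> true].
have : avg (fun w => ln (Z w)) <= avg (fun w => b * (\sum_l G w l * lin (u l) w) + ln 2 +
     (1 - \sum_l G w l ^+ 2) * ln #|L|%:R).
  apply: avg_le => w; apply: le_trans (gibbs_entropy _ l0) _.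
  rewrite !lerD2r le_eqVlt; apply/orP; left; apply/eqP.
  by rewrite mulr_sumr; apply: eq_bigr => l _; rewrite /G /Z; ring.
rewrite 2!avgD avgZ avgZr (avg_cst w0) => h.
suff : ln #|L|%:R <= avg (fun w => ln (Z w)) by lra.
apply: le_trans (_ : avg (fun w => ln #|L|%:R + avg (fun l => b * lin (u l) w)) <= _).
  rewrite avgD (avg_cst w0) (avg_exchange (fun (w : cube) l => b * lin (u l) w)).
  rewrite -[leLHS]addr0 lerD2l; apply: avg_ge0 => l.
  by rewrite avgZ avg_lin mulr0.
by apply: avg_le => w; exact: ln_sum_expR_ge.
Qed.

End Bernoulli_sudakov.

Section Cube_growth.
Variables (R : realType) (I : finType).
Notation cube := {ffun I -> bool}.
Implicit Types (u v : I -> R) (w : cube).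

Lemma linB u v w : lin (fun i => u i - v i) w = lin u w - lin v w.
Proof. by rewrite /lin -sumrB; apply: eq_bigr => i _; rewrite mulrBl. Qed.

Lemma linZ c u w : lin (fun i => c * u i) w = c * lin u w.
Proof. by rewrite /lin mulr_sumr; apply: eq_bigr => i _; rewrite mulrA. Qed.

(* If the Gibbs measure is spread out, [gibbs_ibp] and the separation give the
   bound; if it is concentrated, [gibbs_free_energy] does. *)
Lemma bernoulli_sudakov (L : finType) (u : L -> I -> R) (a : R) :
  (4 <= #|L|)%N -> 0 < a ->
  (forall l l', l != l' -> a ^+ 2 <= \sum_i (u l i - u l' i) ^+ 2) ->
  (forall l i, Num.sqrt (ln #|L|%:R) / a * `|u l i| <= 1) ->
  expR (- 4) / 8 * a * Num.sqrt (ln #|L|%:R) <=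
  avg (fun w => smax (enum L) (fun l => lin (u l) w)).
Proof.
move=> m4 a0 sep ub.
(* This inverse temperature balances the two regimes: both [b * a ^ 2] and [ln #|L| / b] are equal
   to [a * q]. *)
set q := Num.sqrt _ in ub *; set b := q / a in ub.
have ln4 : 2 * ln 2 <= ln #|L|%:R :> R.
  have -> : 2 * ln 2 = ln (2 * 2) :> R by rewrite lnM ?posrE// mulr2n mulrDl mul1r.
  by rewrite ler_ln ?posrE ?ltr0n ?(leq_trans _ m4)// -natrM ler_nat.
have ln20 : 0 < ln 2 :> R by rewrite ln_gt0// ltr1n.
have q2 : q ^+ 2 = ln #|L|%:R by rewrite sqr_sqrtr//; lra.
have q0 : 0 < q by rewrite sqrtr_gt0; lra.
have b0 : 0 < b by exact: divr_gt0.
have [l0 _] : exists l0 : L, true.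
  by have /card_gt0P[l0 _] : (0 < #|L|)%N by [exact: leq_trans m4]; exists l0.
pose G w l := expR (b * lin (u l) w) / \sum_l expR (b * lin (u l) w).
pose M := avg (fun w => \sum_l G w l * lin (u l) w).
have h1 : _ <= M := gibbs_ibp l0 b0 ub.
have h2 : _ <= b * M := gibbs_free_energy u b l0.
have h3 : M <= _ := gibbs_le_smax u b l0.
apply: le_trans h3.
have G0 w l : 0 <= G w l.
  by rewrite divr_ge0 ?expR_ge0 ?sumr_ge0// => ? _; exact: expR_ge0.
have G1 w : \sum_l G w l = 1.
  by rewrite -mulr_suml divff// gt_eqF// (sum_gt0 l0)// => l; exact: expR_gt0.
pose x := avg (fun w => 1 - \sum_l G w l ^+ 2).
have x0 : 0 <= x.
  apply: avg_ge0 => w; rewrite subr_ge0 -(G1 w); apply: ler_sum => l _.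
  rewrite expr2 -[leRHS]mulr1 ler_wpM2l// -(G1 w) (bigD1 l)//= lerDl.
  by apply: sumr_ge0 => l1 _; exact: G0.
have e40 : 0 < expR (- 4) :> R by exact: expR_gt0.
have e41 : expR (- 4) <= 1 :> R by rewrite -[leRHS]expR0 ler_expR; lra.
have hx : b * expR (- 4) / 2 * (a ^+ 2 * x) <= M.
  apply: le_trans h1; apply: ler_wpM2l.
    by rewrite !mulr_ge0 ?invr_ge0 ?ltW.
  rewrite -avgZ; apply: avg_le => w; rewrite -/(G w).
  have -> : 1 - \sum_l G w l ^+ 2 = \sum_l \sum_(l' | l' != l) G w l * G w l'.
    transitivity ((\sum_l G w l) * (\sum_l G w l) - \sum_l G w l ^+ 2).
      by rewrite G1 mulr1.
    rewrite mulr_suml -sumrB; apply: eq_bigr => l _.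
    rewrite mulr_sumr (bigD1 l)//= expr2; ring.
  rewrite mulr_sumr; apply: ler_sum => l _.
  rewrite [leRHS](bigD1 l)//= mulr_sumr ler_wpDl//.
    apply: mulr_ge0; first by apply: mulr_ge0; exact: G0.
    by apply: sumr_ge0 => i _; exact: sqr_ge0.
  apply: ler_sum => l' ll'; rewrite mulrC; apply: ler_wpM2l.
    by apply: mulr_ge0; exact: G0.
  by apply: sep; rewrite eq_sym.
rewrite -/x -q2 in h2.
rewrite -q2 in ln4.
have hx' : expR (- 4) / 2 * x * (a * q) <= M.
  apply: le_trans hx; rewrite le_eqVlt; apply/orP; left; apply/eqP.
  by rewrite /b; field; rewrite gt_eqF.
have hM : (2^-1 - x) * (a * q) <= M.
  have : (2^-1 - x) * q ^+ 2 <= b * M by lra.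
  rewrite /b mulrAC ler_pdivlMr// => h.
  rewrite -(ler_pM2l q0); apply: le_trans h.
  by rewrite le_eqVlt; apply/orP; left; apply/eqP; ring.
have aq0 : 0 < a * q by exact: mulr_gt0.
have [x4|x4] := lerP x 4^-1.
  apply: le_trans hM; rewrite -mulrA; apply: ler_wpM2r; [exact: ltW|lra].
apply: le_trans hx'; rewrite -mulrA; apply: ler_wpM2r; first exact: ltW.
by have := ler_wpM2l (ltW e40) (ltW x4); lra.
Qed.

(** [gibbs_ibp] at inverse temperature [d^-1]. The product of the two Gibbs weights is the inverse
    of [Y w], and the average of [Y] is at most [2 + 2 * expR 16] by [avg_expR_lin], the normalized
    difference having coefficients of square sum 1. *)
Lemma bernoulli_two_points (u v : I -> R) (d : R) :
  0 < d -> \sum_i (u i - v i) ^+ 2 = d ^+ 2 ->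
  (forall i, d^-1 * `|u i| <= 1) -> (forall i, d^-1 * `|v i| <= 1) ->
  expR (- 4) / (2 + 2 * expR 16) * d <=
  avg (fun w => Num.max (lin u w) (lin v w)).
Proof.
move=> d0 uv ud vd.
pose f (l : bool) := if l then u else v.
have b0 : 0 < d^-1 by rewrite invr_gt0.
have bf l i : d^-1 * `|f l i| <= 1 by case: l; [exact: ud|exact: vd].
have h1 := gibbs_ibp true b0 bf.
have h3 := gibbs_le_smax f d^-1 true.
have mE w : smax (enum {: bool}) (fun l => lin (f l) w) <= Num.max (lin u w) (lin v w).
  apply: smax_le => [|l _].
    by rewrite -size_eq0 -cardT card_bool.
  by rewrite le_max; case: l; rewrite lexx ?orbT.
apply: le_trans (avg_le mE); apply: le_trans h3; apply: le_trans h1.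
pose X w := d^-1 * (lin u w - lin v w).
pose Y w := 2 + expR (X w) + expR (- X w).
have Y0 w : 0 < Y w by have := expR_gt0 (X w); have := expR_gt0 (- X w); rewrite /Y; lra.
have E w : 2 * (Y w)^-1 * d ^+ 2 <= \sum_l \sum_l'
   (expR (d^-1 * lin (f l) w) / (\sum_l0 expR (d^-1 * lin (f l0) w)) *
   (expR (d^-1 * lin (f l') w) / (\sum_l0 expR (d^-1 * lin (f l0) w))) *
   \sum_i (f l i - f l' i) ^+ 2).
  rewrite !big_bool /= uv.
  have -> : \sum_i (v i - u i) ^+ 2 = d ^+ 2.
    by rewrite -uv; apply: eq_bigr => i _; ring.
  have -> : \sum_i (u i - u i) ^+ 2 = 0.
    by rewrite big1// => i _; rewrite subrr expr0n.
  have -> : \sum_i (v i - v i) ^+ 2 = 0.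
    by rewrite big1// => i _; rewrite subrr expr0n.
  set p := expR (d^-1 * lin u w); set q := expR (d^-1 * lin v w).
  have p0 : 0 < p by exact: expR_gt0. have q0 : 0 < q by exact: expR_gt0.
  have -> : Y w = 2 + p / q + q / p.
    by rewrite /Y /X mulrBr opprB !expRD !expRN.
  rewrite le_eqVlt; apply/orP; left; apply/eqP.
  by field; rewrite !gt_eqF// !(addr_gt0, mulr_gt0).
apply: le_trans (ler_wpM2l _ (avg_le E)); last by rewrite !mulr_ge0 ?invr_ge0 ?expR_ge0// ltW.
rewrite avgZr avgZ.
pose w0 : cube := [ffun=> true].
set c := 2 + 2 * expR 16.
have c0 : 0 < c by have := expR_gt0 (16 : R); rewrite /c; lra.
have Yc : avg Y <= c.
  have d2 : \sum_i (d^-1 * (u i - v i)) ^+ 2 = 1.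
    rewrite (eq_bigr (fun i => d^-1 ^+ 2 * (u i - v i) ^+ 2)) => [|i _]; last by rewrite exprMn.
    by rewrite -mulr_sumr uv -exprMn mulVf ?expr1n// gt_eqF.
  have e1 := avg_expR_lin (fun i => d^-1 * (u i - v i)).
  have e2 := avg_expR_lin (fun i => - (d^-1 * (u i - v i))).
  rewrite (eq_bigr (fun i => (d^-1 * (u i - v i)) ^+ 2)) in e2; last by move=> i _; rewrite sqrrN.
  rewrite d2 mulr1 in e1 e2.
  rewrite (eq_avg (g := fun w => expR (X w))) in e1; last first.
    by move=> w; rewrite linZ linB.
  rewrite (eq_avg (g := fun w => expR (- X w))) in e2; last first.
    move=> w; congr expR; rewrite /X -linB -linZ /lin -sumrN.
    by apply: eq_bigr => i _; rewrite mulNr.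
  by rewrite /Y !avgD (avg_cst w0) /c; lra.
(* Convexity of the inverse, through its tangent line at [c]. *)
have V : c^-1 <= avg (fun w => (Y w)^-1).
  apply: le_trans (_ : avg (fun w => 2 / c - Y w / c ^+ 2) <= _).
    rewrite avgB (avg_cst w0) avgZr.
    have : avg Y / c ^+ 2 <= c / c ^+ 2 by rewrite ler_pM2r// invr_gt0 exprn_gt0.
    have -> : c / c ^+ 2 = c^-1 by field; rewrite gt_eqF.
    by lra.
  apply: avg_le => w; rewrite -subr_ge0.
  have -> : (Y w)^-1 - (2 / c - Y w / c ^+ 2) = (Y w - c) ^+ 2 / (Y w * c ^+ 2).
    by field; rewrite !gt_eqF.
  by rewrite divr_ge0 ?sqr_ge0// mulr_ge0 ?sqr_ge0// ltW.
have -> : expR (- 4) / c * d = d^-1 * expR (- 4) / 2 * (2 * c^-1 * d ^+ 2).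
  by field; rewrite !gt_eqF.
apply: ler_wpM2l; first by rewrite !mulr_ge0 ?invr_ge0 ?expR_ge0// ltW.
by rewrite ler_wpM2r ?sqr_ge0// ler_wpM2l.
Qed.

(** The maximum over the union is at least the maximum over the centers [t l], plus [y], minus the
    largest downward deviation [D] of the local suprema. By concentration [D] has mean at most
    [8 * s * a * q], where [q] is the square root of [ln #|L|]; the choice of [s] makes this half of
    the Sudakov bound. *)
Lemma cube_growth (V : eqType) (u : V -> I -> R) (L : finType) (t : L -> V)
    (H : L -> seq V) (a s y : R) :
  (4 <= #|L|)%N -> 0 < a -> s = expR (- 4) / 128 ->
  (forall l l', l != l' -> a ^+ 2 <= \sum_i (u (t l) i - u (t l') i) ^+ 2) ->
  (forall l i, Num.sqrt (ln #|L|%:R) / a * `|u (t l) i| <= 1) ->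
  (forall l, H l != [::]) ->
  (forall l x, x \in H l -> \sum_i (u x i - u (t l) i) ^+ 2 <= (s * a) ^+ 2) ->
  (forall l, y <= avg (fun w => smax (H l) (fun x => lin (u x) w))) ->
  expR (- 4) / 16 * a * Num.sqrt (ln #|L|%:R) + y <=
  avg (fun w => smax (flatten [seq H l | l <- enum L]) (fun x => lin (u x) w)).
Proof.
move=> m4 a0 sE sep ub H0 Hs yle.
have sud := bernoulli_sudakov m4 a0 sep ub.
set q := Num.sqrt _ in ub sud *.
have lnm : 0 < ln #|L|%:R :> R by rewrite ln_gt0// ltr1n; exact: leq_trans m4.
have q2 : q ^+ 2 = ln #|L|%:R by rewrite sqr_sqrtr// ltW.
have q0 : 0 < q by rewrite sqrtr_gt0.
have [l0 _] : exists l0 : L, true.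
  by have /card_gt0P[l0 _] : (0 < #|L|)%N by [exact: leq_trans m4]; exists l0.
have m0 : 0 < #|L|%:R :> R by rewrite ltr0n; apply: leq_trans m4.
have e0 : enum L != [::].
  by rewrite -size_eq0 -cardT -lt0n; apply/card_gt0P; exists l0.
pose w0 : cube := [ffun=> true].
pose Y l w := smax (H l) (fun x => lin (fun i => u x i - u (t l) i) w).
have YE l w : Y l w = smax (H l) (fun x => lin (u x) w) - lin (u (t l)) w.
  apply/eqP; rewrite eq_le; apply/andP; split.
    apply: smax_le => // x xH; rewrite linB lerD2r.
    exact: (smax_ge (fun x => lin (u x) w)).
  have [x xH ->] := smax_ex (fun x => lin (u x) w) (H0 l).
  by rewrite -linB; exact: (smax_ge (fun x => lin (fun i => u x i - u (t l) i) w)).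
have avgY l : avg (Y l) = avg (fun w => smax (H l) (fun x => lin (u x) w)).
  by rewrite (eq_avg (YE l)) avgB avg_lin subr0.
pose D w := smax (enum L) (fun l => avg (Y l) - Y l w).
have s0 : 0 < s by rewrite sE divr_gt0// expR_gt0.
pose b := s * a; have b0 : 0 < b by exact: mulr_gt0.
(* Chosen so that [16 * (lam * b) ^ 2 = q ^ 2 = ln #|L|]; the bound [2 * q ^ 2 / lam] on the average
   of [D] is then [8 * b * q]. *)
pose lam := q / (4 * b); have lam0 : 0 < lam by rewrite divr_gt0// mulr_gt0.
have conc l : avg (fun w => expR (lam * (avg (Y l) - Y l w))) <= expR (16 * (lam * b) ^+ 2).
  have := @smax_lin_concentration R I V (H l) (fun x i => lam * (u x i - u (t l) i))
    (fun=> 0) ((lam * b) ^+ 2) (H0 l).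
  cbv zeta.
  have E w : smax (H l) (fun x => 0 + lin (fun i => lam * (u x i - u (t l) i)) w) = lam * Y l w.
    rewrite /Y -smaxZ ?ltW//; apply: eq_smax => x _.
    by rewrite add0r linZ.
  rewrite (eq_avg E) avgZ => h.
  rewrite (eq_avg (g := fun w => expR (lam * avg (Y l) -
    smax (H l) (fun x => 0 + lin (fun i => lam * (u x i - u (t l) i)) w)))).
    apply: h => x xH; rewrite (eq_bigr (fun i => lam ^+ 2 * (u x i - u (t l) i) ^+ 2)).
      by rewrite -mulr_sumr [leRHS]exprMn ler_wpM2l ?sqr_ge0// Hs.
    by move=> i _; rewrite exprMn.
  by move=> w; rewrite E mulrBr.
have avgD_le : avg D <= 8 * b * q.
  set c := #|L|%:R * expR (16 * (lam * b) ^+ 2).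
  have c0 : 0 < c by rewrite mulr_gt0// expR_gt0.
  (* The logarithm is replaced by its tangent at [c], a bound for the average of the sum of
     exponentials, so that averaging commutes with it. *)
  have pt w : lam * D w <= ln c - 1 + (\sum_l expR (lam * (avg (Y l) - Y l w))) / c.
    set S := \sum_l _.
    have S0 : 0 < S by apply: (sum_gt0 l0) => l; exact: expR_gt0.
    have h1 : expR (lam * D w) <= S.
      rewrite /D; have [l _ ->] := smax_ex (fun l => avg (Y l) - Y l w) e0.
      rewrite /S (bigD1 l)//= lerDl sumr_ge0// => l' _; exact: expR_ge0.
    have h2 : lam * D w <= ln S by rewrite -ler_expR lnK.
    have h3 : ln (S / c) <= S / c - 1 by apply: ln_le_subr1; rewrite divr_gt0.
    by rewrite ln_div ?posrE// in h3; lra.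
  have := avg_le pt; rewrite avgZ avgD (avg_cst w0) avgZr avg_sum.
  have : (\sum_l avg (fun w => expR (lam * (avg (Y l) - Y l w)))) / c <= 1.
    rewrite ler_pdivrMr// mul1r.
    apply: le_trans (_ : \sum_(l : L) expR (16 * (lam * b) ^+ 2) <= _).
      by apply: ler_sum => l _; exact: conc.
    by rewrite sumr_const -[leLHS]mulr_natl.
  rewrite /c lnM ?posrE ?expR_gt0// expRK -q2 => h1 h2.
  have h3 : lam * avg D <= q ^+ 2 + 16 * (lam * b) ^+ 2 by lra.
  have E : lam * b = q / 4 by rewrite /lam; field; rewrite gt_eqF.
  rewrite E in h3.
  rewrite -(ler_pM2l lam0); apply: le_trans h3 _.
  rewrite (_ : lam * (8 * b * q) = 8 * (lam * b) * q); last by ring.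
  by rewrite E le_eqVlt; apply/orP; left; apply/eqP; field.
apply: le_trans (_ : avg (fun w => smax (enum L) (fun l => lin (u (t l)) w) + y - D w) <= _).
  rewrite avgB avgD (avg_cst w0).
  have : 8 * b * q = expR (- 4) / 16 * a * q by rewrite /b sE; field.
  by lra.
apply: avg_le => w.
have [l _ ->] := smax_ex (fun l => lin (u (t l)) w) e0.
have h1 : avg (Y l) - Y l w <= D w.
  by apply: (smax_ge (fun l => avg (Y l) - Y l w)); rewrite mem_enum.
have h2 := YE l w.
have h3 := yle l; rewrite -avgY in h3.
have h4 : smax (H l) (fun x => lin (u x) w) <=
     smax (flatten [seq H l | l <- enum L]) (fun x => lin (u x) w).
  apply: smax_subset => // x xH; apply/flattenP; exists (H l) => //.
  by apply: map_f; rewrite mem_enum.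
by lra.
Qed.

End Cube_growth.

(** * Euclidean distance and the Gaussian supremum functional *)

Section Euclidean.
Variables (R : realType) (n : nat).
Implicit Types x y z : 'rV[R]_n.

Lemma d2_ge0 x y : 0 <= d2 x y.
Proof. exact: sqrtr_ge0. Qed.

Lemma sqr_d2 x y : d2 x y ^+ 2 = \sum_(k < n) (x ord0 k - y ord0 k) ^+ 2.
Proof. by rewrite sqr_sqrtr// sumr_ge0// => k _; exact: sqr_ge0. Qed.

Lemma d2C x y : d2 x y = d2 y x.
Proof. by congr Num.sqrt; apply: eq_bigr => k _; rewrite -opprB sqrrN. Qed.

Lemma d2xx x : d2 x x = 0.
Proof.
by rewrite /d2 big1 ?sqrtr0// => k _; rewrite subrr expr0n.
Qed.

Lemma d2_eq0 x y : d2 x y = 0 -> x = y.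
Proof.
move=> h; have := sqr_d2 x y; rewrite h expr0n => /esym/eqP.
rewrite psumr_eq0 => [/allP xy|k _]; last exact: sqr_ge0.
apply/rowP => k; apply/eqP; rewrite -subr_eq0 -sqrf_eq0.
by have := xy k (mem_index_enum k).
Qed.

Lemma cauchy_schwarz (I : finType) (a b : I -> R) :
  \sum_i a i * b i <=
  Num.sqrt (\sum_i a i ^+ 2) * Num.sqrt (\sum_i b i ^+ 2).
Proof.
set A := \sum_i a i ^+ 2; set B := \sum_i b i ^+ 2.
have A0 : 0 <= A by apply: sumr_ge0 => i _; exact: sqr_ge0.
have B0 : 0 <= B by apply: sumr_ge0 => i _; exact: sqr_ge0.
have zero (c e : I -> R) : \sum_i c i ^+ 2 = 0 -> \sum_i c i * e i = 0.
  move=> /eqP; rewrite psumr_eq0 => [/allP c0|i _]; last exact: sqr_ge0.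
  rewrite big1// => i _; have := c0 i (mem_index_enum i).
  by rewrite sqrf_eq0 => /eqP ->; rewrite mul0r.
have [A00|A1] := eqVneq A 0; first by rewrite zero// A00 sqrtr0 mul0r.
have [B00|B1] := eqVneq B 0.
  by under eq_bigr do rewrite mulrC; rewrite zero// B00 sqrtr0 mulr0.
set p := Num.sqrt A; set q := Num.sqrt B.
have p0 : 0 < p by rewrite sqrtr_gt0 lt_def A1.
have q0 : 0 < q by rewrite sqrtr_gt0 lt_def B1.
have pA : p ^+ 2 = A by rewrite sqr_sqrtr.
have qB : q ^+ 2 = B by rewrite sqr_sqrtr.
apply: le_trans (_ : \sum_i (q / (2 * p) * a i ^+ 2 + p / (2 * q) * b i ^+ 2) <= _).
  apply: ler_sum => i _; rewrite -subr_ge0.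
  have -> : q / (2 * p) * a i ^+ 2 + p / (2 * q) * b i ^+ 2 - a i * b i =
    (q * a i - p * b i) ^+ 2 / (2 * p * q) by field; rewrite !gt_eqF.
  by rewrite divr_ge0 ?sqr_ge0// !mulr_ge0// ltW.
rewrite big_split /= -!mulr_sumr -/A -/B -pA -qB.
by rewrite le_eqVlt; apply/orP; left; apply/eqP; field; rewrite !gt_eqF.
Qed.

Lemma d2_triangle y x z : d2 x z <= d2 x y + d2 y z.
Proof.
rewrite -(@ler_pXn2r _ 2)// ?nnegrE ?addr_ge0 ?d2_ge0//.
rewrite sqrrD !sqr_d2.
have := cauchy_schwarz (fun k => x ord0 k - y ord0 k) (fun k => y ord0 k - z ord0 k).
rewrite -/(d2 x y) -/(d2 y z) => h.
apply: le_trans (_ : _ <= \sum_(k < n) (x ord0 k - y ord0 k) ^+ 2 +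
   (\sum_(k < n) (x ord0 k - y ord0 k) * (y ord0 k - z ord0 k)) *+ 2 +
   \sum_(k < n) (y ord0 k - z ord0 k) ^+ 2) _.
  rewrite -sumrMnl -!big_split /=.
  by apply: ler_sum => k _; rewrite le_eqVlt; apply/orP; left; apply/eqP; ring.
by rewrite lerD2r lerD2l lerMn2r.
Qed.

End Euclidean.

Section Gaussian_functional.
Variables (R : realType) (n : nat).
Notation V := 'rV[R]_n.
Implicit Types (A T : set V) (S : seq V) (t : V).

Definition spread N t (p : 'I_n * 'I_N.+1) : R :=
  t ord0 p.1 / Num.sqrt N.+1%:R.

Definition rademacher_max N S : R :=
  avg (fun w : {ffun 'I_n * 'I_N.+1 -> bool} =>
         smax S (fun t => lin (spread t) w)).

(* A stand-in for the Gaussian [E sup_(t in A)], which would be the limit of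
   [rademacher_max N] as [N] tends to infinity. *)
Definition gauss_sup A : R :=
  sup [set x | exists S N0, [/\ S != [::], (forall t, t \in S -> A t) &
                  forall N, (N0 <= N)%N -> x <= rademacher_max N S]].

Lemma sum_spread N (f : 'I_n -> R) :
  \sum_(p : 'I_n * 'I_N.+1) (f p.1 / Num.sqrt N.+1%:R) ^+ 2 = \sum_k f k ^+ 2.
Proof.
have N0 : 0 < N.+1%:R :> R by rewrite ltr0n.
rewrite -(pair_bigA _ (fun k (i : 'I_N.+1) => (f k / Num.sqrt N.+1%:R) ^+ 2)) /=.
apply: eq_bigr => k _; rewrite sumr_const card_ord exprMn exprVn sqr_sqrtr ?ltW//.
by rewrite -mulrnAr -[_ *+ N.+1]mulr_natr mulVf ?mulr1// gt_eqF.
Qed.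

Lemma sum_spreadB N x y :
  \sum_p (@spread N x p - spread y p) ^+ 2 = d2 x y ^+ 2.
Proof.
rewrite sqr_d2 -(@sum_spread N); apply: eq_bigr => p _.
by rewrite /spread mulrBl.
Qed.

(** Provides the smallness of coefficients that [bernoulli_sudakov] and [bernoulli_two_points]
    require. Its threshold is the one in [gauss_sup]. *)
Lemma spread_small (L : finType) (t : L -> V) (K : R) : 0 <= K ->
  exists N0, forall N, (N0 <= N)%N -> forall l p, K * `|@spread N (t l) p| <= 1.
Proof.
move=> K0; pose C := \sum_l \sum_k K * `|t l ord0 k|.
have t0 l k : 0 <= K * `|t l ord0 k| by rewrite mulr_ge0.
have C0 : 0 <= C by apply: sumr_ge0 => l _; apply: sumr_ge0 => k _.
exists (Num.bound (C ^+ 2)) => N hN l [k i].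
have N0 : 0 < N.+1%:R :> R by rewrite ltr0n.
rewrite /spread /= normrM normfV (ger0_norm (sqrtr_ge0 _)) mulrA.
rewrite ler_pdivrMr ?sqrtr_gt0// mul1r.
apply: le_trans (_ : C <= _).
  rewrite /C (bigD1 l)//= (bigD1 k)//= -addrA lerDl addr_ge0//.
    by apply: sumr_ge0.
  by apply: sumr_ge0 => l' _; apply: sumr_ge0.
rewrite -(ger0_norm C0) -sqrtr_sqr ler_sqrt//.
apply: le_trans (ltW (archi_boundP (sqr_ge0 C))) _.
by rewrite ler_nat; apply: leq_trans hN _.
Qed.

Lemma rademacher_max_sub N S1 S2 : S1 != [::] -> {subset S1 <= S2} ->
  rademacher_max N S1 <= rademacher_max N S2.
Proof. by move=> S0 S12; apply: avg_le => w; exact: smax_subset. Qed.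

Lemma rademacher_max_ge0 N S : S != [::] -> 0 <= rademacher_max N S.
Proof.
case: S => // x S _; apply: le_trans (@rademacher_max_sub N [:: x] _ _ _) => //.
  rewrite /rademacher_max (eq_avg (g := lin (@spread N x))) ?avg_lin//.
  by move=> w; rewrite /= big_nil.
by move=> y; rewrite !inE => /eqP ->; rewrite eqxx.
Qed.

Variables (T : set V) (B : R).
Hypothesis TB : forall N S, S != [::] -> (forall t, t \in S -> T t) ->
  rademacher_max N S <= B.

(** The bound [TB] is what gives meaning to [gauss_sup]: the real [sup] of an unbounded set is a
    default value. *)
Lemma gauss_sup_has_sup A : A !=set0 -> A `<=` T ->
  has_sup [set x | exists S N0, [/\ S != [::], (forall t, t \in S -> A t) &
                  forall N, (N0 <= N)%N -> x <= rademacher_max N S]].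
Proof.
move=> [a Aa] AT; split.
  exists 0, [:: a], 0%N; split=> // [t|N _]; first by rewrite inE => /eqP ->.
  exact: rademacher_max_ge0.
exists B => x [S [N0 [S0 SA /(_ N0 (leqnn _)) h]]].
by apply: le_trans h _; apply: TB => // t /SA /AT.
Qed.

Lemma gauss_sup_ge A S N0 x : A `<=` T -> S != [::] ->
  (forall t, t \in S -> A t) ->
  (forall N, (N0 <= N)%N -> x <= rademacher_max N S) -> x <= gauss_sup A.
Proof.
move=> AT S0 SA h; apply: ub_le_sup; last by exists S, N0.
have [|_ //] := gauss_sup_has_sup _ AT.
by case: S S0 SA {h} => // a S _ SA; exists a; apply: SA; rewrite mem_head.
Qed.

Lemma gauss_sup_approx A e : A !=set0 -> A `<=` T -> 0 < e ->
  exists S N0, [/\ S != [::], (forall t, t \in S -> A t) &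
     forall N, (N0 <= N)%N -> gauss_sup A - e <= rademacher_max N S].
Proof.
move=> A0 AT e0.
have [x [S [N0 [S0 SA h]]] xe] := sup_adherent e0 (gauss_sup_has_sup A0 AT).
exists S, N0; split => // N /h; apply: le_trans; exact: ltW.
Qed.

Lemma gauss_sup_mono A A' : A !=set0 -> A `<=` A' -> A' `<=` T ->
  gauss_sup A <= gauss_sup A'.
Proof.
move=> A0 AA' A'T; apply: ge_sup.
  by have [] := gauss_sup_has_sup A0 (subset_trans AA' A'T).
move=> x [S [N0 [S0 SA h]]].
by apply: (gauss_sup_ge A'T S0 _ h) => t /SA /AA'.
Qed.

(** [cube_growth] on near-optimal finite subsets, for all [N] above the finitely many thresholds.
    Since [ln 2 >= 1/4], the square root of [ln (2 ^ 2 ^ k)] is at least half of [Num.sqrt 2 ^+ k],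
    which halves the constant; [0 < k] ensures the four labels needed there. *)
Lemma gauss_sup_growth k (a y : R) (t : 'I_(2 ^ 2 ^ k) -> V) (H : 'I_(2 ^ 2 ^ k) -> set V) :
  (0 < k)%N -> 0 < a ->
  (forall l l', l != l' -> a <= d2 (t l) (t l')) ->
  (forall l, H l !=set0) -> (forall l, H l `<=` T) ->
  (forall l x, H l x -> d2 x (t l) <= expR (- 4) / 128 * a) ->
  (forall l, y <= gauss_sup (H l)) ->
  expR (- 4) / 32 * a * Num.sqrt 2 ^+ k + y <= gauss_sup (\bigcup_l H l).
Proof.
move=> k0 a0 sep H0 HT Hs yle.
apply/ler_addgt0Pr => e e0; rewrite -lerBlDr.
have /choice[S /choice[N0 SN]] l := gauss_sup_approx (H0 l) (HT l) e0.
have m4 : (4 <= #|'I_(2 ^ 2 ^ k)|)%N.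
  by rewrite card_ord; apply: (@leq_pexp2l 2 2) => //; apply: (@leq_pexp2l 2 1).
set q := Num.sqrt (ln #|'I_(2 ^ 2 ^ k)|%:R : R).
have qa0 : 0 <= q / a by rewrite divr_ge0 ?sqrtr_ge0// ltW.
have [N1 hN1] := spread_small t qa0.
apply: (@gauss_sup_ge _ (flatten [seq S l | l <- enum 'I_(2 ^ 2 ^ k)])
  (maxn N1 (\max_l N0 l))).
- by move=> x [l _ /HT].
- pose l0 : 'I_(2 ^ 2 ^ k) := Ordinal (expn_gt0 2 (2 ^ k) : 0 < _)%N.
  have [Sl0 _ _] := SN l0; case E : (S l0) Sl0 => [//|x s] _.
  suff : x \in flatten [seq S l | l <- enum 'I_(2 ^ 2 ^ k)] by case: flatten.
  by apply/flattenP; exists (S l0); rewrite ?E ?mem_head// -E map_f ?mem_enum.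
- move=> x /flattenP[_ /mapP[l _ ->] xS]; exists l => //.
  by have [_ h _] := SN l; exact: h.
move=> N; rewrite geq_max => /andP[NN1 NN0].
have := @cube_growth R _ V (@spread N) _ t S a (expR (- 4) / 128) (y - e) m4 a0 erefl.
rewrite -/q => h.
apply: (le_trans _ (h _ _ _ _ _)).
- rewrite -addrA lerD2r -[leLHS]mulrA -[leRHS]mulrA.
  rewrite (_ : expR (-4) / 32 = expR (- 4) / 16 / 2); last by field.
  rewrite -[leLHS]mulrA; apply: ler_wpM2l; first by rewrite divr_ge0// expR_ge0.
  rewrite mulrCA; apply: ler_wpM2l; first exact: ltW.
  have s0 : 0 <= Num.sqrt 2 ^+ k / 2 :> R by rewrite divr_ge0// exprn_ge0// sqrtr_ge0.
  rewrite mulrC -(ger0_norm s0) -sqrtr_sqr ler_sqrt; last first.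
    by rewrite ln_ge0// ler1n; apply: leq_trans m4.
  rewrite exprMn -exprM mulnC exprM sqr_sqrtr// card_ord.
  rewrite natrX lnXn// -[leRHS]mulr_natl natrX.
  rewrite ler_pM2l ?exprn_gt0//.
  have : ln (2^-1) <= 2^-1 - 1 :> R by apply: ln_le_subr1; rewrite invr_gt0.
  rewrite lnV ?posrE//.
  have -> : (2^-1 ^+ 2 = 4^-1 :> R) by field.
  by lra.
- move=> l l' /sep h'; rewrite sum_spreadB ler_pXn2r ?nnegrE ?d2_ge0//.
  exact: ltW.
- by move=> l p; apply: hN1.
- by move=> l; have [] := SN l.
- move=> l x xS; rewrite sum_spreadB ler_pXn2r ?nnegrE ?d2_ge0//.
    by apply: Hs; have [_ h' _] := SN l; exact: h'.
  by rewrite mulr_ge0 ?divr_ge0 ?expR_ge0// ltW.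
- move=> l; have [_ _ h'] := SN l.
  apply: le_trans (h' N _); first by rewrite lerB.
  exact: leq_trans (leq_bigmax l) NN0.
Qed.

Lemma gauss_sup_diam x y : T x -> T y ->
  expR (- 4) / (2 + 2 * expR 16) * d2 x y <= gauss_sup T.
Proof.
move=> Tx Ty.
have [d0|d0] := leP (d2 x y) 0.
  apply: le_trans (_ : 0 <= _).
    by apply: mulr_ge0_le0.
  apply: (@gauss_sup_ge _ [:: x] 0) => // [t|N _]; first by rewrite inE => /eqP ->.
  exact: rademacher_max_ge0.
pose f (b : bool) := if b then x else y.
have di0 : 0 <= (d2 x y)^-1 by rewrite invr_ge0 d2_ge0.
have [N0 hN0] := spread_small f di0.
apply: (@gauss_sup_ge _ [:: x; y] N0) => // [t|N NN0].
  by rewrite !inE => /orP[|] /eqP ->.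
apply: le_trans (bernoulli_two_points d0 (@sum_spreadB N x y) _ _) _.
- by move=> p; apply: (hN0 _ NN0 true).
- by move=> p; apply: (hN0 _ NN0 false).
- apply: avg_le => w; rewrite ge_max.
  by apply/andP; split; apply: (smax_ge (fun t => lin (spread t) w)); rewrite !inE eqxx ?orbT.
Qed.

End Gaussian_functional.

(** * Majorizing measures *)

Section Separated_families.
Variables (R : realType) (V : Type) (d : V -> V -> R).
Hypothesis dC : forall x y, d x y = d y x.
Hypothesis d_triangle : forall y x z, d x z <= d x y + d y z.

(** Greedy choice of points: when no further point can be added, every point of [A] is within [r] of
    one already chosen, and [f] records such a point. *)
Lemma separated_or_covered (A : set V) (r : R) (x0 : V) (N : nat) :
  (exists t : nat -> V, (forall l, (l < N)%N -> A (t l)) /\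
     forall l l', (l < N)%N -> (l' < N)%N -> l != l' -> r <= d (t l) (t l')) \/
  (exists f : V -> nat, (forall x, (f x < N)%N) /\
     forall x y, A x -> A y -> f x = f y -> d x y <= 2 * r).
Proof.
elim: N => [|N [[t [At sep]]|[f [fN fd]]]]; first by left; exists (fun=> x0).
- have ltN l : (l < N.+1)%N -> l != N -> (l < N)%N.
    by move=> lN lE; rewrite ltn_neqAle lE -ltnS.
  have [[x [Ax xt]]|nx] := pselect (exists x, A x /\ forall l, (l < N)%N -> r <= d x (t l)).
    left; exists (fun l => if l == N then x else t l); split => [l lN|l l' lN l'N ll'].
      by case: eqP => // /eqP lN'; apply: At; exact: ltN.
    have [lE|lE] := eqVneq l N; have [lE'|lE'] := eqVneq l' N.
    + by move: ll'; rewrite lE lE' eqxx.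
    + by apply: xt; exact: ltN.
    + by rewrite dC; apply: xt; exact: ltN.
    + by apply: sep => //; exact: ltN.
  right.
  have /choice[f hf] x : exists l, (l < N.+1)%N /\ (A x -> d x (t l) < r).
    have [Ax|nAx] := pselect (A x); last by exists 0%N.
    apply: contrapT => nl; apply: nx; exists x; split => // l lN.
    rewrite leNgt; apply/negP => xl; apply: nl; exists l; split => //.
    exact: ltnW.
  exists f; split => [x|x y Ax Ay fxy]; first by have [] := hf x.
  apply: le_trans (d_triangle (t (f x)) x y) _.
  have [_ /(_ Ax) h1] := hf x; have [_ /(_ Ay)] := hf y.
  by rewrite -fxy dC; lra.
- by right; exists f; split => // x; exact: leqW.
Qed.

End Separated_families.

Section Delayed_iteration.
Variables (A : Type) (f : nat -> A -> A) (a : A).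

(** The nested matches keep the start value on stages 0, 1 and 2 and apply [f n.+1] to reach stage
    [n.+3]. The first level used is therefore 1, in accordance with [0 < k] in the growth
    condition. *)
Fixpoint delayed_iter n : A :=
  if n is n1.+1 then
    if n1 is n2.+1 then if n2 is _.+1 then f n2 (delayed_iter n1) else a else a
  else a.

Lemma delayed_iterS n : delayed_iter n.+3 = f n.+1 (delayed_iter n.+2).
Proof. by []. Qed.

Lemma delayed_iter_small n : (n < 3)%N -> delayed_iter n = a.
Proof. by case: n => [|[|[|n]]]. Qed.

End Delayed_iteration.

Section Majorizing_measure.
Variables (R : realType) (V : Type) (d : V -> V -> R) (T : set V).
Variables (F : set V -> R) (c sg D : R).
Hypothesis d0 : forall x, d x x = 0.
Hypothesis dC : forall x y, d x y = d y x.
Hypothesis d_triangle : forall y x z, d x z <= d x y + d y z.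
Hypothesis c0 : 0 < c.
Hypothesis sg0 : 0 < sg.
Hypothesis D0 : 0 < D.
Hypothesis diamT : forall x y, T x -> T y -> d x y <= D.
Hypothesis F_ge0 : forall A, A !=set0 -> A `<=` T -> 0 <= F A.
Hypothesis F_mono : forall A B, A !=set0 -> A `<=` B -> B `<=` T -> F A <= F B.
Hypothesis FT : F T <= c * D.
Hypothesis F_growth : forall k (a y : R) (t : 'I_(2 ^ 2 ^ k) -> V)
    (H : 'I_(2 ^ 2 ^ k) -> set V), (0 < k)%N -> 0 < a ->
  (forall l l', l != l' -> a <= d (t l) (t l')) ->
  (forall l, H l !=set0) -> (forall l, H l `<=` T) ->
  (forall l x, H l x -> d x (t l) <= sg * a) ->
  (forall l, y <= F (H l)) ->
  c * a * Num.sqrt 2 ^+ k + y <= F (\bigcup_l H l).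

Let th : R := Num.sqrt 2.

Let th2 : th ^+ 2 = 2.
Proof. by rewrite sqr_sqrtr. Qed.

Let th0 : 0 < th.
Proof. by rewrite sqrtr_gt0. Qed.

Let th_le : th <= 3 / 2.
Proof.
rewrite -(@ler_pXn2r _ 2)// ?nnegrE ?ltW// ?divr_gt0//.
by rewrite th2; lra.
Qed.

Let th_ge : 4 / 3 <= th.
Proof.
rewrite -(@ler_pXn2r _ 2)// ?nnegrE ?ltW// ?divr_gt0//.
by rewrite th2; lra.
Qed.

Let ball x j : set V := [set y | T y /\ d y x <= D / 2 ^+ j].

Let rad_gt0 j : 0 < D / 2 ^+ j.
Proof. by rewrite divr_gt0// exprn_gt0. Qed.

Let ball_n0 x j : T x -> ball x j !=set0.
Proof. by move=> Tx; exists x; split => //; rewrite d0 ltW. Qed.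

Let ballT x j : ball x j `<=` T.
Proof. by move=> y []. Qed.

(* van Handel's interpolation functional: the radius [D / 2 ^+ j] is traded
   against the loss of [F] on the ball, at a price [th ^+ n]. *)
Let K n x j := c / 16 * th ^+ n * (D / 2 ^+ j) + (F T - F (ball x j)).

Let argmin_nat n (f : nat -> R) :
  exists j, (j <= n)%N /\ forall i, (i <= n)%N -> f j <= f i.
Proof.
elim: n => [|n [j [jn h]]].
  by exists 0%N; split => // i; rewrite leqn0 => /eqP ->.
have [le_j|lt_j] := lerP (f j) (f n.+1).
  exists j; split; first exact: leq_trans jn _.
  by move=> i; rewrite leq_eqVlt => /orP[/eqP ->//|]; rewrite ltnS => /h.
exists n.+1; split => // i; rewrite leq_eqVlt => /orP[/eqP ->//|].
by rewrite ltnS => /h; apply: le_trans; exact: ltW.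
Qed.

Let jn n x : nat := projT1 (cid (argmin_nat n (K n x))).

Let jn_le n x : (jn n x <= n)%N.
Proof. by rewrite /jn; case: cid => j []. Qed.

Let jn_min n x i : (i <= n)%N -> K n x (jn n x) <= K n x i.
Proof. by rewrite /jn; case: cid => j /= [_]; exact. Qed.

Let s n x := D / 2 ^+ jn n x.

Let s_gt0 n x : 0 < s n x.
Proof. exact: rad_gt0. Qed.

Let F_ball x j : T x -> F (ball x j) <= F T.
Proof. by move=> Tx; apply: F_mono => //; exact: ball_n0. Qed.

(* The minimal value of [K] is almost monotone in [n]; its increments control
   [s n x]. *)
Let K_incr n x : T x ->
  K n x (jn n x) + c / 64 * (th ^+ n.+1 * s n.+1 x) <=
  K n.+1 x (jn n.+1 x) + c / 16 * D * (3 / 4) ^+ n.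
Proof.
move=> Tx.
have thn : 0 < th ^+ n by rewrite exprn_gt0.
have cs : 0 < c * (th ^+ n * s n.+1 x) by rewrite !mulr_gt0.
have pow0 : 0 < (3 / 4) ^+ n :> R by rewrite exprn_gt0// divr_gt0.
have err0 : 0 <= c / 16 * D * (3 / 4) ^+ n.
  by rewrite !mulr_ge0 ?ltW.
(* If the optimal exponent at level [n.+1] is available at level [n], the same ball competes there
   at a price lower by a factor [th >= 4/3], which gains a quarter of [c / 16]. *)
have [le_n|lt_n] := leqP (jn n.+1 x) n.
  have := jn_min x le_n.
  rewrite {2 4}/K -/(s n.+1 x) exprS => h.
  have := ler_wpM2r (ltW cs) th_ge.
  by lra.
have E : jn n.+1 x = n.+1.
  by apply/eqP; rewrite eqn_leq jn_le.
have := jn_min x (leqnn n).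
have Fle : F (ball x n.+1) <= F (ball x n).
  apply: F_mono (ball_n0 _ Tx) _ (@ballT _ _) => y [Ty yx]; split => //.
  apply: le_trans yx _; rewrite ler_pM2l// lef_pV2 ?posrE ?exprn_gt0//.
  by rewrite ler_eXn2l// ltr1n.
have E2 : c / 16 * th ^+ n * (D / 2 ^+ n) <= c / 16 * D * (3 / 4) ^+ n.
  rewrite mulrACA ler_wpM2l//.
    by rewrite !mulr_ge0 ?ltW.
  rewrite -exprVn -exprMn; apply: lerXn2r; rewrite ?nnegrE.
  - by rewrite divr_ge0 ?ltW.
  - by rewrite divr_ge0.
  - by have := th_le; lra.
rewrite {2 4}/K E exprS.
rewrite /s E in cs *.
have := ler_wpM2r (ltW cs) th_ge.
by lra.
Qed.

Let K_sum m x : T x -> K 0 x (jn 0 x) + c / 64 * \sum_(i < m) th ^+ i.+1 * s i.+1 x <=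
  K m x (jn m x) + c / 4 * D * (1 - (3 / 4) ^+ m).
Proof.
move=> Tx; elim: m => [|m ih].
  by rewrite big_ord0 expr0; lra.
rewrite big_ord_recr /= [(3 / 4) ^+ m.+1]exprS.
by have := K_incr m Tx; lra.
Qed.

(** [K_sum] telescopes between 0 and the value of [K] at exponent [k]. The terms 1, 1/16 and 1/4
    come from [FT], the radius price and the errors; [64 * (1 + 1/16 + 1/4) = 84], and the summand
    of index 0 adds [D]. *)
Let sum_s m x : T x -> \sum_(i < m) th ^+ i * s i x <= 85 * D.
Proof.
move=> Tx.
suff H k : \sum_(i < k.+1) th ^+ i * s i x <= 85 * D.
  by case: m => [|m]; [rewrite big_ord0 mulr_ge0 ?ltW|exact: H].
rewrite big_ord_recl /= expr0 mul1r.
have s0 : s 0 x = D.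
  by have := jn_le 0 x; rewrite /s leqn0 => /eqP ->; rewrite expr0 divr1.
have h := K_sum k Tx.
have K00 : 0 <= K 0 x (jn 0 x).
  by rewrite addr_ge0 ?subr_ge0 ?F_ball// !mulr_ge0 ?ltW// exprn_gt0.
have Kk : K k x (jn k x) <= c / 16 * D + c * D.
  apply: le_trans (jn_min x (leqnn k)) _; apply: lerD.
    rewrite mulrACA -[leRHS]mulr1; apply: ler_wpM2l.
      by rewrite !mulr_ge0 ?ltW.
    rewrite -exprVn -exprMn exprn_ile1 ?divr_ge0 ?ltW//.
    by have := th_le; lra.
  by rewrite lerBlDr (le_trans FT)// lerDl; exact: F_ge0 (ball_n0 k Tx) _.
have p0 : 0 <= c / 4 * D * (3 / 4) ^+ k.
  by rewrite !mulr_ge0 ?ltW// exprn_gt0// divr_gt0.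
set S := \sum_(i < k) _ in h; have -> : \sum_(i < k) th ^+ bump 0 i * s (bump 0 i) x = S.
  by apply: eq_bigr.
have h2 : c * S <= c * (84 * D) by lra.
by rewrite ler_pM2l// in h2; lra.
Qed.

(** Rounds [z] up to a dyadic radius. Beyond [D] the exponent 0 is returned, which is harmless
    because the ball of radius [D] is already all of [T]. *)
Let grid_radius j z : D / 2 ^+ j <= z ->
  exists i, [/\ (i <= j)%N, D / 2 ^+ i <= 2 * z & z <= D / 2 ^+ i \/ i = 0%N].
Proof.
elim: j => [|j ih] hz.
  exists 0%N; split => //; last by right.
  by have := rad_gt0 0; lra.
have [h|h] := lerP z (D / 2 ^+ j.+1).
  by exists j.+1; split => //; [have := rad_gt0 j.+1; lra|left].
have E : D / 2 ^+ j = 2 * (D / 2 ^+ j.+1).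
  by rewrite exprS; field; rewrite expf_neq0.
have [h2|h2] := lerP z (D / 2 ^+ j).
  by exists j; split => //; [lra|left].
have [i [ij h3 h4]] := ih (ltW h2).
by exists i; split => //; exact: leqW.
Qed.

(** Otherwise growth makes [F] of the union of the balls of radius [r] exceed the smallest of their
    values, at [t lm], by [c * a * th ^+ k]. The union lies in a ball about [t lm] whose radius is
    at most [2 * (E + r)] after rounding, and trading [j] for that radius would lower [K k]. The
    coefficient [1 / 8] is twice the price [1 / 16]; the term [r / sg] makes the balls small enough
    for the growth condition. *)
Let no_separated k j (A : set V) (E : R) (t : 'I_(2 ^ 2 ^ k) -> V) :
  (0 < k)%N -> A `<=` T -> (forall x, A x -> jn k x = j) ->
  (forall x y, A x -> A y -> d x y <= E) -> (forall l, A (t l)) ->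
  (forall l l', l != l' ->
     1 / 8 * (E + D / 2 ^+ j) + D / 2 ^+ j / sg <= d (t l) (t l')) -> False.
Proof.
move=> k0 AT jnA AE At sep.
set r := D / 2 ^+ j in sep; have r0 : 0 < r by exact: rad_gt0.
pose l0 : 'I_(2 ^ 2 ^ k) := Ordinal (expn_gt0 2 (2 ^ k) : 0 < _)%N.
have E0 : 0 <= E by rewrite -(d0 (t l0)) AE.
have Tt l : T (t l) by exact: AT.
have [lm _ Fmin] : exists2 lm, lm \in enum 'I_(2 ^ 2 ^ k) &
    smax (enum 'I_(2 ^ 2 ^ k)) (fun l => - F (ball (t l) j)) = - F (ball (t lm) j).
  apply: smax_ex; rewrite -size_eq0 -lt0n -cardT; apply/card_gt0P.
  by exists l0.
have Fm l : F (ball (t lm) j) <= F (ball (t l) j).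
  rewrite -lerN2 -Fmin; apply: (smax_ge (fun l => - F (ball (t l) j))).
  by rewrite mem_enum.
set a := _ + r / sg in sep.
have a0 : 0 < a by rewrite addr_gt0// ?mulr_gt0 ?invr_gt0//; lra.
have ra : r <= sg * a.
  have -> : sg * a = sg * (1 / 8 * (E + r)) + r.
    by rewrite /a; field; rewrite gt_eqF.
  rewrite lerDr !mulr_ge0 ?ltW//; lra.
have g := F_growth k0 a0 sep (fun l => ball_n0 j (Tt l)) (fun l => @ballT _ _)
  (fun l x (h : ball (t l) j x) => le_trans h.2 ra) Fm.
have jk : (j <= k)%N by rewrite -(jnA _ (At l0)) jn_le.
have rE : D / 2 ^+ j <= E + r by rewrite lerDr.
have [i [ij i1 i2]] := grid_radius rE.
have sub : \bigcup_l ball (t l) j `<=` ball (t lm) i.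
  move=> y [l _ [Ty yl]]; split => //.
  case: i2 => [i2|->]; last by rewrite expr0 divr1 diamT.
  apply: le_trans (d_triangle (t l) _ _) _; apply: le_trans i2.
  by rewrite addrC lerD// AE.
have ne : \bigcup_l ball (t l) j !=set0.
  by have [y yb] := ball_n0 j (Tt l0); exists y, l0.
have F1 := F_mono ne sub (@ballT _ _).
have := jn_min (t lm) (leq_trans ij jk).
rewrite jnA// /K -/r => K1.
have thk : 0 < th ^+ k by rewrite exprn_gt0.
rewrite -/th in g.
have h1 : c / 16 * th ^+ k * (D / 2 ^+ i) <= c * th ^+ k * (1 / 8 * (E + r)).
  have ck : 0 <= c / 16 * th ^+ k by rewrite !mulr_ge0 ?ltW.
  by have := ler_wpM2l ck i1; lra.
have h2 : 0 < c / 16 * th ^+ k * r by rewrite !mulr_gt0.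
have h3 : c * th ^+ k * (1 / 8 * (E + r)) < c * a * th ^+ k.
  rewrite [ltRHS]mulrAC ltr_pM2l ?mulr_gt0// /a.
  by rewrite ltrDl divr_gt0.
by lra.
Qed.

(** The conditions stand under the existential so that [cid] yields a labelling [cov] for every
    argument, as the recursion needs. *)
Let covering k j (A : set V) (E : R) : exists f : V -> nat,
  (forall x, (f x < 2 ^ 2 ^ k)%N) /\
  ((0 < k)%N -> A `<=` T -> (forall x, A x -> jn k x = j) ->
   (forall x y, A x -> A y -> d x y <= E) ->
   forall x y, A x -> A y -> f x = f y ->
     d x y <= E / 4 + (1 / 4 + 2 / sg) * (D / 2 ^+ j)).
Proof.
have [[k0 AT jnA AE]|nh] := pselect [/\ (0 < k)%N, A `<=` T,
    (forall x, A x -> jn k x = j) & (forall x y, A x -> A y -> d x y <= E)];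
  last first.
  exists (fun=> 0%N); split => [x|k0 AT jnA AE]; first by rewrite expn_gt0.
  by exfalso; apply: nh.
have [[x0 _]|nA] := pselect (A !=set0); last first.
  exists (fun=> 0%N); split => [x|_ _ _ _ x y Ax]; first by rewrite expn_gt0.
  by exfalso; apply: nA; exists x.
set r := D / 2 ^+ j.
have [[t [At sep]]|[f [fN fd]]] :=
  separated_or_covered dC d_triangle A (1 / 8 * (E + r) + r / sg) x0 (2 ^ 2 ^ k).
  exfalso; apply: (@no_separated k j A E (fun l => t l)) => // l; first exact: At.
  by move=> l' ll'; exact: sep.
exists f; split => // _ _ _ _ x y Ax Ay fxy.
by apply: le_trans (fd x y Ax Ay fxy) _; lra.
Qed.

Let cov k j A E : V -> nat := projT1 (cid (covering k j A E)).

Let cov_lt k j A E x : (cov k j A E x < 2 ^ 2 ^ k)%N.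
Proof. by rewrite /cov; case: cid => f []. Qed.

Let C1 : R := 1 / 4 + 2 / sg.

Let cell (f : V -> nat) n x : set V :=
  [set y | [/\ T y, f y = f x & jn n y = jn n x]].

(* A label of level [n.+2] records the label one level above, the optimal
   exponent [jn n x] and a piece of a covering by [2 ^ 2 ^ n] sets; the shift
   by two levels keeps the number of labels below [2 ^ 2 ^ n.+2]. *)
Let step n (p : (V -> nat) * (V -> R)) : (V -> nat) * (V -> R) :=
  (fun x => ((p.1 x * n.+2 + jn n x) * 2 ^ 2 ^ n +
             cov n (jn n x) (cell p.1 n x) (p.2 x) x)%N,
   fun x => p.2 x / 4 + C1 * s n x).

Notation state := (delayed_iter step (fun=> 0%N, fun=> D)).

Let step_inj n p x y : (step n p).1 x = (step n p).1 y ->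
  [/\ p.1 x = p.1 y, jn n x = jn n y &
      cov n (jn n x) (cell p.1 n x) (p.2 x) x =
      cov n (jn n y) (cell p.1 n y) (p.2 y) y].
Proof.
have eqdiv m a b a' b' : (b < m)%N -> (b' < m)%N ->
    (a * m + b = a' * m + b')%N -> a = a' /\ b = b'.
  move=> bm bm' e; have m0 : (0 < m)%N by exact: leq_ltn_trans bm.
  have := congr1 (divn^~ m) e; have := congr1 (modn^~ m) e.
  rewrite !modnMDl !divnMDl// !modn_small// !divn_small// !addn0.
  by move=> -> ->.
move=> /eqdiv[]; rewrite ?cov_lt// => e1 e2.
have j_lt z : (jn n z < n.+2)%N by rewrite ltnS leqW.
by have [h1 h2] := eqdiv _ _ _ _ _ (j_lt x) (j_lt y) e1.
Qed.

Let lab n := (state n).1.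
Let Dn n := (state n).2.

Let lab_lt n x : (lab n x < 2 ^ 2 ^ n)%N.
Proof.
rewrite /lab; have [n3|] := ltnP n 3; first by rewrite delayed_iter_small// expn_gt0.
case: n => [|[|[|n]]]// _.
elim: n => [|n ih]; rewrite delayed_iterS.
  rewrite /= mul0n add0n.
  have h1 : (jn 1 x <= 1)%N by exact: jn_le.
  have h2 := cov_lt 1 (jn 1 x) (cell (fun=> 0%N) 1 x) D x.
  by rewrite -addnS; apply: leq_trans (leq_add (leq_mul h1 (leqnn _)) h2) _.
move: ih; set p := state n.+3 => p_lt; rewrite {1}/step /fst -/(fst p).
set q := cov _ _ _ _ _.
have q_lt : (q < 2 ^ 2 ^ n.+2)%N by exact: cov_lt.
have j_lt : (jn n.+2 x < n.+4)%N by rewrite ltnS; exact: leqW (jn_le _ _).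
have n_le : (n.+4 <= 2 ^ 2 ^ n.+2)%N.
  apply: leq_trans (_ : 2 ^ n.+3 <= _)%N.
    exact: ltn_expl.
  rewrite leq_exp2l//; exact: ltn_expl.
(* Since [2 ^ n.+4 = 2 ^ n.+3 + 2 * 2 ^ n.+2], there is just room for the previous labels, the
   exponents (fewer than [n.+4]) and the pieces of the covering. *)
have -> : (2 ^ 2 ^ n.+4 = 2 ^ 2 ^ n.+3 * 2 ^ 2 ^ n.+2 * 2 ^ 2 ^ n.+2)%N.
  by rewrite -!expnD; congr expn; rewrite !(expnS 2) !mul2n -!addnn; lia.
apply: leq_trans (_ : (p.1 x * n.+4 + jn n.+2 x).+1 * 2 ^ 2 ^ n.+2 <= _)%N.
  by rewrite mulSn addnC ltn_add2r.
rewrite leq_mul2r; apply/orP; right.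
apply: leq_trans (_ : (p.1 x).+1 * n.+4 <= _)%N.
  by rewrite mulSn addnC ltn_add2r.
exact: leq_mul.
Qed.

Let lab_refine n x y : lab n.+1 x = lab n.+1 y -> lab n x = lab n y.
Proof.
rewrite /lab; case: n => [|[|n]]//; rewrite delayed_iterS.
by move=> /step_inj[].
Qed.

(** The equality of the two bounds is carried through the induction because [covering] is applied to
    a whole cell with a single [E], so [Dn] must be constant on cells. *)
Let lab_diam n x y : T x -> T y -> lab n x = lab n y ->
  d x y <= Dn n x /\ Dn n x = Dn n y.
Proof.
rewrite /lab /Dn; have [n3|] := ltnP n 3.
  by rewrite delayed_iter_small// => Tx Ty _; split => //=; exact: diamT.
case: n => [|[|[|n]]]// _.
elim: n x y => [|n ih] x y Tx Ty; rewrite delayed_iterS => /step_inj[p12 jxy].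
  rewrite /= /s -jxy.
  have -> : cell (fun=> 0%N) 1 y = cell (fun=> 0%N) 1 x.
    by rewrite /cell jxy.
  move=> fxy; split => //.
  have := projT2 (cid (covering 1 (jn 1 x) (cell (fun=> 0%N) 1 x) D)).
  move=> [_ h]; apply: h => //; try by split.
  - by move=> z [].
  - by move=> z [].
  - by move=> z z' [? _ _] [? _ _]; exact: diamT.
have [_ pD] := ih _ _ Tx Ty p12.
set p := state n.+3 in p12 pD *.
have -> : cell p.1 n.+2 y = cell p.1 n.+2 x by rewrite /cell p12 jxy.
rewrite -pD -jxy => fxy.
split; last first.
  have -> : (step n.+2 p).2 y = p.2 y / 4 + C1 * s n.+2 y by [].
  by rewrite -pD /s -jxy.
have [_ h] := projT2 (cid (covering n.+2 (jn n.+2 x) (cell p.1 n.+2 x) (p.2 x))).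
apply: h => //; try by split.
- by move=> z [].
- by move=> z [].
- move=> z z' [Tz pz _] [Tz' pz' _].
  have [h1 _] := ih z z' Tz Tz' (etrans pz (esym pz')).
  by have [_ <-] := ih z x Tz Tx pz.
Qed.

Let C10 : 0 <= C1.
Proof. by rewrite /C1 addr_ge0// ?divr_ge0 ?ltW. Qed.

Let C1s k x : 0 <= C1 * s k x.
Proof. by apply: mulr_ge0; [exact: C10|exact: ltW]. Qed.

Let Dn_ge0 n x : 0 <= Dn n x.
Proof.
rewrite /Dn; have [n3|] := ltnP n 3; first by rewrite delayed_iter_small// ltW.
case: n => [|[|[|n]]]// _.
elim: n => [|n ih]; rewrite delayed_iterS; apply: addr_ge0 => //; apply: divr_ge0 => //.
exact: ltW.
Qed.

(** The contraction by 4 in [step] beats the growth of the weight: [th / 4 <= 1/2], so half of the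
    sum is absorbed. This doubles [5 * D] and turns [2 * C1 * 85 * D] into [340 * C1 * D]. *)
Let Dn_sum m x : T x -> \sum_(i < m) th ^+ i * Dn i x <= (10 + 340 * C1) * D.
Proof.
move=> Tx.
have t_ge0 i : 0 <= th ^+ i * Dn i x by rewrite mulr_ge0 ?Dn_ge0// exprn_ge0// ltW.
have H k : \sum_(i < k.+3) th ^+ i * Dn i x <=
    5 * D + 2^-1 * (\sum_(i < k.+2) th ^+ i * Dn i x) +
    2 * C1 * \sum_(i < k.+1) th ^+ i * s i x.
  elim: k => [|k ih].
    rewrite !big_ord_recr !big_ord0 /= expr0 expr1 th2 /Dn /=.
    have := C1s 0 x.
    have : th * D <= 3 / 2 * D by rewrite ler_pM2r.
    have : 0 <= th * D by rewrite mulr_ge0 ?ltW.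
    by have := D0; lra.
  rewrite big_ord_recr /= [X in _ + _ * X + _]big_ord_recr /=.
  rewrite [X in _ + _ + _ * X]big_ord_recr /=.
  have E : Dn k.+3 x = Dn k.+2 x / 4 + C1 * s k.+1 x by rewrite /Dn delayed_iterS.
  rewrite E mulrDr.
  have -> : th ^+ k.+3 * (C1 * s k.+1 x) = 2 * C1 * (th ^+ k.+1 * s k.+1 x).
    by rewrite (exprD _ 2 k.+1) th2; ring.
  have : th ^+ k.+3 * (Dn k.+2 x / 4) <= 2^-1 * (th ^+ k.+2 * Dn k.+2 x).
    have := ler_wpM2r (t_ge0 k.+2) th_le; rewrite [th ^+ k.+3]exprS.
    by have := t_ge0 k.+2; lra.
  by lra.
have H2 : \sum_(i < m.+3) th ^+ i * Dn i x <= (10 + 340 * C1) * D.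
  have := H m; rewrite big_ord_recr /=.
  have := ler_wpM2l C10 (sum_s m.+1 Tx).
  by have := t_ge0 m.+2; lra.
apply: le_trans H2; rewrite !big_ord_recr /=.
by have := t_ge0 m.+2; have := t_ge0 m.+1; have := t_ge0 m; lra.
Qed.

(** Partitions are presented by labels: a block of level [n] is a level set of [l n], and [e n]
    bounds its diameter. The constant is [10 + 340 * C1]. *)
Lemma majorizing_labels : exists (l : nat -> V -> nat) (e : nat -> V -> R),
  [/\ forall x, l 0%N x = 0%N, forall n x, (l n x < 2 ^ 2 ^ n)%N,
      forall n x y, l n.+1 x = l n.+1 y -> l n x = l n y,
      forall n x y z, T x -> T y -> T z -> l n y = l n x -> l n z = l n x ->
        d y z <= e n x &
      forall n x, 0 <= e n x /\ (T x -> \sum_(i < n) Num.sqrt 2 ^+ i * e i x <=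
        (95 + 680 / sg) * D)].
Proof.
exists lab, Dn; split => //.
- move=> n x y z Tx Ty Tz yx zx; have [_ <-] := lab_diam Ty Tx yx.
  by have [] := lab_diam Ty Tz (etrans yx (esym zx)).
- move=> n x; split => [|Tx]; first exact: Dn_ge0.
  by apply: le_trans (Dn_sum n Tx) _; rewrite ler_pM2r// /C1; lra.
Qed.

End Majorizing_measure.

(** * Chaining for subgaussian processes *)

Section Chaining.
Variables (R : realType) (O : finType) (w0 : O) (V : eqType).
Variables (X : V -> O -> R) (d : V -> V -> R) (S : seq V).
Variables (l : nat -> V -> nat) (e : nat -> V -> R) (g kap : R).
Hypothesis S0 : S != [::].
Hypothesis kap0 : 0 <= kap.
Hypothesis d_ge0 : forall x y, 0 <= d x y.
Hypothesis d_eq0 : forall x y, d x y = 0 -> x = y.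
Hypothesis subgauss : forall x y (c : R),
  avg (fun w => expR (c * (X x w - X y w))) <= expR (kap * (c * d x y) ^+ 2).
Hypothesis centered : forall x, avg (X x) = 0.
Hypothesis l0 : forall x y, x \in S -> y \in S -> l 0%N x = l 0%N y.
Hypothesis l_lt : forall n x, x \in S -> (l n x < 2 ^ 2 ^ n)%N.
Hypothesis l_refine : forall n x y, x \in S -> y \in S ->
  l n.+1 x = l n.+1 y -> l n x = l n y.
Hypothesis l_diam : forall n x y z, x \in S -> y \in S -> z \in S ->
  l n x = l n z -> l n y = l n z -> d x y <= e n z.
Hypothesis e_ge0 : forall n x, x \in S -> 0 <= e n x.
Hypothesis e_sum : forall n x, x \in S -> \sum_(i < n) Num.sqrt 2 ^+ i * e i x <= g.

Let th : R := Num.sqrt 2.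

(** [S] is finite, so [K] exceeds all inverse distances. Once [th ^+ m] exceeds [g * K], the bound
    [e m x <= g / th ^+ m] is below every positive distance, and chains of length [m] end at their
    target. *)
Lemma chain_separates : exists m, forall x y, x \in S -> y \in S ->
  l m x = l m y -> x = y.
Proof.
have th0 : 0 < th by rewrite sqrtr_gt0.
have g0 : 0 <= g.
  by have [x xS _] := smax_ex (fun=> 0 : R) S0; have := e_sum 0 xS; rewrite big_ord0.
pose K := 1 + \sum_(x <- S) \sum_(y <- S) (d x y)^-1.
have di x y : 0 <= (d x y)^-1 by rewrite invr_ge0.
have K1 x y : x \in S -> y \in S -> (d x y)^-1 < K.
  move=> xS yS; rewrite /K (big_rem x)//= (big_rem y)//=.
  set A := \sum_(y <- rem y S) _; set B := \sum_(y <- rem x S) _.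
  have A0 : 0 <= A by exact: sumr_ge0.
  have B0 : 0 <= B by apply: sumr_ge0 => ? _; exact: sumr_ge0.
  by lra.
have K0 : 0 < K.
  by have [x xS _] := smax_ex (fun=> 0 : R) S0; exact: le_lt_trans (K1 x x xS xS).
have gK : 0 <= g * K by rewrite mulr_ge0// ltW.
exists (2 * Num.bound (g * K))%N => x y xS yS lxy.
set m := (2 * _)%N in lxy.
have thm : g * K < th ^+ m.
  rewrite /m exprM sqr_sqrtr//; apply: lt_le_trans (archi_boundP gK) _.
  by rewrite -natrX ler_nat ltnW// ltn_expl.
have thm0 : 0 < th ^+ m by rewrite exprn_gt0.
have h1 : th ^+ m * e m x <= g.
  apply: le_trans (e_sum m.+1 xS); rewrite big_ord_recr /= lerDr.
  by apply: sumr_ge0 => i _; rewrite mulr_ge0 ?e_ge0// exprn_ge0// ltW.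
have h2 : d x y <= e m x by exact: l_diam.
apply: d_eq0; apply/eqP; rewrite eq_le d_ge0 andbT leNgt; apply/negP => dxy.
have h3 : 1 < K * d x y.
  by rewrite -ltr_pdivrMr// mul1r K1.
have h4 : th ^+ m * d x y <= g.
  by apply: le_trans h1; rewrite ler_pM2l.
have h5 : g <= g * (K * d x y) by rewrite ler_peMr// ltW.
have : g * K * d x y < th ^+ m * d x y by rewrite ltr_pM2r.
by rewrite -mulrA; lra.
Qed.

Lemma positive_part_le (z c : R) : 0 < c -> Num.max z 0 <= expR (c * z) / c.
Proof.
move=> c0; rewrite ge_max; apply/andP; split; last by rewrite divr_ge0 ?expR_ge0// ltW.
rewrite ler_pdivlMr// mulrC.
by have := expR_ge1Dx (c * z); lra.
Qed.

Lemma chaining : avg (fun w => smax S (X^~ w)) <= (kap + 4) * g.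
Proof.
have th0 : 0 < th by rewrite sqrtr_gt0.
have [m sep] := chain_separates.
have [x0 x0S _] := smax_ex (fun=> 0 : R) S0.
pose rep j i := nth x0 S (find (fun x => l j x == i) S).
have repP j t : t \in S -> rep j (l j t) \in S /\ l j (rep j (l j t)) = l j t.
  move=> tS; have h : has (fun x => l j x == l j t) S by apply/hasP; exists t.
  split; first by rewrite mem_nth// -has_find.
  by apply/eqP; exact: (nth_find x0 h).
(* By refinement a link of the chain is determined by its finer label [i], so there are at most
   [2 ^ 2 ^ j.+1] links at level [j]. A link of length 0 contributes 0 to [Y], as [0^-1 = 0]. *)
pose p j i := rep j.+1 i; pose q j i := rep j (l j (rep j.+1 i)).
pose Y j i w := (X (p j i) w - X (q j i) w) / d (p j i) (q j i) / th ^+ j.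
(* Instead of a union bound, [M] adds to the level [L] all excesses of the normalized links. With
   this [L] the exponent at level [j] is at most [- (2 * 2 ^+ j)], which pays for the number of
   links and leaves [2^-1 ^+ j]; the excesses sum to at most 2. *)
pose L := kap + 2.
pose M w := L + \sum_(j < m) \sum_(i < 2 ^ 2 ^ j.+1) Num.max (Y j i w - L) 0.
have g0 : 0 <= g by have := e_sum 0 x0S; rewrite big_ord0.
have M_ge w j i : (j < m)%N -> (i < 2 ^ 2 ^ j.+1)%N -> Y j i w <= M w.
  move=> jm ilt; rewrite /M (bigD1 (Ordinal jm))//= (bigD1 (Ordinal ilt))//=.
  set A := \sum_(i0 < _ | _) _; set B := \sum_(i0 < _ | _) _.
  have A0 : 0 <= A by apply: sumr_ge0 => k _; rewrite le_max lexx orbT.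
  have B0 : 0 <= B.
    by apply: sumr_ge0 => k _; apply: sumr_ge0 => k' _; rewrite le_max lexx orbT.
  have : Y j i w - L <= Num.max (Y j i w - L) 0 by rewrite le_max lexx.
  by lra.
have M0 w : 0 <= M w.
  rewrite addr_ge0 ?addr_ge0//; apply: sumr_ge0 => k _; apply: sumr_ge0 => k' _.
  by rewrite le_max lexx orbT.
have avgM : avg M <= kap + 4.
  rewrite /M avgD (avg_cst w0) avg_sum.
  suff : \sum_(j < m) avg (fun w => \sum_(i < 2 ^ 2 ^ j.+1) Num.max (Y j i w - L) 0) <= 2.
    by rewrite /L; lra.
  apply: le_trans (_ : \sum_(j < m) (2^-1) ^+ j <= _); last first.
    have h k : \sum_(j < k) (2^-1 : R) ^+ j = 2 - 2 * (2^-1) ^+ k.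
      elim: k => [|k ih]; first by rewrite big_ord0 expr0; ring.
      by rewrite big_ord_recr /= ih exprS; field.
    by rewrite h; have : 0 <= (2^-1 : R) ^+ m by [rewrite exprn_ge0]; lra.
  apply: ler_sum => -[j jm] _ /=; rewrite avg_sum.
  have t2 : th ^+ j ^+ 2 = 2 ^+ j by rewrite -exprM mulnC exprM sqr_sqrtr.
  have tj : 0 < th ^+ j by rewrite exprn_gt0.
  have j2 : 0 < 2 ^+ j :> R by rewrite exprn_gt0.
  apply: le_trans (_ : \sum_(i < 2 ^ 2 ^ j.+1) expR (- (2 * 2 ^+ j)) / 2 ^+ j <= _).
    apply: ler_sum => i _.
    apply: le_trans (_ : avg (fun w => expR (2 ^+ j * (Y j i w - L)) / 2 ^+ j) <= _).
      by apply: avg_le => w; exact: positive_part_le.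
    rewrite avgZr ler_pM2r ?invr_gt0//.
    pose c := th ^+ j / d (p j i) (q j i).
    rewrite (eq_avg (g := fun w => expR (- (2 ^+ j * L)) *
      expR (c * (X (p j i) w - X (q j i) w)))); last first.
      move=> w; rewrite -expRD; congr expR; rewrite mulrBr addrC; congr (_ + _).
      have [E|dn0] := eqVneq (d (p j i) (q j i)) 0.
        by rewrite /Y /c E !invr0 !mulr0 !mul0r mulr0.
      by rewrite /Y /c -t2; field; rewrite dn0 gt_eqF.
    rewrite avgZ; apply: le_trans (ler_wpM2l (expR_ge0 _) (subgauss _ _ _)) _.
    rewrite -expRD ler_expR.
    have : (c * d (p j i) (q j i)) ^+ 2 <= 2 ^+ j.
      have [E|dn0] := eqVneq (d (p j i) (q j i)) 0.
        by rewrite E mulr0 expr0n ltW.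
      by rewrite /c divfK// t2.
    by move=> /(ler_wpM2l kap0); rewrite /L; lra.
  rewrite sumr_const card_ord -mulrnAl.
  have -> : (2^-1 : R) ^+ j = 1 / 2 ^+ j by rewrite exprVn div1r.
  rewrite ler_pM2r ?invr_gt0// -[leLHS]mulr_natl.
  rewrite expRN ler_pdivrMr ?expR_gt0// mul1r natrX.
  have e2 : 2 <= expR 1 :> R by have := expR_ge1Dx (1 : R); lra.
  apply: le_trans (_ : expR 1 ^+ (2 ^ j.+1) <= _).
    by apply: lerXn2r; rewrite ?nnegrE ?expR_ge0.
  by rewrite -expRM_natl ler_expR mulr1 expnS natrM natrX.
pose t0 := rep 0%N (l 0%N x0).
have bound w t : t \in S -> X t w <= X t0 w + M w * g.
  move=> tS.
  pose pi j := rep j (l j t).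
  have piS j : pi j \in S /\ l j (pi j) = l j t by exact: repP.
  have E : X t w - X t0 w = \sum_(j < m) (X (pi j.+1) w - X (pi j) w).
    have h k : \sum_(j < k) (X (pi j.+1) w - X (pi j) w) = X (pi k) w - X (pi 0%N) w.
      elim: k => [|k ih]; first by rewrite big_ord0 subrr.
      by rewrite big_ord_recr /= ih; ring.
    rewrite h; congr (X _ w - X _ w).
      by apply: sep => //; [case: (piS m)|case: (piS m) => _ ->].
    by rewrite /t0 /pi (l0 x0S tS).
  rewrite -lerBlDl E.
  apply: le_trans (_ : \sum_(j < m) (M w * (th ^+ j * e j t)) <= _); last first.
    by rewrite -mulr_sumr ler_wpM2l// e_sum.
  apply: ler_sum => -[j jm] _ /=.
  have [p1S lp1] := piS j.+1.
  have ljE : l j (pi j.+1) = l j t by apply: l_refine.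
  have qE : q j (l j.+1 t) = pi j by rewrite /q -/(pi j.+1) ljE.
  have dle : d (pi j.+1) (pi j) <= e j t.
    by apply: l_diam => //; have [] := piS j.
  have tj : 0 < th ^+ j by rewrite exprn_gt0.
  have [E0|dn0] := eqVneq (d (pi j.+1) (pi j)) 0.
    by rewrite (d_eq0 E0) subrr mulr_ge0// mulr_ge0 ?e_ge0// ltW.
  have dp : 0 < d (pi j.+1) (pi j) by rewrite lt_def dn0 d_ge0.
  have := M_ge w j (l j.+1 t) jm (l_lt _ tS).
  rewrite /Y /p qE -/(pi j.+1) ler_pdivrMr// ler_pdivrMr//.
  move=> /le_trans; apply; rewrite -mulrA ler_wpM2l// ler_pM2l//.
apply: le_trans (_ : avg (fun w => X t0 w + M w * g) <= _).
  by apply: avg_le => w; apply: smax_le => // t tS; exact: bound.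
by rewrite avgD centered add0r avgZr ler_wpM2r.
Qed.

End Chaining.

(** * Passage between labels and admissible partitions *)

Section Gamma_bounds.
Variables (R : realType) (V : choiceType).
Implicit Types (T : set V) (d : V -> V -> R).

Lemma pblock_partition T (A : set (set V)) (B : set V) x :
  partition A id T -> A B -> B x -> pblock A id x = B.
Proof.
move=> [_ tA _] AB Bx; have [AC Cx] : A (pblock A id x) /\ pblock A id x x.
  by rewrite /pblock /pblock_index; case: xgetP => [C -> //|/(_ B)[]].
by apply: tA => //; exists x.
Qed.

Lemma pblock_mem T (A : set (set V)) x :
  partition A id T -> T x -> A (pblock A id x) /\ pblock A id x x.
Proof.
move=> pA Tx; have [cA _ _] := pA.
by have [B AB Bx] : cover A id x by [rewrite cA]; rewrite (pblock_partition pA AB Bx).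
Qed.

Lemma diameter_le d (A : set V) r : (forall x y, A x -> A y -> d x y <= r) ->
  (diameter d A <= r%:E)%E.
Proof.
move=> h; apply: ge_ereal_sup => _ [[x y] [/= Ax Ay] <-].
by rewrite lee_fin h.
Qed.

Lemma diameter_ge d (A : set V) x y : A x -> A y -> ((d x y)%:E <= diameter d A)%E.
Proof. by move=> Ax Ay; apply: ereal_sup_ubound; exists (x, y). Qed.

Lemma weightE n : 2 `^ (n%:R / 2) = Num.sqrt 2 ^+ n :> R.
Proof. by rewrite mulrC powRrM powR12_sqrt// powR_mulrn// sqrtr_ge0. Qed.

Lemma gamma_le_labels T d (l : nat -> V -> nat) (e : nat -> V -> R) (B : R) :
  T !=set0 -> (forall x, d x x = 0) ->
  (forall x, l 0%N x = 0%N) -> (forall n x, (l n x < 2 ^ 2 ^ n)%N) ->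
  (forall n x y, l n.+1 x = l n.+1 y -> l n x = l n y) ->
  (forall n x y z, T x -> T y -> T z -> l n y = l n x -> l n z = l n x ->
     d y z <= e n x) ->
  (forall n x, 0 <= e n x /\
    (T x -> \sum_(i < n) Num.sqrt 2 ^+ i * e i x <= B)) ->
  (gamma 2 T d <= B%:E)%E.
Proof.
move=> T0 d0 l0 l_lt l_ref l_diam eB.
pose cell n x : set V := [set y | T y /\ l n y = l n x].
pose A n : set (set V) := [set cell n x | x in T].
have pA n : partition (A n) id T.
  split.
  - apply/seteqP; split => [x [_ [y Ty <-]] []//|x Tx].
    by exists (cell n x) => //; exists x.
  - move=> _ _ [x Tx <-] [y Ty <-] [z [[_ zx] [_ zy]]].
    by apply/seteqP; split => t [Tt tl]; split => //; rewrite tl -zx -zy.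
  - by move=> _ [x Tx <-]; exists x.
have cellE n x : T x -> pblock (A n) id x = cell n x.
  by move=> Tx; apply: (pblock_partition (pA n)); [exists x|].
have adm : admissible T A.
  split => //.
  - move=> j _ [x Tx <-]; exists (cell j x); first by exists x.
    by move=> y [Ty /l_ref].
  - apply/seteqP; split => [_ [x Tx <-]|_ ->].
      by apply/seteqP; split => [y []//|y Ty]; split => //; rewrite !l0.
    have [x Tx] := T0; exists x => //.
    by apply/seteqP; split => [y []//|y Ty]; split => //; rewrite !l0.
  - move=> j; apply: card_le_trans (card_image_le (fun i => [set y | T y /\ l j y = i]) _).
    by apply: subset_card_le => _ [x Tx <-]; exists (l j x) => //=; exact: l_lt.
apply: ge_ereal_inf.
eexists; first by exists A; first exact: adm.
apply: ge_ereal_sup => _ [x Tx <-].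
have diam0 j : (0 <= diameter d (pblock (A j) id x))%E.
  have [_ xb] := pblock_mem (pA j) Tx.
  by apply: le_trans (diameter_ge d xb xb); rewrite d0.
apply: lime_le.
  by apply: is_cvg_nneseries => j _ _; rewrite mule_ge0// lee_fin powR_ge0.
apply: nearW => n.
apply: le_trans (_ : ((\sum_(0 <= i < n) Num.sqrt 2 ^+ i * e i x)%R%:E <= _)%E).
  rewrite -sumEFin; apply: lee_sum => i _; rewrite weightE EFinM.
  apply: lee_wpmul2l; first by rewrite lee_fin exprn_ge0// sqrtr_ge0.
  apply: diameter_le => y z; rewrite cellE// => -[Ty ly] [Tz lz].
  exact: l_diam.
by rewrite lee_fin big_mkord; have [_] := eB n x; exact.
Qed.

(** Chaining is applied along every admissible sequence, its blocks being numbered by an injection.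
    If the supremum [G] is infinite the bound is trivial; if it is finite, so are all block
    diameters, since their weights are positive. *)
Lemma gamma_ge_chaining (O : finType) (w0 : O) (X : V -> O -> R) d (S : seq V)
    T (kap : R) :
  S != [::] -> (forall t, t \in S -> T t) -> 0 <= kap ->
  (forall x, d x x = 0) -> (forall x y, 0 <= d x y) ->
  (forall x y, d x y = 0 -> x = y) ->
  (forall x y (c : R), avg (fun w => expR (c * (X x w - X y w))) <=
     expR (kap * (c * d x y) ^+ 2)) ->
  (forall x, avg (X x) = 0) ->
  ((avg (fun w => smax S (X^~ w)))%:E <= (kap + 4)%:E * gamma 2 T d)%E.
Proof.
move=> S0 ST kap0 d0 d_ge0 d_eq0 sub cen.
have k0 : 0 < kap + 4 by lra.
have [x0 x0S _] := smax_ex (fun=> 0 : R) S0.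
rewrite -lee_pdivrMl//; apply: le_ereal_inf_tmp => _ [A adm <-].
have [pA refA A0 cardA] := adm.
have diam0 j x : T x -> (0 <= diameter d (pblock (A j) id x))%E.
  move=> /(pblock_mem (pA j))[_ xb].
  by apply: le_trans (diameter_ge d xb xb); rewrite d0.
have term0 j x : T x ->
    (0 <= (2 `^ (j%:R / 2))%:E * diameter d (pblock (A j) id x))%E.
  by move=> Tx; rewrite mule_ge0 ?diam0// lee_fin powR_ge0.
set G := ereal_sup _.
have G_ge t n : T t ->
    (\sum_(0 <= j < n) (2 `^ (j%:R / 2))%:E * diameter d (pblock (A j) id t) <= G)%E.
  move=> Tt; apply: le_trans (_ : _ <= \sum_(0 <= j <oo)
    (2 `^ (j%:R / 2))%:E * diameter d (pblock (A j) id t))%E _.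
    by apply: nneseries_lim_ge => j _ _; exact: term0.
  by apply: ereal_sup_ubound; exists t.
have G0 : (0 <= G)%E by have := G_ge x0 0%N (ST _ x0S); rewrite big_geq.
case GE : G G0 => [g| |]// g0; last by rewrite leey.
rewrite lee_fin ler_pdivrMl//.
pose e n x := fine (diameter d (pblock (A n) id x)).
have diam_fin n x : T x -> diameter d (pblock (A n) id x) = (e n x)%:E.
  move=> Tx; rewrite /e fineK// ge0_fin_numE ?diam0//.
  have := G_ge x n.+1 Tx; rewrite GE big_nat_recr//= => h.
  have : ((2 `^ (n%:R / 2))%:E * diameter d (pblock (A n) id x) <= g%:E)%E.
    apply: le_trans h; rewrite leeDr// sume_ge0// => j _.
    exact: term0.
  case E : (diameter d _) (diam0 n x Tx) => [z| |]// _; rewrite ?ltry//.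
  by rewrite gt0_muley// lte_fin powR_gt0.
have e_ge0 n x : T x -> 0 <= e n x by move=> Tx; rewrite -lee_fin -diam_fin ?diam0.
have e_sum n x : T x -> \sum_(i < n) Num.sqrt 2 ^+ i * e i x <= g.
  move=> Tx; rewrite -lee_fin -GE; apply: le_trans (G_ge x n Tx).
  rewrite -sumEFin big_mkord; apply: lee_sum => i _.
  by rewrite weightE diam_fin// EFinM.
have /choice[f hf] j : exists f : set V -> nat,
    (forall B, A j B -> (f B < 2 ^ 2 ^ j)%N) /\
    (forall B C, A j B -> A j C -> f B = f C -> B = C).
  have /pcard_leP[f] := cardA j.
  exists f; split => [B AB|B C AB AC fBC]; first exact: (@funS _ _ _ _ f _ AB).
  by apply: (@inj _ _ _ f) => //; exact: mem_set.
pose l n x := f n (pblock (A n) id x).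
have block n x y : T x -> T y -> l n x = l n y -> pblock (A n) id x = pblock (A n) id y.
  move=> Tx Ty; have [_ h] := hf n; apply: h.
    by have [] := pblock_mem (pA n) Tx.
  by have [] := pblock_mem (pA n) Ty.
apply: (@chaining R O w0 V X d S l e g kap) => //.
- move=> x y xS yS; congr (f 0%N _).
  have [Ax _] := pblock_mem (pA 0%N) (ST _ xS); have [Ay _] := pblock_mem (pA 0%N) (ST _ yS).
  by move: Ax Ay; rewrite A0 /= => -> ->.
- move=> n x xS; have [h _] := hf n; apply: h.
  by have [] := pblock_mem (pA n) (ST _ xS).
- move=> n x y xS yS /(block n.+1 x y (ST _ xS) (ST _ yS)) E.
  have [Ax xx] := pblock_mem (pA n.+1) (ST _ xS).
  have [_ yy] := pblock_mem (pA n.+1) (ST _ yS).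
  have [C AC sub'] := refA n _ Ax; congr (f n _).
  rewrite (pblock_partition (pA n) AC (sub' _ xx)).
  by rewrite (pblock_partition (pA n) AC (x := y))//; apply: sub'; rewrite E.
- move=> n x y z xS yS zS xz yz; rewrite -lee_fin -diam_fin; last exact: ST.
  apply: diameter_ge.
    rewrite -(block n x z)//; try exact: ST.
    by have [] := pblock_mem (pA n) (ST _ xS).
  rewrite -(block n y z)//; try exact: ST.
  by have [] := pblock_mem (pA n) (ST _ yS).
- by move=> n x xS; apply: e_ge0; exact: ST.
- by move=> n x xS; apply: e_sum; exact: ST.
Qed.

End Gamma_bounds.


(** * Sublinear functionals and random permutations *)

Section Sublinear_functionals.
Variables (R : realType) (I : finType).
Implicit Types (G : (I -> R) -> R) (u v : I -> R).

(** Monotonicity is required only from nonnegative vectors on: the functional of interest, [rad S],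
    depends on the coordinates through their absolute values. *)
Definition sublinear G : Prop :=
  [/\ forall u v, (forall i, 0 <= u i) -> (forall i, u i <= v i) -> G u <= G v,
      forall c v, 0 <= c -> G (fun i => c * v i) = c * G v &
      forall u v, G (fun i => u i + v i) <= G u + G v].

Lemma sublinear_eq {G u v} : u =1 v -> G u = G v.
Proof. by move=> uv; congr G; apply/funext. Qed.

Lemma sublinear0 G : sublinear G -> G (fun=> 0) = 0.
Proof.
move=> [_ hom _]; rewrite -[RHS](mul0r (G (fun=> 0))) -hom//.
by apply: sublinear_eq => i; rewrite mul0r.
Qed.

Lemma sublinear_ge0 G u : sublinear G -> (forall i, 0 <= u i) -> 0 <= G u.
Proof. by move=> sG u0; rewrite -(sublinear0 sG); case: sG => mono _ _; exact: mono. Qed.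

Lemma sublinear_avg G (W : finType) (f : W -> I -> R) : sublinear G ->
  G (fun i => avg (fun w => f w i)) <= avg (fun w => G (f w)).
Proof.
move=> sG; have [_ hom sub] := sG.
rewrite [in leLHS]/avg hom ?invr_ge0// /avg ler_wpM2l ?invr_ge0//.
elim: (index_enum W) => [|w s ih].
  by rewrite big_nil (sublinear_eq (v := fun=> 0)) ?(sublinear0 sG)// => i; rewrite big_nil.
rewrite big_cons (sublinear_eq (v := fun i => f w i + \sum_(w <- s) f w i)); last first.
  by move=> i; rewrite big_cons.
by apply: le_trans (sub _ _) _; rewrite lerD2l.
Qed.

Lemma sublinear_avg_scale G (W : finType) (z : W -> I -> R) : sublinear G ->
  (forall w i, 0 <= z w i) ->
  sublinear (fun v => avg (fun w => G (fun i => v i * z w i))).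
Proof.
move=> [mono hom sub] z0; split.
- move=> u v u0 uv; apply: avg_le => w; apply: mono => i; first by rewrite mulr_ge0.
  by rewrite ler_wpM2r.
- move=> c v c0; rewrite -avgZ; apply: eq_avg => w; rewrite -hom//.
  by apply: sublinear_eq => i; rewrite mulrA.
- move=> u v; rewrite -avgD; apply: avg_le => w; apply: le_trans (sub _ _).
  by rewrite (sublinear_eq (v := fun i => u i * z w i + v i * z w i))// => i; rewrite mulrDl.
Qed.

Definition setc v (k : I) (z : R) : I -> R := fun i => if i == k then z else v i.

Lemma sublinear_setc_le G v k y z : sublinear G -> (forall i, 0 <= v i) ->
  0 <= y -> y <= z -> G (setc v k y) <= G (setc v k z).
Proof.
move=> [mono _ _] v0 y0 yz; apply: mono => i; rewrite /setc; first by case: eqP.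
by case: eqP.
Qed.

(** Convexity in one coordinate: [z] divides the segment from 0 to [K * z] in the ratio given by
    [K^-1]. *)
Lemma sublinear_setc_dilate G v k z K : sublinear G -> 1 <= K ->
  K * (G (setc v k z) - G (setc v k 0)) <= G (setc v k (K * z)) - G (setc v k 0).
Proof.
move=> [_ hom sub] K1; have K0 : 0 < K by lra.
have E i : setc v k z i = K^-1 * setc v k (K * z) i + (1 - K^-1) * setc v k 0 i.
  by rewrite /setc; case: eqP => _; field; rewrite gt_eqF.
rewrite (sublinear_eq E).
have := sub (fun i => K^-1 * setc v k (K * z) i) (fun i => (1 - K^-1) * setc v k 0 i).
have i0 : 0 <= K^-1 by rewrite invr_ge0 ltW.
have i1 : 0 <= 1 - K^-1 by rewrite subr_ge0 invf_le1.
rewrite (hom _ _ i0) (hom _ _ i1).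
move=> /(ler_wpM2l (ltW K0)).
have -> : K * (K^-1 * G (setc v k (K * z)) + (1 - K^-1) * G (setc v k 0)) =
  G (setc v k (K * z)) + (K - 1) * G (setc v k 0) by field; rewrite gt_eqF.
by lra.
Qed.

End Sublinear_functionals.

(** * Comparison of tails by coordinatewise replacement *)

Section Tail_comparison.
Variable R : realType.

(** A layer-cake sum along increasing thresholds: it telescopes to [g z - g p] when [z] is itself a
    threshold, and stays below [g z - g p] for any other [z >= p]. *)
Fixpoint layers (g : R -> R) (p : R) (s : seq R) (z : R) : R :=
  if s is u :: s' then (g u - g p) * (u <= z)%R%:R + layers g u s' z else 0.

Lemma layers_cake (g : R -> R) (p : R) (s : seq R) :
  (forall x y, 0 <= x -> x <= y -> g x <= g y) -> 0 <= p -> path <=%R p s ->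
  forall z, [/\ 0 <= layers g p s z, z < p -> layers g p s z = 0,
    p <= z -> layers g p s z <= g z - g p &
    z \in p :: s -> p <= z -> layers g p s z = g z - g p].
Proof.
move=> gm; elim: s p => [|u s ih] p p0 /=.
  move=> _ z; split => //; first by move=> pz; rewrite subr_ge0 gm.
  by rewrite inE => /eqP -> _; rewrite subrr.
move=> /andP[pu us] z; have [T0 Tlt Tle Teq] := ih u (le_trans p0 pu) us z.
have gup : 0 <= g u - g p by rewrite subr_ge0 gm.
have ge0 : 0 <= (g u - g p) * (u <= z)%R%:R + layers g u s z.
  by rewrite addr_ge0// mulr_ge0.
have le : p <= z -> (g u - g p) * (u <= z)%R%:R + layers g u s z <= g z - g p.
  move=> pz; have [uz|zu] := lerP u z.
    by rewrite mulr1; have := Tle uz; lra.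
  by rewrite mulr0 add0r Tlt// subr_ge0 gm.
split => //.
  move=> zp; have zu : z < u by exact: lt_le_trans pu.
  by rewrite Tlt// leNgt zu mulr0 addr0.
rewrite inE => /orP[/eqP zp|zus] pz.
  have E : g z - g p = 0 by rewrite zp subrr.
  by apply/eqP; rewrite eq_le (le pz) /= E.
have uz : u <= z.
  move: zus; rewrite inE => /orP[/eqP ->//|zs].
  by have /allP := order_path_min le_trans us; exact.
by rewrite Teq// uz mulr1; ring.
Qed.

(** With the values of [x] as thresholds, the layer-cake sum is exact on the side of [x] and a lower
    bound on the side of [y]; the tails are compared layer by layer. *)
Lemma tail_comparison (A B : finType) (b0 : B) (x : A -> R) (y : B -> R) (K : R) (g : R -> R) :
  1 <= K -> (forall a, 0 <= x a) -> (forall b, 0 <= y b) ->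
  (forall u, 0 < u -> avg (fun a => (u <= x a)%R%:R : R) <= K * avg (fun b => (u <= y b)%R%:R : R)) ->
  (forall x y, 0 <= x -> x <= y -> g x <= g y) ->
  avg (fun a => g (x a) - g 0) <= K * avg (fun b => g (y b) - g 0).
Proof.
move=> K1 x0 y0 tail gm.
have tail0 u : 0 <= u -> avg (fun a => (u <= x a)%R%:R : R) <= K * avg (fun b => (u <= y b)%R%:R : R).
  rewrite le_eqVlt => /orP[/eqP <-|/tail//].
  rewrite [X in _ <= _ * X](eq_avg (g := fun=> 1)); last by move=> b; rewrite y0.
  rewrite (avg_cst b0) mulr1; apply: le_trans K1.
  rewrite /avg; have [->|A0] := eqVneq #|A| 0%N; first by rewrite invr0 mul0r.
  rewrite ler_pdivrMl ?ltr0n ?lt0n// mulr1.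
  rewrite -[leRHS]sumr_const; apply: ler_sum => a _.
  by rewrite lern1 leq_b1.
pose s := sort <=%R [seq x a | a <- enum A].
have ps : path <=%R 0 s.
  rewrite path_sortedE; last exact: le_trans.
  rewrite sort_sorted ?andbT; last exact: le_total.
  by apply/allP => z; rewrite mem_sort => /mapP[a _ ->].
have L := layers_cake gm (lexx 0) ps.
have -> : avg (fun a => g (x a) - g 0) = avg (fun a => layers g 0 s (x a)).
  apply: eq_avg => a; have [_ _ _ ->]// := L (x a).
  by rewrite inE mem_sort map_f ?orbT// mem_enum.
apply: le_trans (_ : K * avg (fun b => layers g 0 s (y b)) <= _); last first.
  rewrite ler_wpM2l//; first by lra.
  by apply: avg_le => b; have [_ _ h _] := L (y b); exact: h.
have H t : forall p, 0 <= p -> path <=%R p t ->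
    avg (fun a => layers g p t (x a)) <= K * avg (fun b => layers g p t (y b)).
  elim: t => [|u t ih] p p0 /=.
    by move=> _; rewrite /avg !big1 ?mulr0.
  move=> /andP[pu us]; have u0 := le_trans p0 pu.
  rewrite !avgD !avgZ mulrDr lerD ?ih// [leRHS]mulrCA.
  by apply: ler_wpM2l; [rewrite subr_ge0 gm|exact: tail0].
exact: H.
Qed.

Lemma avg_snd (A B : finType) (a0 : A) (f : B -> R) :
  avg (fun p : A * B => f p.2) = avg f.
Proof. by rewrite (avg_pair (fun _ b => f b)) (avg_cst a0). Qed.

(** Replacement of [x] by [K * y] one coordinate at a time, [Z] being the coordinates already
    treated. [tail_comparison] loses a factor [K] in front of the increment, and convexity moves it
    into the argument, so the factors do not accumulate over the coordinates. *)
Lemma sublinear_tail_comparison (I A B : finType) (a0 : A) (b0 : B) (x : A -> R) (y : B -> R)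
    (K : R) (G : (I -> R) -> R) :
  1 <= K -> (forall a, 0 <= x a) -> (forall b, 0 <= y b) ->
  (forall u, 0 < u -> avg (fun a => (u <= x a)%R%:R : R) <= K * avg (fun b => (u <= y b)%R%:R : R)) ->
  sublinear G ->
  avg (fun w : {ffun I -> A} => G (fun i => x (w i))) <=
  K * avg (fun w : {ffun I -> B} => G (fun i => y (w i))).
Proof.
move=> K1 x0 y0 tail sG.
pose vec (Z : seq I) (w : {ffun I -> A * B}) (i : I) : R :=
  if i \in Z then K * y (w i).2 else x (w i).1.
have K0 : 0 <= K by lra.
have vec0 Z w i : 0 <= vec Z w i by rewrite /vec; case: ifP; rewrite ?mulr_ge0.
pose Q Z := avg (fun w => G (vec Z w)).
have step k Z : Q Z <= Q (k :: Z).
  have [kZ|kZ] := boolP (k \in Z).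
    rewrite le_eqVlt; apply/orP; left; apply/eqP; apply: eq_avg => w.
    apply: sublinear_eq => i; rewrite /vec inE; case: eqP => [->|//].
    by rewrite kZ.
  rewrite /Q [leLHS](avg_resample k) [leRHS](avg_resample k); apply: avg_le => w.
  have E1 c : G (vec Z (upd w k c)) = G (setc (vec Z w) k (x c.1)).
    apply: sublinear_eq => i; rewrite /vec /setc ffunE.
    by case: eqP => [->|//]; rewrite (negbTE kZ).
  have E2 c : G (vec (k :: Z) (upd w k c)) = G (setc (vec Z w) k (K * y c.2)).
    apply: sublinear_eq => i; rewrite /vec /setc ffunE inE.
    by case: eqP => [->|//].
  rewrite (eq_avg E1) (eq_avg E2).
  rewrite (avg_fst b0 (fun a => G (setc (vec Z w) k (x a)))).
  rewrite (avg_snd a0 (fun b => G (setc (vec Z w) k (K * y b)))).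
  pose g z := G (setc (vec Z w) k z).
  have gm z z' : 0 <= z -> z <= z' -> g z <= g z' by move=> ? ?; exact: sublinear_setc_le.
  have := tail_comparison b0 K1 x0 y0 tail gm.
  rewrite !avgB (avg_cst a0) (avg_cst b0) => h.
  have h2 : avg (fun b => K * (g (y b) - g 0)) <= avg (fun b => g (K * y b) - g 0).
    by apply: avg_le => b; exact: sublinear_setc_dilate.
  rewrite avgZ !avgB !(avg_cst b0) in h2.
  by rewrite -/(g _); rewrite /g in h h2 *; lra.
have chain Z : Q [::] <= Q Z.
  by elim: Z => // k Z ih; exact: le_trans ih (step k Z).
have := chain (enum I).
have -> : Q [::] = avg (fun w : {ffun I -> A} => G (fun i => x (w i))).
  rewrite /Q -(eq_avg (f := fun w : {ffun I -> A * B} => G (fun i => x ([ffun i => (w i).1] i)))).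
    rewrite (avg_pair_ffun (fun (u : {ffun I -> A}) (_ : {ffun I -> B}) => G (fun i => x (u i)))).
    by apply: eq_avg => u; rewrite (avg_cst [ffun=> b0]).
  by move=> w; apply: sublinear_eq => i; rewrite ffunE.
have -> // : Q (enum I) = K * avg (fun w : {ffun I -> B} => G (fun i => y (w i))).
rewrite /Q -(eq_avg (f := fun w : {ffun I -> A * B} => G (fun i => K * y ([ffun i => (w i).2] i)))).
  rewrite (avg_pair_ffun (fun (_ : {ffun I -> A}) (u : {ffun I -> B}) => G (fun i => K * y (u i)))).
  rewrite (avg_cst [ffun=> a0]) -avgZ; apply: eq_avg => u.
  by have [_ hom _] := sG; rewrite hom.
by move=> w; apply: sublinear_eq => i; rewrite ffunE /vec mem_enum.
Qed.

End Tail_comparison.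

Section Product_averages.
Variable R : realType.

Lemma avg_prod (I A : finType) (f : I -> A -> R) :
  avg (fun w : {ffun I -> A} => \prod_i f i (w i)) = \prod_i avg (f i).
Proof.
rewrite /avg -bigA_distr_bigA /= big_split /= prodr_const card_ffun natrX.
by rewrite exprVn.
Qed.

Lemma avg_coord (I A : finType) (a0 : A) (i : I) (f : A -> R) :
  avg (fun w : {ffun I -> A} => f (w i)) = avg f.
Proof.
rewrite (avg_resample i) -[RHS](avg_cst ([ffun=> a0] : {ffun I -> A})).
by apply: eq_avg => w; apply: eq_avg => a; rewrite ffunE eqxx.
Qed.

End Product_averages.

(** * Sampling with and without replacement *)

Section Sampling.
Variables (R : realType) (n : nat).
Notation N := n.+1.

(** The permutation is corrected by a transposition for each new index; injectivity on [s] keeps the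
    earlier values in place. *)
Lemma perm_extend (J : 'I_N -> 'I_N) (s : seq 'I_N) :
  {in s &, injective J} -> uniq s -> exists p : 'S_N, {in s, forall i, p i = J i}.
Proof.
elim: s => [|i s ih] inj_J; first by exists 1%g.
move=> /=/andP[i_s us].
have [|//|p pJ] := ih; first by move=> j k js ks; apply: inj_J; rewrite inE ?js ?ks orbT.
exists (p * tperm (p i) (J i))%g => j; rewrite permM inE => /orP[/eqP ->|js].
  by rewrite tpermL.
have ji : j != i by apply: contraNneq i_s => <-.
rewrite tpermD ?(inj_eq perm_inj) 1?eq_sym// pJ//.
by apply: contra_neq ji => /inj_J -> //; rewrite inE ?eqxx ?js ?orbT.
Qed.

Lemma expR1_le4 : expR 1 <= 4 :> R.
Proof.
have h : expR (2^-1) <= (1 - 2^-1)^-1 :> R by apply: expR_le_inv; lra.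
have E : (1 - 2^-1)^-1 = 2 :> R by field.
rewrite E in h.
have -> : expR 1 = expR (2^-1) * expR (2^-1) :> R by rewrite -expRD; congr expR; field.
by have := expR_ge0 (2^-1 : R); nra.
Qed.

Definition isolated (J : {ffun 'I_N -> 'I_N}) (i : 'I_N) : bool :=
  [forall j, (j != i) ==> (J j != J i)].

(** Given the value of [J] at [i], the other [n] values avoid it with probability [(n / n.+1) ^ n],
    which is at least [expR (- 1)]. *)
Lemma isolated_ge (i : 'I_N) :
  4^-1 <= avg (fun J : {ffun 'I_N -> 'I_N} => (isolated J i)%:R : R).
Proof.
rewrite (avg_resample i).
rewrite (eq_avg (g := fun J : {ffun 'I_N -> 'I_N} => avg (fun c : 'I_N =>
   \prod_j (if j == i then 1 else (J j != c)%:R)))); last first.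
  move=> J; apply: eq_avg => c.
  have [/forallP h|] := boolP (isolated _ i).
    rewrite big1// => j _; have := h j; rewrite !ffunE eqxx.
    by case: eqP => //= _ ->.
  rewrite /isolated negb_forall => /existsP[j]; rewrite negb_imply !ffunE eqxx => /andP[ji].
  rewrite (negbTE ji) negbK => Jj.
  by rewrite (bigD1 j)//= (negbTE ji) Jj mul0r.
rewrite avg_exchange; apply: (avg_ge_cst ord0) => c.
rewrite (avg_prod (fun j a => if j == i then 1 else (a != c)%:R)).
rewrite (bigD1 i)//= (eq_avg (g := fun=> 1)); last by move=> a; rewrite eqxx.
rewrite (avg_cst ord0) mul1r.
rewrite (eq_bigr (fun=> n%:R / N%:R)); last first.
  move=> j /negbTE ji; rewrite (eq_avg (g := fun a => 1 - (a == c)%:R)); last first.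
    by move=> a; rewrite ji; case: eqP => _; rewrite ?subrr ?subr0.
  rewrite avgB (avg_cst ord0) /avg card_ord (bigD1 c)//= eqxx big1 ?addr0; last first.
    by move=> a /negbTE ->.
  by rewrite mulr1 -natr1; field; rewrite natr1 pnatr_eq0.
rewrite prodr_const.
have -> : #|[pred j | j != i]| = n.
  by rewrite (eq_card (B := predC1 i))// cardC1 card_ord.
have [->|n0] := posnP n; first by rewrite expr0; lra.
have n0' : 0 < n%:R :> R by rewrite ltr0n.
have h : expR (- n%:R^-1) <= n%:R / N%:R :> R.
  apply: le_trans (expRN_le _) _; first by rewrite invr_ge0 ltW.
  rewrite le_eqVlt; apply/orP; left; apply/eqP; rewrite -natr1; field.
  have n1 : 0 < n%:R + 1 :> R by rewrite addr_gt0.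
  by rewrite !gt_eqF.
apply: le_trans (_ : expR (- n%:R^-1) ^+ n <= _); last first.
  by apply: lerXn2r; rewrite ?nnegrE ?expR_ge0// divr_ge0.
rewrite -expRM_natl mulrN divff ?gt_eqF// expRN.
by rewrite lef_pV2 ?posrE ?expR_gt0// expR1_le4.
Qed.

(* On the isolated indices, each of probability at least 1/4, the sample [J]
   extends to a permutation. *)
Lemma sampling_lower (G : ('I_N -> R) -> R) (a : 'I_N -> R) :
  sublinear G -> (forall i, 0 <= a i) ->
  avg (fun p : 'S_N => G (fun i => a (p i))) <=
  4 * avg (fun J : {ffun 'I_N -> 'I_N} => G (fun i => a (J i))).
Proof.
move=> sG a0; have [mono hom _] := sG.
have symJ (p : 'S_N) : avg (fun J : {ffun 'I_N -> 'I_N} => G (fun i => a (p (J i)))) =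
    avg (fun J : {ffun 'I_N -> 'I_N} => G (fun i => a (J i))).
  rewrite -(@avg_bij _ _ _ (fun J : {ffun 'I_N -> 'I_N} => [ffun i => p (J i)])
    (fun J => G (fun i => a (J i)))).
    by apply: eq_avg => J; apply: sublinear_eq => i; rewrite ffunE.
  exists (fun J : {ffun 'I_N -> 'I_N} => [ffun i => (p^-1)%g (J i)]) => J;
    apply/ffunP => i; rewrite !ffunE ?permK ?permKV//.
rewrite -ler_pdivrMl//.
(* [J] is followed by an independent uniform permutation of the values. For fixed [J] with extension
   [t], the composite of [t] and [p] is again uniform and agrees with that of [J] and [p] on the
   isolated indices. *)
rewrite -(avg_cst (1%g : 'S_N) (avg (fun J : {ffun 'I_N -> 'I_N} => G (fun i => a (J i))))).
rewrite -(eq_avg symJ) avg_exchange.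
apply: le_trans (_ : avg (fun J : {ffun 'I_N -> 'I_N} =>
   avg (fun p : 'S_N => G (fun i => (isolated J i)%:R * a (p i)))) <= _); last first.
  apply: avg_le => J.
  have [||t tJ] := @perm_extend J [seq i <- enum 'I_N | isolated J i].
  - move=> i j; rewrite !mem_filter => /andP[/forallP/(_ j) ij _] _ Jij.
    by apply/esym/eqP; apply: contraLR ij => ji; rewrite negb_imply ji Jij eqxx.
  - by rewrite filter_uniq ?enum_uniq.
  rewrite -(@avg_bij _ _ _ (fun p : 'S_N => (t * p)%g)); last first.
    by exists (fun p => (t^-1 * p)%g) => p; rewrite mulgA ?mulVg ?mulgV mul1g.
  apply: avg_le => p; apply: mono => i; first by rewrite mulr_ge0.
  case: (boolP (isolated J i)) => iJ; last by rewrite mul0r.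
  by rewrite mul1r permM tJ// mem_filter iJ mem_enum.
rewrite avg_exchange -avgZ; apply: avg_le => p.
apply: le_trans (sublinear_avg (fun (J : {ffun 'I_N -> 'I_N}) i => (isolated J i)%:R * a (p i)) sG).
rewrite -hom ?invr_ge0//; apply: mono => i; first by rewrite mulr_ge0 ?invr_ge0.
by rewrite avgZr ler_wpM2r// isolated_ge.
Qed.

Lemma avg_perm_coord (i : 'I_N) (f : 'I_N -> R) :
  avg (fun p : 'S_N => f (p i)) = avg f.
Proof.
have E j : avg (fun p : 'S_N => f (p j)) = avg (fun p : 'S_N => f (p i)).
  rewrite -(@avg_bij _ _ _ (fun p : 'S_N => (tperm i j * p)%g)); last first.
    by exists (fun p => (tperm i j * p)%g) => p; rewrite mulgA tperm2 mul1g.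
  by apply: eq_avg => p; rewrite permM tpermR.
rewrite -(avg_cst i (avg (fun p : 'S_N => f (p i)))).
rewrite -(eq_avg E) avg_exchange -[RHS](avg_cst (1%g : 'S_N)); apply: eq_avg => p.
by rewrite (avg_bij f) //; exists (p^-1)%g => j; rewrite ?permK ?permKV.
Qed.

(** [p i] counts the entries ranked above [i], with ties broken by index so that the ranks are
    distinct; with [i] itself these give [p i + 1] entries of value at least [y i]. *)
Lemma rank_perm (y : 'I_N -> R) : exists p : 'S_N, forall i,
  ((p i).+1 <= #|[pred j | (y i <= y j)%R]|)%N.
Proof.
pose above i := [pred j | (y i < y j) || (y i == y j) && (j < i)%N].
have cmp i j : (i \in above j) || (j \in above i) || (i == j).
  rewrite !inE; case: (ltgtP (y i) (y j)) => //= _; rewrite ?orbT//.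
  by case: (ltngtP i j) => //= ij; rewrite ?orbT//; apply/eqP/val_inj.
have sub i j : j \in above i -> above j \proper above i.
  move=> ji; apply/properP; split; last by exists j; rewrite // !inE ltxx ltnn andbF.
  apply/fintype.subsetP => k; move: ji; rewrite !inE.
  case/orP => [ij|/andP[/eqP -> ji]].
    by case/orP => [jk|/andP[/eqP <- _]]; rewrite ?(lt_trans ij jk) ?ij.
  case/orP => [->//|/andP[-> kj]]; by rewrite (ltn_trans kj ji) orbT.
have lt i : (#|above i| < N)%N.
  have iA : i \notin above i by rewrite inE ltxx ltnn andbF.
  by have := max_card [predU1 i & above i]; rewrite cardU1 iA card_ord.
pose f i := Ordinal (lt i).
have f_inj : injective f.
  move=> i j /(congr1 val) /= e; have /orP[/orP[|]|/eqP//] := cmp i j.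
    by move=> /sub /proper_card; rewrite e ltnn.
  by move=> /sub /proper_card; rewrite e ltnn.
exists (perm f_inj) => i; rewrite permE /=; apply: proper_card.
apply/properP; split; last by exists i; rewrite !inE ?lexx ?ltxx ?ltnn ?andbF.
by apply/fintype.subsetP => j; rewrite !inE => /orP[/ltW//|/andP[/eqP -> _]].
Qed.

(* The quantile at level [i.+1 / M] of the tail [exp (- u ^ p)]: for [M = n] these
   are the weights in [Tperm], for large [M] a discretization of the law. *)
Definition quantile (p : R) (M : nat) (i : 'I_M) : R :=
  ln (M%:R / i.+1%:R) `^ p^-1.

Lemma ln_ratio_ge0 (i : 'I_N) : 0 <= ln (N%:R / i.+1%:R) :> R.
Proof. by rewrite ln_ge0// ler_pdivlMr// mul1r ler_nat. Qed.

Variables (A : finType) (a0 : A) (y : A -> R) (s : R) (G : ('I_N -> R) -> R).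
Hypothesis s0 : 0 < s.
Hypothesis y0 : forall a, 0 <= y a.
Hypothesis ymom : avg (fun a => expR (y a `^ s / 2)) <= 2.
Hypothesis sG : sublinear G.

Lemma le_powRV (x c : R) : 0 <= x -> x `^ s <= c -> x <= c `^ s^-1.
Proof.
move=> x0 xc; have -> : x = (x `^ s) `^ s^-1.
  by rewrite -powRrM mulfV ?gt_eqF// powRr1.
apply: ge0_ler_powR; rewrite ?nnegrE ?powR_ge0 ?invr_ge0 ?(ltW s0)//.
exact: le_trans (powR_ge0 _ _) xc.
Qed.

Let K1 : R := (2 * (1 + s^-1)) `^ s^-1.

(** All order statistics are dominated at once, up to the single random factor [Z J]. Its mean is
    finite because [Z J <= K1 * W J] and [W] has mean at most 2; exchangeability makes the ordering
    permutation uniform. *)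
Lemma sampling_upper_log :
  avg (fun J : {ffun 'I_N -> A} => G (fun i => y (J i))) <=
  2 * K1 * avg (fun p : 'S_N => G (fun i => (1 + ln (N%:R / (p i).+1%:R)) `^ s^-1)).
Proof.
have [mono hom _] := sG.
pose W (J : {ffun 'I_N -> A}) : R := avg (fun i => expR (y (J i) `^ s / 2)).
have W1 J : 1 <= W J.
  apply: (avg_ge_cst ord0) => i; rewrite -expR0 ler_expR.
  by rewrite divr_ge0// powR_ge0.
pose Z J := (2 * (1 + ln (W J))) `^ s^-1.
have Z_le J : Z J <= K1 * W J.
  have W0 : 0 < W J by exact: lt_le_trans (W1 J).
  have lnW0 : 0 <= ln (W J) by rewrite ln_ge0.
  rewrite -[X in _ * X](_ : (W J `^ s) `^ s^-1 = _); last first.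
    by rewrite -powRrM mulfV ?gt_eqF// powRr1// ltW.
  have i0 : 0 < s^-1 by rewrite invr_gt0.
  have Ws1 : 1 <= W J `^ s by rewrite -(powRr0 (W J)); apply: ler_powR => //; exact: ltW.
  rewrite /K1 -powRM ?powR_ge0//; last by lra.
  apply: ge0_ler_powR; rewrite ?nnegrE ?invr_ge0 ?mulr_ge0 ?powR_ge0 ?(ltW s0)//; try lra.
  rewrite -mulrA ler_pM2l//.
  have : ln (W J `^ s) <= W J `^ s - 1 by apply: ln_le_subr1; exact: powR_gt0.
  rewrite ln_powR => h.
  have : ln (W J) <= s^-1 * (W J `^ s - 1).
    by rewrite -ler_pdivrMl ?invr_gt0// invrK.
  by lra.
(* Markov's inequality for the order statistics of [y \o J]. *)
have key (J : {ffun 'I_N -> A}) : exists p : 'S_N, forall i,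
    y (J i) <= Z J * (1 + ln (N%:R / (p i).+1%:R)) `^ s^-1.
  have [p hp] := rank_perm (fun i => y (J i)); exists p => i.
  have W0 : 0 < W J by exact: lt_le_trans (W1 J).
  have lnW0 : 0 <= ln (W J) by rewrite ln_ge0.
  set k := (p i).+1 in hp *; have k0 : 0 < k%:R :> R by rewrite ltr0n.
  have lk : 0 <= ln (N%:R / k%:R) :> R by exact: ln_ratio_ge0.
  rewrite /Z -powRM; [|lra|lra].
  apply: le_powRV => //.
  have h : k%:R * expR (y (J i) `^ s / 2) <= N%:R * W J.
    rewrite /W /avg card_ord mulVKf ?pnatr_eq0//.
    apply: le_trans (_ : \sum_(j in [pred j | y (J i) <= y (J j)]) expR (y (J i) `^ s / 2) <= _).
      rewrite sumr_const -[leRHS]mulr_natl ler_pM2r ?expR_gt0// ler_nat.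
      exact: hp.
    rewrite [leRHS](bigID (fun j => j \in [pred j | y (J i) <= y (J j)])) /=.
    apply: ler_wpDr; first by apply: sumr_ge0 => j _; exact: expR_ge0.
    apply: ler_sum => j; rewrite inE => yij; rewrite ler_expR ler_pM2r ?invr_gt0//.
    by apply: ge0_ler_powR; rewrite ?nnegrE ?(ltW s0).
  have h2 : y (J i) `^ s / 2 <= ln (N%:R / k%:R) + ln (W J).
    rewrite -ler_expR expRD !lnK ?posrE ?divr_gt0//.
    by rewrite mulrAC ler_pdivlMr// mulrC.
  have : 0 <= ln (W J) * ln (N%:R / k%:R) by exact: mulr_ge0.
  by lra.
pose Gt := avg (fun p : 'S_N => G (fun i => (1 + ln (N%:R / (p i).+1%:R)) `^ s^-1)).
have Gt0 : 0 <= Gt.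
  by apply: avg_ge0 => p; apply: (sublinear_ge0 sG) => i; exact: powR_ge0.
have symJ (q : 'S_N) : avg (fun J : {ffun 'I_N -> A} => G (fun i => y (J (q i)))) =
    avg (fun J : {ffun 'I_N -> A} => G (fun i => y (J i))).
  rewrite -(@avg_bij _ _ _ (fun J : {ffun 'I_N -> A} => [ffun i => J (q i)])
    (fun J => G (fun i => y (J i)))).
    by apply: eq_avg => J; apply: sublinear_eq => i; rewrite ffunE.
  exists (fun J : {ffun 'I_N -> A} => [ffun i => J ((q^-1)%g i)]) => J;
    apply/ffunP => i; rewrite !ffunE ?permK ?permKV//.
rewrite -(avg_cst (1%g : 'S_N) (avg (fun J : {ffun 'I_N -> A} => G (fun i => y (J i))))).
rewrite -(eq_avg symJ) avg_exchange.
apply: le_trans (_ : avg (fun J => Z J * Gt) <= _).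
  apply: avg_le => J; have [p hp] := key J.
  rewrite /Gt -[in leRHS](@avg_bij _ _ _ (fun q : 'S_N => (q * p)%g)); last first.
    by exists (fun q => (q * p^-1)%g) => q; rewrite -mulgA ?mulVg ?mulgV mulg1.
  rewrite -avgZ; apply: avg_le => q.
  rewrite -(hom (Z J) _ (powR_ge0 _ _)).
  by apply: mono => i; [exact: y0|rewrite permM; exact: hp].
rewrite avgZr -/Gt ler_wpM2r//.
apply: le_trans (avg_le Z_le) _; rewrite avgZ mulrC ler_wpM2r ?powR_ge0//.
rewrite /W avg_exchange (eq_avg (g := fun=> avg (fun a => expR (y a `^ s / 2)))).
  by rewrite (avg_cst ord0).
by move=> i; rewrite (avg_coord a0 i (fun a => expR (y a `^ s / 2))).
Qed.

(** Absorbs the 1 in [1 + ln]: the first half of the ranks has weights at least [ln 2 ^ (1/s)], and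
    that half is at least a third of all ranks, with equality for three of them. For a single rank
    the only weight is 0, hence [0 < n]. *)
Lemma sublinear_const_le : (0 < n)%N ->
  (ln 2) `^ s^-1 / 3 * G (fun=> 1) <= avg (fun p : 'S_N => G (fun i => quantile s (p i))).
Proof.
move=> n0; have [mono hom _] := sG.
pose c : R := (ln 2) `^ s^-1; have c0 : 0 <= c by exact: powR_ge0.
apply: le_trans (_ : avg (fun p : 'S_N => G (fun i => c * (p i < N./2)%N%:R)) <= _); last first.
  apply: avg_le => p; apply: mono => i; first by rewrite mulr_ge0.
  case: ltnP => ip; last by rewrite mulr0 powR_ge0.
  rewrite mulr1; apply: ge0_ler_powR; rewrite ?nnegrE ?invr_ge0 ?(ltW s0)//.
  - by rewrite ln_ge0// ler1n.
  - exact: ln_ratio_ge0.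
  rewrite ler_ln ?posrE ?divr_gt0// ler_pdivlMr// -natrM ler_nat.
  by move: ip; have := odd_double_half N; set h := N./2; case: (odd N) => /=; lia.
apply: le_trans (sublinear_avg (fun (p : 'S_N) i => c * (p i < N./2)%N%:R) sG).
rewrite -hom; last by rewrite divr_ge0.
apply: mono => i; first by rewrite mulr1 divr_ge0.
rewrite mulr1 avgZ ler_wpM2l// (avg_perm_coord i (fun j => (j < N./2)%N%:R)).
rewrite /avg card_ord ler_pdivlMl// -natr_sum.
rewrite ler_pdivrMr// -natrM ler_nat.
have -> : (\sum_(j < N) (j < N./2))%N = N./2.
  rewrite -(big_mkord xpredT (fun j => (j < N./2)%N : nat)).
  rewrite (big_cat_nat _ (n := N./2))//=; last by have := odd_double_half N; set h := N./2; case: (odd N) => /=; lia.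
  rewrite (eq_big_nat _ _ (F2 := fun=> 1%N)); last by move=> j /andP[_ ->].
  rewrite sum_nat_const_nat subn0 muln1 big_nat_cond big1 ?addn0// => j.
  by rewrite andbT => /andP[h _]; rewrite ltnNge h.
have := odd_double_half N; move: n0; set h := N./2; case: (odd N) => /=; lia.
Qed.

Lemma sampling_upper : (0 < n)%N ->
  avg (fun J : {ffun 'I_N -> A} => G (fun i => y (J i))) <=
  2 * K1 * (2 `^ s^-1 * (1 + 3 / (ln 2) `^ s^-1)) *
  avg (fun p : 'S_N => G (fun i => quantile s (p i))).
Proof.
move=> n0; have [mono hom sub] := sG.
apply: le_trans sampling_upper_log _; rewrite -[leRHS]mulrA ler_wpM2l//.
  by rewrite mulr_ge0// powR_ge0.
have i0 : 0 < s^-1 by rewrite invr_gt0.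
have ln20 : 0 < ln 2 :> R by rewrite ln_gt0// ltr1n.
have c0 : 0 < (ln 2 : R) `^ s^-1 by exact: powR_gt0.
have h1 (p : 'S_N) : G (fun i => (1 + ln (N%:R / (p i).+1%:R)) `^ s^-1) <=
    2 `^ s^-1 * (G (fun=> 1) + G (fun i => quantile s (p i))).
  have t0 : 0 <= 2 `^ s^-1 :> R by exact: powR_ge0.
  apply: le_trans (_ : G (fun i => 2 `^ s^-1 * (1 + quantile s (p i))) <= _); last first.
    by rewrite hom// ler_wpM2l.
  apply: mono => i; first exact: powR_ge0.
  have q0 : 0 <= quantile s (p i) by exact: powR_ge0.
  have l0 := ln_ratio_ge0 (p i).
  set z := ln _ in l0 *.
  have -> : 2 `^ s^-1 * (1 + quantile s (p i)) =
      (2 * (1 + quantile s (p i)) `^ s) `^ s^-1.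
    rewrite powRM ?powR_ge0// -powRrM mulfV ?gt_eqF// powRr1//.
    by lra.
  apply: ge0_ler_powR; rewrite ?nnegrE ?mulr_ge0 ?powR_ge0 ?(ltW i0)//; first by lra.
  have e1 : 1 <= (1 + quantile s (p i)) `^ s.
    have E : 1 `^ s = 1 :> R by rewrite powR1.
    rewrite -[leLHS]E; apply: ge0_ler_powR; rewrite ?nnegrE ?(ltW s0)//; lra.
  have e2 : z <= (1 + quantile s (p i)) `^ s.
    have -> : z = quantile s (p i) `^ s.
      by rewrite /quantile -/z -powRrM mulVf ?gt_eqF// powRr1.
    apply: ge0_ler_powR; rewrite ?nnegrE ?(ltW s0)//; lra.
  by lra.
apply: le_trans (avg_le h1) _.
rewrite avgZ avgD (avg_cst (1%g : 'S_N)) -mulrA ler_wpM2l ?powR_ge0//.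
rewrite mulrDl mul1r addrC lerD2l.
have := sublinear_const_le n0.
set a := avg _; set b := _ `^ _; set g1 := G _ => h.
have -> : g1 = 3 / b * (b / 3 * g1) by field; rewrite gt_eqF.
by rewrite ler_wpM2l// divr_ge0// ltW.
Qed.

End Sampling.

(** * Moments and tails of the quantile laws *)

Section Quantiles.
Variable R : realType.

Lemma quantile_ge0 (p : R) M (i : 'I_M) : 0 <= quantile p i.
Proof. exact: powR_ge0. Qed.

Lemma quantile_powR (p : R) m (i : 'I_m.+1) : 0 < p ->
  quantile p i `^ p = ln (m.+1%:R / i.+1%:R).
Proof.
by move=> p0; rewrite /quantile -powRrM mulVf ?gt_eqF// powRr1// ln_ratio_ge0.
Qed.

(** The exponential at the quantile of index [i] is the square root of [m.+1 / i.+1], and the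
    inverse square roots up to [k] sum to at most twice the square root of [k]. *)
Lemma quantile_moment (p : R) m : 0 < p ->
  avg (fun i : 'I_m.+1 => expR (quantile p i `^ p / 2)) <= 2.
Proof.
move=> p0.
have E (i : 'I_m.+1) : expR (quantile p i `^ p / 2) =
    Num.sqrt m.+1%:R * (Num.sqrt i.+1%:R)^-1.
  rewrite quantile_powR//; set x := m.+1%:R / i.+1%:R.
  have x0 : 0 < x by rewrite divr_gt0.
  have -> : expR (ln x / 2) = Num.sqrt x.
    rewrite -powR12_sqrt ?ltW// /powR gt_eqF// mulrC//.
  by rewrite /x sqrtrM// sqrtrV.
rewrite (eq_avg E) avgZ.
have H k : \sum_(i < k) (Num.sqrt i.+1%:R : R)^-1 <= 2 * Num.sqrt k%:R.
  elim: k => [|k ih]; first by rewrite big_ord0 mulr_ge0// sqrtr_ge0.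
  rewrite big_ord_recr /=; set a : R := Num.sqrt k.+1%:R in ih *.
  have a0 : 0 < a by rewrite sqrtr_gt0.
  have aE : a ^+ 2 = k%:R + 1 by rewrite sqr_sqrtr// natr1.
  set b : R := Num.sqrt k%:R in ih *.
  have b0 : 0 <= b by exact: sqrtr_ge0.
  have bE : b ^+ 2 = k%:R by rewrite sqr_sqrtr.
  suff : a^-1 <= 2 * (a - b) by lra.
  rewrite -[leLHS]mul1r ler_pdivrMr//.
  have : 0 <= (a - b) ^+ 2 by exact: sqr_ge0.
  by rewrite sqrrB -mulr_natl; nra.
rewrite /avg card_ord.
have := H m.+1; set t : R := \sum_(i < _) _ => Ht.
set q : R := Num.sqrt m.+1%:R in Ht *.
have q2 : q ^+ 2 = m.+1%:R by rewrite sqr_sqrtr.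
have q0 : 0 < q by rewrite sqrtr_gt0.
rewrite -q2; have -> : q * ((q ^+ 2)^-1 * t) = t / q by field; rewrite gt_eqF.
by rewrite ler_pdivrMr.
Qed.

Lemma avg_ord_le m (x : R) : 0 <= x -> x <= m.+1%:R ->
  x - 1 <= m.+1%:R * avg (fun i : 'I_m.+1 => (i.+1%:R <= x)%R%:R) <= x.
Proof.
move=> x0 xm.
have /andP[t1 t2] := truncn_itv x0; set t := Num.truncn x in t1 t2.
have tM : (t <= m.+1)%N by rewrite -(ler_nat R); apply: le_trans xm.
rewrite /avg card_ord mulVKf ?pnatr_eq0//.
have -> : \sum_(i < m.+1) (i.+1%:R <= x)%R%:R = t%:R :> R.
  rewrite -natr_sum; congr _%:R.
  rewrite (eq_bigr (fun i : 'I_m.+1 => (i < t)%N : nat)); last first.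
    by move=> i _; rewrite truncn_gt_nat.
  rewrite -(big_mkord xpredT (fun i => (i < t)%N : nat)).
  rewrite (big_cat_nat _ (n := t))//=.
  rewrite (eq_big_nat _ _ (F2 := fun=> 1%N)); last by move=> j /andP[_ ->].
  rewrite sum_nat_const_nat subn0 muln1 big_nat_cond big1 ?addn0// => j.
  by rewrite andbT => /andP[h _]; rewrite ltnNge h.
by rewrite t1 andbT lerBlDr natr1 ltW.
Qed.

Lemma quantile_geE (p u : R) m (i : 'I_m.+1) : 0 < p -> 0 < u ->
  (u <= quantile p i) = (i.+1%:R <= m.+1%:R * expR (- (u `^ p))).
Proof.
move=> p0 u0; transitivity (u `^ p <= quantile p i `^ p).
  apply/idP/idP => h.
    by apply: ge0_ler_powR; rewrite ?nnegrE ?quantile_ge0 ?(ltW p0) ?(ltW u0).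
  rewrite leNgt; apply/negP => ltq; move: h; rewrite leNgt => /negP; apply.
  by apply: gt0_ltr_powR; rewrite ?nnegrE ?quantile_ge0 ?(ltW u0).
rewrite quantile_powR// -ler_expR lnK ?posrE ?divr_gt0//.
by rewrite ler_pdivlMr// expRN ler_pdivlMr ?expR_gt0// mulrC.
Qed.

Lemma quantile_tail (p u : R) m : 0 < p -> 0 < u ->
  expR (- (u `^ p)) - m.+1%:R^-1 <=
  avg (fun i : 'I_m.+1 => (u <= quantile p i)%R%:R) <= expR (- (u `^ p)).
Proof.
move=> p0 u0.
rewrite (eq_avg (g := fun i : 'I_m.+1 => (i.+1%:R <= m.+1%:R * expR (- (u `^ p)))%R%:R)); last first.
  by move=> i; rewrite quantile_geE.
have e1 : expR (- (u `^ p)) <= 1 by rewrite -[leRHS]expR0 ler_expR oppr_le0 powR_ge0.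
have /andP[h1 h2] : m.+1%:R * expR (- (u `^ p)) - 1 <= m.+1%:R *
    avg (fun i : 'I_m.+1 => (i.+1%:R <= m.+1%:R * expR (- (u `^ p)))%R%:R) <= m.+1%:R * expR (- (u `^ p)).
  apply: avg_ord_le; first by rewrite mulr_ge0// expR_ge0.
  by rewrite -[leRHS]mulr1 ler_pM2l.
have m0 : 0 < m.+1%:R :> R by rewrite ltr0n.
apply/andP; split; last by rewrite -(ler_pM2l m0).
rewrite -(ler_pM2l m0); apply: le_trans h1.
by rewrite mulrBr divff// gt_eqF.
Qed.

(** The additive error [m.+1^-1] becomes a relative one on [u <= b], where the tail is bounded
    below. A bounded range suffices for comparison with a variable on a finite set. *)
Lemma quantile_tail_eventually (p b : R) (q : R) : 0 < p -> 0 < q -> q < 1 ->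
  exists m0, forall m, (m0 <= m)%N -> forall u, 0 < u -> u <= b ->
  q * expR (- (u `^ p)) <= avg (fun i : 'I_m.+1 => (u <= quantile p i)%R%:R).
Proof.
move=> p0 q0 q1.
have z0 : 0 < (1 - q) * expR (- (b `^ p)) by rewrite mulr_gt0 ?expR_gt0// subr_gt0.
exists (Num.bound ((1 - q) * expR (- (b `^ p)))^-1) => m hm u u0 ub.
have /andP[h _] := quantile_tail m p0 u0.
apply: le_trans h.
have h1 : expR (- (b `^ p)) <= expR (- (u `^ p)).
  rewrite ler_expR lerN2; apply: ge0_ler_powR; rewrite ?nnegrE ?(ltW p0) ?(ltW u0)//.
  by apply: ltW; exact: lt_le_trans ub.
have h2 : m.+1%:R^-1 <= (1 - q) * expR (- (b `^ p)).
  rewrite invf_ple ?posrE//; apply/ltW.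
  apply: lt_le_trans (archi_boundP _) _; first by rewrite invr_ge0 ltW.
  by rewrite ler_nat; exact: leq_trans hm _.
have q1' : 0 <= 1 - q by rewrite subr_ge0 ltW.
move: h2 (ler_wpM2l q1' h1); set a := _^-1; set e1 := expR _; set e2 := expR _.
by lra.
Qed.

End Quantiles.

(** * Rademacher averages and symmetrization *)

Section Rademacher_functional.
Variables (R : realType) (n : nat).
Notation V := 'rV[R]_n.
Implicit Types (S : seq V) (v : 'I_n -> R).

Definition rad S v : R := avg (fun e : {ffun 'I_n -> bool} =>
  smax S (fun t => \sum_k t ord0 k * (v k * sg R (e k)))).

Lemma rad_sign S v (e : {ffun 'I_n -> bool}) :
  rad S (fun k => v k * sg R (e k)) = rad S v.
Proof.
rewrite /rad -(@avg_bij _ _ _ (fun w : {ffun 'I_n -> bool} => [ffun k => e k == w k])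
  (fun w => smax S (fun t => \sum_k t ord0 k * (v k * sg R (w k))))); last first.
  apply: inv_bij => w; apply/ffunP => k; rewrite !ffunE.
  by case: (e k) (w k) => [] [].
apply: eq_avg => w; apply: eq_smax => t _; apply: eq_bigr => k _.
by rewrite ffunE; case: (e k) (w k) => [] [] /=; ring.
Qed.

Lemma rad_norm S v : rad S v = rad S (fun k => `|v k|).
Proof.
rewrite -(rad_sign S v [ffun k => 0 <= v k]).
congr rad; apply/funext => k; rewrite ffunE.
by case: (lerP 0 (v k)) => h; rewrite /= ?mulr1 ?mulrN1 ?(ger0_norm h) ?(ltr0_norm h).
Qed.

Lemma radZ S c v : 0 <= c -> rad S (fun k => c * v k) = c * rad S v.
Proof.
move=> c0; rewrite /rad -avgZ; apply: eq_avg => w.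
rewrite -smaxZ//; apply: eq_smax => t _; rewrite mulr_sumr.
by apply: eq_bigr => k _; ring.
Qed.

Lemma radD S u v : rad S (fun k => u k + v k) <= rad S u + rad S v.
Proof.
rewrite /rad -avgD; apply: avg_le => w; apply: le_trans (smaxD _ _ _).
apply: smax_le2 => t _; rewrite -big_split /=.
by rewrite le_eqVlt; apply/orP; left; apply/eqP; apply: eq_bigr => k _; ring.
Qed.

(* Contraction principle: each coordinate of [u] is moved to that of [v], and
   [u] is then a convex combination of [v] and its reflection. *)
Lemma rad_contraction S u v : (forall k, `|u k| <= `|v k|) -> rad S u <= rad S v.
Proof.
move=> uv.
pose mix (L : seq 'I_n) k := if k \in L then v k else u k.
have step L k : rad S (mix L) <= rad S (mix (k :: L)).
  set z := mix (k :: L).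
  pose lam := mix L k / v k.
  have lam1 : `|lam| <= 1.
    rewrite /lam /mix normrM normfV; have [v0|v0] := eqVneq (v k) 0.
      by rewrite v0 normr0 invr0 mulr0.
    rewrite ler_pdivrMr ?normr_gt0// mul1r; case: ifP => // _; exact: lexx.
  have lamE : mix L k = lam * v k.
    rewrite /lam; have [v0|v0] := eqVneq (v k) 0; last by rewrite divfK.
    rewrite v0 invr0 !mulr0 /mix; case: ifP => _; first exact: v0.
    by have := uv k; rewrite v0 normr0 normr_le0 => /eqP.
  have E : mix L = (fun j => (1 + lam) / 2 * z j +
      (1 - lam) / 2 * (z j * sg R ([ffun i => i != k] j))).
    apply/funext => j; rewrite ffunE /z; have [->|jk] := eqVneq j k.
      rewrite lamE [mix (k :: L) k]/mix inE eqxx /=.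
      by field.
    by rewrite {1 2 3}/mix inE (negbTE jk) /=; field.
  move: lam1; rewrite ler_norml => /andP[l1 l2].
  rewrite E; apply: le_trans (radD _ _ _) _.
  have c1 : 0 <= (1 + lam) / 2 by lra.
  have c2 : 0 <= (1 - lam) / 2 by lra.
  rewrite (radZ _ z c1) (radZ _ (fun j => z j * _) c2) rad_sign -mulrDl.
  by have -> : (1 + lam) / 2 + (1 - lam) / 2 = 1 by [field]; rewrite mul1r.
have chain L : rad S u <= rad S (mix L).
  by elim: L => [|k L ih]; [exact: lexx|exact: le_trans ih (step L k)].
apply: le_trans (chain (enum 'I_n)) _.
rewrite le_eqVlt; apply/orP; left; apply/eqP; congr rad; apply/funext => k.
by rewrite /mix mem_enum.
Qed.

Lemma rad_sublinear S : sublinear (rad S).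
Proof.
split.
- move=> u v u0 uv; apply: rad_contraction => k.
  by rewrite !ger0_norm//; exact: le_trans (uv k).
- by move=> c v; exact: radZ.
- exact: radD.
Qed.

(** Symmetry of the law of [x] is expressed by the involution [nu] of the sample space, which lets
    independent signs be inserted. *)
Lemma symmetrization (A : finType) (x : A -> R) (nu : A -> A) S v :
  involutive nu -> (forall a, x (nu a) = - x a) ->
  avg (fun w : {ffun 'I_n -> A} => smax S (fun t => \sum_k t ord0 k * (v k * x (w k)))) =
  avg (fun w : {ffun 'I_n -> A} => rad S (fun k => v k * `|x (w k)|)).
Proof.
move=> nuK xnu.
have E (e : {ffun 'I_n -> bool}) :
    avg (fun w : {ffun 'I_n -> A} => smax S (fun t => \sum_k t ord0 k * (v k * x (w k)))) =
    avg (fun w : {ffun 'I_n -> A} => smax S (fun t => \sum_k t ord0 k * (v k * x (w k) * sg R (e k)))).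
  rewrite -[LHS](@avg_bij _ _ _ (fun w : {ffun 'I_n -> A} => [ffun k => if e k then w k else nu (w k)])).
    apply: eq_avg => w; apply: eq_smax => t _; apply: eq_bigr => k _.
    by rewrite ffunE; case: (e k); rewrite /= ?xnu; ring.
  apply: inv_bij => w; apply/ffunP => k; rewrite !ffunE.
  by case: (e k); rewrite ?nuK.
rewrite -[LHS](avg_cst ([ffun=> true] : {ffun 'I_n -> bool})) (eq_avg E) avg_exchange.
apply: eq_avg => w; rewrite -/(rad S (fun k => v k * x (w k))) rad_norm [RHS]rad_norm.
by congr rad; apply/funext => k; rewrite !normrM normr_id.
Qed.

(** Reindexing by [p] moves the weight [a k] to the coordinate [p k]; the permutation then acts on
    the weights, through its inverse, and the set [S] stays fixed. *)
Lemma rad_permute (A : finType) (x : A -> R) (nu : A -> A) S (a : 'I_n -> R) (p : 'S_n) :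
  involutive nu -> (forall b, x (nu b) = - x b) ->
  avg (fun w : {ffun 'I_n -> A} =>
    smax [seq \row_k (t ord0 (p k) * a k) | t : V <- S]
      (fun t => \sum_k t ord0 k * x (w k))) =
  avg (fun w : {ffun 'I_n -> A} => rad S (fun k => a ((p^-1)%g k) * `|x (w k)|)).
Proof.
move=> nuK xnu; rewrite -(symmetrization S _ nuK xnu).
rewrite -[RHS](@avg_bij _ _ _ (fun w : {ffun 'I_n -> A} => [ffun k => w ((p^-1)%g k)])); last first.
  exists (fun w : {ffun 'I_n -> A} => [ffun k => w (p k)]) => w;
    by apply/ffunP => k; rewrite !ffunE ?permK ?permKV.
apply: eq_avg => w; rewrite smax_map; apply: eq_smax => t _.
rewrite [RHS](reindex_inj (@perm_inj _ p)) /=; apply: eq_bigr => k _.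
by rewrite mxE ffunE permK mulrA.
Qed.

End Rademacher_functional.


(** * Discretization of the coefficients *)

Section Discretization.
Variables (R : realType) (r : R).
Hypothesis r0 : 0 < r.
Implicit Types x : R.

(** Places the tail probability of [|x|] among [m.+1] equal intervals, which makes the cells
    equiprobable, and rounds [|x|] down to a quantile. The [minn] acts only at [x = 0], where the
    tail equals 1. *)
Definition cell_index m x : 'I_m.+1 :=
  inord (minn m (Num.truncn (m.+1%:R * expR (- (`|x| `^ r))))).

Definition cell_value m x : R := quantile r (cell_index m x) * sg R (0 <= x).

Lemma val_cell_index m x : cell_index m x =
  minn m (Num.truncn (m.+1%:R * expR (- (`|x| `^ r)))) :> nat.
Proof. by rewrite inordK// ltnS geq_minl. Qed.

Lemma cell_index_le m x (i : 'I_m.+1) :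
  (cell_index m x <= i)%N = (i == m :> nat) || (quantile r i < `|x|).
Proof.
rewrite val_cell_index geq_min; have [->|im] := eqVneq (i : nat) m.
  by rewrite leqnn.
have -> : (m <= i)%N = false.
  by apply/negbTE; rewrite -ltnNge ltn_neqAle im -ltnS ltn_ord.
rewrite /= truncn_le_nat !ltNge; congr (~~ _).
have [x0|x0] := ltrP 0 `|x|; first by rewrite quantile_geE.
have -> : `|x| = 0 by apply/eqP; rewrite eq_le x0 normr_ge0.
rewrite powR0 ?gt_eqF// oppr0 expR0 mulr1 quantile_ge0 ler_nat ltn_ord.
by [].
Qed.

Lemma cell_value_norm m x : `|cell_value m x| = quantile r (cell_index m x).
Proof.
rewrite /cell_value normrM ger0_norm ?quantile_ge0//.
by case: (0 <= x); rewrite /= ?normrN normr1 mulr1.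
Qed.

Lemma quantile_cell_le m x : quantile r (cell_index m x) <= `|x|.
Proof.
have := cell_index_le x (cell_index m x); rewrite leqnn => /esym/orP[/eqP E|/ltW//].
rewrite /quantile E divff ?pnatr_eq0// ln1 powR0 ?normr_ge0//.
by rewrite invr_eq0 gt_eqF.
Qed.

Lemma cell_value_approx x e : 0 < e ->
  exists m0, forall m, (m0 <= m)%N -> `|cell_value m x - x| <= e.
Proof.
move=> e0.
have E m : `|cell_value m x - x| = `|x| - quantile r (cell_index m x).
  have q := quantile_cell_le m x; have q0 := quantile_ge0 r (cell_index m x).
  rewrite /cell_value; case: (lerP 0 x) => x0; move: q.
    by rewrite /= (ger0_norm x0) mulr1 distrC => q; rewrite ger0_norm// subr_ge0.
  rewrite /= (ltr0_norm x0) mulrN1 => q.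
  by rewrite ger0_norm; lra.
have [xe|xe] := lerP `|x| e.
  exists 0%N => m _; rewrite E.
  by have := quantile_ge0 r (cell_index m x); lra.
pose u := `|x| - e; have u0 : 0 < u by rewrite subr_gt0.
pose y := expR (- (`|x| `^ r)); pose z := expR (- (u `^ r)).
have yz : y < z.
  rewrite ltr_expR ltrN2; apply: gt0_ltr_powR; rewrite ?nnegrE//.
  - exact: ltW.
  - by rewrite /u; lra.
exists (Num.bound (z - y)^-1) => m hm; rewrite E.
suff : u <= quantile r (cell_index m x) by rewrite /u; lra.
rewrite quantile_geE// -/z.
have m0 : 0 < m.+1%:R :> R by rewrite ltr0n.
have h1 : (cell_index m x)%:R <= m.+1%:R * y.
  rewrite val_cell_index; apply: le_trans (_ : (Num.truncn (m.+1%:R * y))%:R <= _).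
    by rewrite ler_nat geq_minr.
  by rewrite truncn_le mulr_ge0// expR_ge0.
have h2 : 1 <= m.+1%:R * (z - y).
  rewrite -ler_pdivrMr ?subr_gt0// mul1r; apply: ltW.
  apply: lt_le_trans (archi_boundP _) _; first by rewrite invr_ge0 subr_ge0 ltW.
  by rewrite ler_nat; exact: leq_trans hm _.
by rewrite -natr1; lra.
Qed.

Lemma le_expR_powR x : 0 <= x -> x <= (2 / r) `^ r^-1 * expR (x `^ r / 2).
Proof.
move=> x0; rewrite -[leLHS](_ : (x `^ r) `^ r^-1 = x); last first.
  by rewrite -powRrM mulfV ?gt_eqF// powRr1.
set y := x `^ r; have y0 : 0 <= y by exact: powR_ge0.
have -> : expR (y / 2) = expR (y * r / 2) `^ r^-1.
  by rewrite -expRM; congr expR; field; rewrite gt_eqF.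
rewrite -powRM ?expR_ge0 ?divr_ge0 ?(ltW r0)//.
apply: ge0_ler_powR; rewrite ?nnegrE ?invr_ge0 ?(ltW r0)//.
  by rewrite mulr_ge0 ?expR_ge0// divr_ge0// ltW.
have h := expR_ge1Dx (y * r / 2).
have : 2 / r * (y * r / 2) <= 2 / r * expR (y * r / 2).
  by rewrite ler_pM2l ?divr_gt0//; lra.
by have -> : 2 / r * (y * r / 2) = y by field; rewrite gt_eqF.
Qed.

Lemma avg_quantile_le m :
  avg (fun i : 'I_m.+1 => quantile r i) <= (2 / r) `^ r^-1 * 2.
Proof.
apply: le_trans (_ : avg (fun i : 'I_m.+1 => (2 / r) `^ r^-1 * expR (quantile r i `^ r / 2)) <= _).
  by apply: avg_le => i; apply: le_expR_powR; exact: quantile_ge0.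
by rewrite avgZ ler_wpM2l ?powR_ge0// quantile_moment.
Qed.

End Discretization.

(** * Probabilities of the cells *)

Section Cell_probabilities.
Context {d : measure_display} {O : measurableType d} {R : realType}.
Variables (P : probability O R) (r : R).
Hypothesis r0 : 0 < r.

Definition cell m (i : 'I_m.+1) (b : bool) : set R :=
  [set x | cell_index r m x = i /\ (0 <= x) = b].

Lemma measurable_sign (b : bool) : measurable [set x : R | (0 <= x) = b].
Proof.
case: b.
  by rewrite (_ : [set _ | _] = `[0, +oo[%classic)//; apply/seteqP; split => x; rewrite /= in_itv/= andbT.
rewrite (_ : [set _ | _] = `]-oo, 0[%classic)//; apply/seteqP; split => x; rewrite /= in_itv/=.
  by move/negbT; rewrite -ltNge.
by move=> x0; apply/negbTE; rewrite -ltNge.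
Qed.

Lemma cell_index_leE m (i : 'I_m.+1) : (i < m)%N ->
  [set x | (cell_index r m x <= i)%N] = [set x | quantile r i < `|x|].
Proof.
move=> im; apply/seteqP; split => x /=; rewrite cell_index_le// (ltn_eqF im)//.
Qed.

Lemma measurable_cell_index_le m (i : 'I_m.+1) :
  measurable [set x : R | (cell_index r m x <= i)%N].
Proof.
have [im|im] := ltnP i m; last first.
  rewrite (_ : [set _ | _] = setT)//; apply/seteqP; split => x //= _.
  by apply: leq_trans im; rewrite -ltnS.
rewrite cell_index_leE//.
rewrite (_ : [set x | _] = (`]-oo, (- quantile r i)[ `|` `]quantile r i, +oo[)%classic).
  by apply: measurableU; exact: measurable_itv.
apply/seteqP; split => x; rewrite /= !in_itv/= andbT ltr_normr.
  by move=> /orP[|]; [right|left; rewrite ltrNr].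
by move=> [|->//]; rewrite ltrNr => ->; rewrite orbT.
Qed.

Lemma measurable_cell_index m (i : 'I_m.+1) :
  measurable [set x : R | cell_index r m x = i].
Proof.
have [i0|i0] := posnP i.
  rewrite (_ : [set _ | _] = [set x | (cell_index r m x <= i)%N]).
    exact: measurable_cell_index_le.
  apply/seteqP; split => x /=; first by move=> ->.
  by rewrite i0 leqn0 => /eqP x0; apply: val_inj; rewrite /= x0 i0.
have jm : (i.-1 < m.+1)%N by rewrite (leq_ltn_trans (leq_pred _)).
rewrite (_ : [set _ | _] = [set x | (cell_index r m x <= i)%N] `\`
    [set x | (cell_index r m x <= Ordinal jm)%N]).
  by apply: measurableD; exact: measurable_cell_index_le.
apply/seteqP; split => x /=.
  by move=> ->; split => //; apply/negP; rewrite -ltnNge prednK.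
move=> [h1 /negP]; rewrite -ltnNge prednK// => h2.
by apply: val_inj; apply/eqP; rewrite eqn_leq h1 h2.
Qed.

Lemma measurable_cell m (i : 'I_m.+1) b : measurable (cell i b).
Proof.
by apply: measurableI; [exact: measurable_cell_index|exact: measurable_sign].
Qed.

Variable X : {RV P >-> R}.
Hypothesis X_sym : symmetric_RV X.
Hypothesis X_tail : forall u : R, 0 < u ->
  P [set w | u < `|X w|] = (expR (- (u `^ r)))%:E.

Lemma prob_cell_index_le m (i : 'I_m.+1) :
  P (X @^-1` [set x | (cell_index r m x <= i)%N]) = (i.+1%:R / m.+1%:R)%:E.
Proof.
have [im|im] := ltnP i m; last first.
  have -> : i = m :> nat by apply/eqP; rewrite eqn_leq im -ltnS ltn_ord.
  rewrite divff ?pnatr_eq0// (_ : _ @^-1` _ = setT) ?probability_setT//.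
  apply/seteqP; split => w //= _; by rewrite -ltnS.
rewrite cell_index_leE//.
have q0 : 0 < quantile r i.
  apply: powR_gt0; rewrite ln_gt0// ltr_pdivlMr// mul1r ltr_nat.
  by rewrite ltnS.
rewrite -[LHS]/(P [set w | quantile r i < `|X w|]) X_tail// quantile_powR//.
by rewrite -lnV ?posrE ?divr_gt0// invf_div lnK ?posrE ?divr_gt0.
Qed.

Lemma prob_cell_index m (i : 'I_m.+1) :
  P (X @^-1` [set x | cell_index r m x = i]) = (m.+1%:R^-1)%:E.
Proof.
have [i0|i0] := posnP i.
  rewrite (_ : [set _ | _] = [set x | (cell_index r m x <= i)%N]).
    by rewrite prob_cell_index_le i0 div1r.
  apply/seteqP; split => x /=; first by move=> ->.
  by rewrite i0 leqn0 => /eqP x0; apply: val_inj; rewrite /= x0 i0.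
have jm : (i.-1 < m.+1)%N by rewrite (leq_ltn_trans (leq_pred _)).
pose j := Ordinal jm.
have E : X @^-1` [set x | (cell_index r m x <= i)%N] =
    X @^-1` [set x | (cell_index r m x <= j)%N] `|`
    X @^-1` [set x | cell_index r m x = i].
  apply/seteqP; split => w /=.
    rewrite leq_eqVlt => /orP[/eqP h|h]; first by right; apply: val_inj.
    by left; rewrite -ltnS prednK.
  by move=> [h|->//]; apply: leq_trans h _; exact: leq_pred.
have mj : measurable (X @^-1` [set x | (cell_index r m x <= j)%N]).
  by apply: measurable_funPTI; exact: measurable_cell_index_le.
have mi : measurable (X @^-1` [set x | cell_index r m x = i]).
  by apply: measurable_funPTI; exact: measurable_cell_index.
have dis : X @^-1` [set x | (cell_index r m x <= j)%N] `&`
    X @^-1` [set x | cell_index r m x = i] = set0.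
  apply/seteqP; split => w //= [h1 h2].
  by move: h1; rewrite h2 leqNgt /= prednK// leqnn.
have : P (X @^-1` [set x | (cell_index r m x <= i)%N]) =
    (P (X @^-1` [set x | (cell_index r m x <= j)%N]) +
     P (X @^-1` [set x | cell_index r m x = i]))%E.
  by rewrite E; exact: measureU.
rewrite !prob_cell_index_le /= prednK//.
have fin : P (X @^-1` [set x | cell_index r m x = i]) \is a fin_num.
  exact: fin_num_measure.
rewrite -(fineK fin) -EFinD => -[] h; congr EFin.
have -> : m.+1%:R^-1 = i.+1%:R / m.+1%:R - i%:R / m.+1%:R :> R.
  by rewrite -mulrBl -[i.+1%:R]natr1 addrAC subrr add0r mul1r.
by rewrite h; ring.
Qed.

(** The point 0 lies in the last cell for every [m], and that cell has probability [m.+1^-1]. *)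
Lemma prob_zero : P (X @^-1` [set 0]) = 0%E.
Proof.
apply/eqP; rewrite eq_le measure_ge0 andbT; apply/lee_addgt0Pr => e e0.
rewrite add0e; pose m := Num.bound e^-1.
apply: le_trans (_ : P (X @^-1` [set x | cell_index r m x = ord_max]) <= _)%E.
  apply: le_measure; rewrite ?inE.
  - by apply: measurable_funPTI; exact: measurable_set1.
  - by apply: measurable_funPTI; exact: measurable_cell_index.
  move=> w /= ->; apply: val_inj; rewrite /= val_cell_index normr0.
  by rewrite powR0 ?gt_eqF// oppr0 expR0 mulr1 natrK; apply/minn_idPl.
rewrite prob_cell_index lee_fin invf_ple ?posrE//.
apply: le_trans (ltW (archi_boundP _)) _; first by rewrite invr_ge0 ltW.
by rewrite ler_nat.
Qed.

(** Symmetry equates the strictly positive and the negative part of the cell; the point 0, counted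
    as positive, has probability 0. *)
Lemma prob_cell m (i : 'I_m.+1) b :
  P (X @^-1` (cell i b)) = ((2 * m.+1%:R)^-1)%:E.
Proof.
have mX B : measurable B -> measurable (X @^-1` B) by exact: measurable_funPTI.
have mpos : measurable [set x : R | 0 < x].
  by rewrite (_ : [set _ | _] = `]0, +oo[%classic)//; apply/seteqP; split => x; rewrite /= in_itv/= andbT.
have mi := measurable_cell_index i.
pose A := [set x : R | cell_index r m x = i] `&` [set x | 0 < x].
have mA : measurable A by exact: measurableI.
have neg : P (X @^-1` (cell i false)) = P (X @^-1` A).
  rewrite X_sym; last exact: measurable_cell.
  congr (P _); apply/seteqP; split => w /=.
    rewrite /cell /A /= /cell_index normrN => -[-> /negbT]; rewrite -ltNge oppr_lt0.
    by [].
  rewrite /cell /A /= /cell_index normrN => -[-> h]; split => //.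
  by apply/negbTE; rewrite -ltNge oppr_lt0.
have pos : P (X @^-1` (cell i true)) = P (X @^-1` A).
  apply/eqP; rewrite eq_le; apply/andP; split; last first.
    apply: le_measure; rewrite ?inE; [exact: mX|exact: (mX _ (measurable_cell _ _))|].
    by move=> w [/= h1 h2]; split => //; apply/ltW.
  have le1 : (P (X @^-1` (cell i true)) <= P (X @^-1` A `|` X @^-1` [set 0%R])%classic)%E.
    apply: le_measure; rewrite ?inE; [exact: (mX _ (measurable_cell _ _))|by apply: measurableU; apply: mX|].
    move=> w [/= h1]; rewrite le_eqVlt => /orP[/eqP h2|h2]; first by right.
    by left.
  apply: (le_trans le1); rewrite -[leRHS]adde0 -prob_zero.
  by apply: measureU2; exact: mX.
have U : X @^-1` [set x | cell_index r m x = i] =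
    X @^-1` cell i true `|` X @^-1` cell i false.
  apply/seteqP; split => w /=.
    by move=> h; case E : (0 <= X w); [left|right].
  by move=> [[-> _]|[-> _]].
have : P (X @^-1` [set x | cell_index r m x = i]) =
    (P (X @^-1` cell i true) + P (X @^-1` cell i false))%E.
  rewrite U; apply: measureU; [exact: (mX _ (measurable_cell _ _))|exact: (mX _ (measurable_cell _ _))|].
  by apply/seteqP; split => w //= [[_ h1] [_ h2]]; rewrite h1 in h2.
have fin : P (X @^-1` A) \is a fin_num by apply: fin_num_measure; exact: mX.
have -> : P (X @^-1` cell i b) = P (X @^-1` A) by case: b.
rewrite prob_cell_index neg pos -(fineK fin) -EFinD => -[] h; congr EFin.
have -> : (2 * m.+1%:R)^-1 = m.+1%:R^-1 / 2 :> R by rewrite invfM mulrC.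
by rewrite h; field.
Qed.

End Cell_probabilities.

Section Measurable_smax.
Context {d : measure_display} {O : measurableType d} {R : realType}.

Lemma measurable_smax (V : eqType) (S : seq V) (f : V -> O -> R) :
  (forall t, measurable_fun setT (f t)) ->
  measurable_fun setT (fun w => smax S (f^~ w)).
Proof.
move=> mf; case: S => [|x s]; first exact: measurable_cst.
elim: s => [|y s ih].
  by rewrite (_ : (fun _ => _) = f x)//; apply/funext => w; rewrite /= big_nil.
rewrite (_ : (fun _ => _) = f y \max (fun w => smax (x :: s) (f^~ w))).
  exact: measurable_maxr.
by apply/funext => w; rewrite /= big_cons.
Qed.

End Measurable_smax.

Section Joint_cells.
Context {d : measure_display} {O : measurableType d} {R : realType}.
Variables (P : probability O R) (r : R) (n : nat) (X : 'I_n -> {RV P >-> R}).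
Hypothesis r0 : 0 < r.
Hypothesis X_ind : independent_RVs X.
Hypothesis X_sym : forall k, symmetric_RV (X k).
Hypothesis X_tail : forall k (u : R), 0 < u ->
  P [set w | u < `|X k w|] = (expR (- (u `^ r)))%:E.

Definition cells m (w : O) : {ffun 'I_n -> 'I_m.+1 * bool} :=
  [ffun k => (cell_index r m (X k w), 0 <= X k w)].

Lemma cells_preimage m (c : {ffun 'I_n -> 'I_m.+1 * bool}) :
  [set w | cells m w = c] =
  \bigcap_(k in [set k | k \in [set: 'I_n]%SET]) (X k @^-1` cell r (c k).1 (c k).2).
Proof.
apply/seteqP; split => w /= h.
  by move=> k _; rewrite -h /cells !ffunE; split.
apply/ffunP => k; have [] := h k (finset.in_setT k).
by rewrite ffunE => -> ->; case: (c k).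
Qed.

Lemma measurable_cells m (c : {ffun 'I_n -> 'I_m.+1 * bool}) :
  measurable [set w | cells m w = c].
Proof.
rewrite cells_preimage; apply: fin_bigcap_measurable => // k _.
by apply: measurable_funPTI; exact: measurable_cell.
Qed.

Lemma prob_cells m (c : {ffun 'I_n -> 'I_m.+1 * bool}) :
  P [set w | cells m w = c] =
  (#|{: {ffun 'I_n -> 'I_m.+1 * bool}}|%:R^-1)%:E.
Proof.
rewrite cells_preimage X_ind; last by move=> k; exact: measurable_cell.
rewrite (eq_bigr (fun=> ((2 * m.+1%:R)^-1)%:E)); last first.
  by move=> k _; exact: (prob_cell r0 (@X_sym k) (@X_tail k)).
rewrite prodEFin big_const; congr EFin.
rewrite card_ffun card_prod card_ord card_bool card_ord mulnC natrX natrM.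
by rewrite cardsT card_ord -exprVn -iter_mulr_1.
Qed.

Lemma cells_sum m (f : {ffun 'I_n -> 'I_m.+1 * bool} -> R) w :
  f (cells m w) = \sum_c f c * \1_[set w | cells m w = c] w.
Proof.
rewrite (bigD1 (cells m w))//= big1 ?addr0.
  by rewrite indicE mem_set// mulr1.
move=> c /eqP cw; rewrite indicE memNset ?mulr0//=.
by move=> /esym.
Qed.

Lemma measurable_fun_cells m (f : {ffun 'I_n -> 'I_m.+1 * bool} -> R) :
  measurable_fun setT (fun w => f (cells m w)).
Proof.
rewrite (_ : (fun _ => _) = (fun w => \sum_c f c * \1_[set w | cells m w = c] w)).
  apply: measurable_sum => c; apply: measurable_funM; first exact: measurable_cst.
  by apply: measurable_indic; exact: measurable_cells.
by apply/funext => w; exact: cells_sum.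
Qed.

Lemma expectation_cells m (f : {ffun 'I_n -> 'I_m.+1 * bool} -> R) :
  ('E_P[fun w => f (cells m w)])%E = (avg f)%:E.
Proof.
rewrite unlock.
under eq_integral do rewrite cells_sum -sumEFin.
have int1 c : P.-integrable setT (fun w => (\1_[set w | cells m w = c] w : R)%:E).
  by apply: integrable_indic; exact: measurable_cells.
rewrite integral_sum//; last first.
  move=> c; under eq_fun do rewrite EFinM.
  exact: integrableZl.
rewrite (eq_bigr (fun c => (f c * #|{: {ffun 'I_n -> 'I_m.+1 * bool}}|%:R^-1)%:E)).
  by rewrite sumEFin -mulr_suml mulrC.
move=> c _; under eq_integral do rewrite EFinM.
rewrite integralZl// integral_indic//; last exact: measurable_cells.
by rewrite setIT EFinM; congr (_ * _)%E; exact: prob_cells.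
Qed.

(** Fatou's lemma for the discretizations, whose means are bounded uniformly by
    [avg_quantile_le]. *)
Lemma integrable_coord k : P.-integrable setT (fun w => (X k w)%:E).
Proof.
have mX : measurable_fun setT (fun w => (X k w)%:E).
  by apply/measurable_EFinP; exact: measurable_funPT.
apply/integrableP; split => //.
pose g m (w : O) : \bar R := `|cell_value r m (X k w)|%:E.
pose C : R := (2 / r) `^ r^-1 * 2.
have gE m w : g m w = (quantile r (cells m w k).1)%:E.
  by rewrite /g cell_value_norm// ffunE.
have mg m : measurable_fun setT (g m).
  rewrite (_ : g m = (fun w => (quantile r (cells m w k).1)%:E)).
    by apply/measurable_EFinP; exact: (measurable_fun_cells (fun c => quantile r (c k).1)).
  by apply/funext => w; rewrite gE.
have g0 m w : setT w -> (0 <= g m w)%E by rewrite lee_fin.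
have intg m : (\int[P]_w g m w <= C%:E)%E.
  have -> : (\int[P]_w g m w)%E = ('E_P[fun w => quantile r (cells m w k).1])%E.
    by rewrite unlock; apply: eq_integral => w _; rewrite gE.
  rewrite (expectation_cells (fun c => quantile r (c k).1)) lee_fin.
  rewrite (avg_coord (ord0, true) k (fun p => quantile r p.1)).
  rewrite (avg_fst true (fun i => quantile r i)).
  exact: avg_quantile_le.
have lim_g w : limn_einf (g^~ w) = `|(X k w)%:E|%E.
  apply: (cvg_limn_einf_sup _).1.
  apply/fine_cvgP; split; first exact: nearW.
  apply/cvgrPdist_le => e e0; have [m0 hm] := cell_value_approx r0 (X k w) e0.
  exists m0 => // m /hm h; rewrite /=.
  by rewrite distrC (le_trans (ler_dist_dist _ _))//.
have F := fatou P measurableT mg g0.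
rewrite (eq_integral (fun w => `|(X k w)%:E|%E)) in F; last by move=> w _; exact: lim_g.
apply: le_lt_trans F _.
apply: (@le_lt_trans _ _ C%:E); last exact: ltry.
rewrite limn_einf_lim; apply: lime_le; first exact: is_cvg_einfs.
apply: nearW => m; apply: le_trans (intg m).
by apply: ereal_inf_lbound; exists m => /=.
Qed.

(** Dominated convergence: discretization rounds towards 0, so [g], built from the undiscretized
    coordinates, dominates every [f m]. *)
Lemma process_cvg (S : seq 'rV[R]_n) :
  (avg (fun c : {ffun 'I_n -> 'I_m.+1} => rad S (fun k => quantile r (c k))))%:E
    @[m --> \oo] --> ('E_P[fun w => smax S (fun t => linear_process X t w)])%E.
Proof.
pose f m (w : O) : R := smax S (fun t : 'rV[R]_n => \sum_k t ord0 k * cell_value r m (X k w)).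
pose h m (c : {ffun 'I_n -> 'I_m.+1 * bool}) : R := smax S (fun t : 'rV[R]_n =>
   \sum_k t ord0 k * (quantile r (c k).1 * sg R (c k).2)).
have fE m w : f m w = h m (cells m w).
  apply: eq_smax => t _; apply: eq_bigr => k _.
  by rewrite ffunE.
have hE m : avg (h m) = avg (fun c : {ffun 'I_n -> 'I_m.+1} => rad S (fun k => quantile r (c k))).
  rewrite /rad -(avg_pair_ffun (fun (c : {ffun 'I_n -> 'I_m.+1}) (e : {ffun 'I_n -> bool}) =>
    smax S (fun t : 'rV[R]_n => \sum_k t ord0 k * (quantile r (c k) * sg R (e k))))).
  apply: eq_avg => c; apply: eq_smax => t _; apply: eq_bigr => k _.
  by rewrite !ffunE.
pose g (w : O) : R := \sum_(t <- S) \sum_k `|t ord0 k| * `|X k w|.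
have smax_abs (F G : 'rV[R]_n -> R) : `|smax S F - smax S G| <= \sum_(t <- S) `|F t - G t|.
  have [->|S0] := eqVneq S [::]; first by rewrite /= subrr normr0 big_nil.
  have H (F' G' : 'rV[R]_n -> R) : smax S F' - smax S G' <= \sum_(t <- S) `|F' t - G' t|.
    have [t tS ->] := smax_ex F' S0.
    have h1 := smax_ge G' tS.
    apply: le_trans (_ : `|F' t - G' t| <= _).
      by apply: le_trans (ler_norm _); lra.
    by rewrite (big_rem t)//= lerDl sumr_ge0.
  apply/ler_normlP; split; last exact: H.
  rewrite opprB; apply: le_trans (H G F) _.
  by apply: ler_sum => t _; rewrite distrC.
have smax0 : smax S (fun=> 0 : R) = 0.
  have [->//|S0] := eqVneq S [::].
  by have [t _ ->] := smax_ex (fun=> 0 : R) S0.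
have fg m w : `|f m w| <= g w.
  rewrite -[f m w]subr0 -smax0; apply: le_trans (smax_abs _ _) _.
  apply: ler_sum => t _; rewrite subr0; apply: le_trans (ler_norm_sum _ _ _) _.
  apply: ler_sum => k _; rewrite normrM ler_wpM2l//.
  by rewrite cell_value_norm; exact: quantile_cell_le.
pose F (w : O) : R := smax S (fun t => linear_process X t w).
have fF w : f^~ w @ \oo --> F w.
  apply/cvgrPdist_le => e e0.
  pose W : R := 1 + \sum_(t <- S) \sum_k `|t ord0 k|.
  have W0 : 0 < W.
    by rewrite ltr_pwDl// sumr_ge0// => t _; exact: sumr_ge0.
  have /choice[m0 hm0] k : exists m0, forall m, (m0 <= m)%N ->
      `|cell_value r m (X k w) - X k w| <= e / W.
    by apply: cell_value_approx => //; exact: divr_gt0.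
  exists (\max_k m0 k)%N => // m /= hm.
  apply: le_trans (smax_abs _ _) _.
  apply: le_trans (_ : \sum_(t <- S) (\sum_k `|t ord0 k|) * (e / W) <= _).
    apply: ler_sum => t _; rewrite /linear_process -sumrB.
    apply: le_trans (ler_norm_sum _ _ _) _; rewrite mulr_suml.
    apply: ler_sum => k _; rewrite -mulrBr normrM ler_wpM2l// distrC.
    by apply: hm0; apply: leq_trans hm; exact: leq_bigmax.
  rewrite -mulr_suml mulrA ler_pdivrMr// mulrC ler_pM2l//.
  by rewrite /W lerDr.
have mf m : measurable_fun setT (EFin \o f m).
  apply/measurable_EFinP; rewrite (_ : f m = (fun w => h m (cells m w))).
    exact: measurable_fun_cells.
  by apply/funext => w.
have mF : measurable_fun setT (EFin \o F).
  apply/measurable_EFinP; apply: measurable_smax => t.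
  apply: measurable_sum => k; apply: measurable_funM; first exact: measurable_cst.
  exact: measurable_funPT.
have ig : P.-integrable setT (EFin \o g).
  rewrite (_ : EFin \o g = (fun w => \sum_(t <- S) \sum_k (`|t ord0 k|%:E * `|(X k w)%:E|))%E).
    apply: integrable_sum => // t _; apply: integrable_sum => // k _.
    by apply: integrableZl => //; apply: integrable_abse; exact: integrable_coord.
  apply/funext => w; rewrite /= -sumEFin; apply: eq_bigr => t _.
  by rewrite -sumEFin; apply: eq_bigr => k _; rewrite EFinM.
have fF' w : setT w -> (EFin \o f ^~ w) m @[m --> \oo] --> (EFin \o F) w.
  by move=> _; apply/fine_cvgP; split; [exact: nearW|exact: fF].
have fg' w m : setT w -> (`|(EFin \o f m) w| <= (EFin \o g) w)%E.
  by move=> _; rewrite lee_fin.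
have [_ _ cvg] := @dominated_convergence _ _ _ P setT measurableT
  (fun m => EFin \o f m) (EFin \o F) (EFin \o g) mf mF (aeW _ fF') ig (aeW _ fg').
rewrite unlock; apply: cvg_trans cvg.
rewrite (_ : (fun m => _) = [sequence (\int[P]_x (EFin \o f m) x)%E]_m)//.
apply/funext => m; rewrite -hE -expectation_cells unlock.
by apply: eq_integral => w _; rewrite /= fE.
Qed.


End Joint_cells.


(** * Comparison with random permutations *)

Section Rademacher_sums.
Variables (R : realType) (N : nat).
Notation cube := {ffun 'I_N.+1 -> bool}.

(* A central-limit substitute for a Gaussian variable. *)
Definition rsum (h : cube) : R := lin (fun=> (Num.sqrt N.+1%:R)^-1) h.

Definition neg_cube (h : cube) : cube := [ffun i => ~~ h i].

Lemma neg_cubeK : involutive neg_cube.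
Proof. by move=> h; apply/ffunP => i; rewrite !ffunE negbK. Qed.

Lemma rsum_neg h : rsum (neg_cube h) = - rsum h.
Proof.
rewrite /rsum /lin -sumrN; apply: eq_bigr => i _.
by rewrite ffunE; case: (h i) => /=; ring.
Qed.

Lemma rsum_mgf (c : R) : avg (fun h : cube => expR (c * rsum h)) <= expR (16 * c ^+ 2).
Proof.
rewrite (eq_avg (g := fun h : cube => expR (lin (fun=> c * (Num.sqrt N.+1%:R)^-1) h))); last first.
  by move=> h; rewrite /rsum -linZ.
apply: le_trans (avg_expR_lin _) _; rewrite ler_expR ler_pM2l//.
rewrite sumr_const card_ord exprMn exprVn sqr_sqrtr// -mulrnAr.
by rewrite -[_ *+ N.+1]mulr_natr mulVf ?pnatr_eq0// mulr1.
Qed.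

Lemma rsum_tail (u : R) : 0 < u ->
  avg (fun h : cube => (u <= `|rsum h|)%R%:R : R) <= 2 * expR (- (u ^+ 2 / 64)).
Proof.
(* Chernoff's bound: this [c] minimizes [- (c * u) + 16 * c ^ 2], with value [- (u ^ 2 / 64)]. *)
move=> u0; pose c := u / 32.
have c0 : 0 <= c by rewrite divr_ge0// ltW.
apply: le_trans (_ : avg (fun h : cube => expR (- (c * u)) *
   (expR (c * rsum h) + expR (- c * rsum h))) <= _).
  apply: avg_le => h; case: (lerP u `|rsum h|) => hu; last first.
    by rewrite mulr_ge0 ?addr_ge0 ?expR_ge0.
  rewrite mulrDr -!expRD.
  have e1 := expR_ge0 (- (c * u) + c * rsum h).
  have e2 := expR_ge0 (- (c * u) + - c * rsum h).
  move: hu; rewrite ler_normr => /orP[hu|hu].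
    rewrite (_ : true%:R = 1 :> R)//.
    by have := ler_wpM2l c0 hu; have := expR_ge1Dx (- (c * u) + c * rsum h); lra.
  rewrite (_ : true%:R = 1 :> R)//.
  have := ler_wpM2l c0 hu; have := expR_ge1Dx (- (c * u) + - c * rsum h).
  by rewrite mulrN !mulNr in e2 *; lra.
rewrite avgZ avgD.
have h1 := rsum_mgf c; have h2 := rsum_mgf (- c); rewrite sqrrN in h2.
apply: le_trans (_ : expR (- (c * u)) * (2 * expR (16 * c ^+ 2)) <= _).
  by rewrite ler_wpM2l ?expR_ge0//; lra.
rewrite mulrCA -expRD ler_pM2l// ler_expR le_eqVlt; apply/orP; left; apply/eqP.
by rewrite /c; field.
Qed.

Lemma rademacher_max_rsum n (S : seq 'rV[R]_n) :
  rademacher_max N S = avg (fun w : {ffun 'I_n -> cube} =>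
    smax S (fun t => \sum_k t ord0 k * rsum (w k))).
Proof.
rewrite avg_curry; apply: eq_avg => w; apply: eq_smax => t _.
rewrite /lin (eq_bigr (fun c : 'I_n * 'I_N.+1 =>
  t ord0 c.1 / Num.sqrt N.+1%:R * sg R (w (c.1, c.2)))) => [|[]//].
rewrite -(pair_bigA _ (fun k i => t ord0 k / Num.sqrt N.+1%:R * sg R (w (k, i)))) /=.
apply: eq_bigr => k _; rewrite /rsum /lin mulr_sumr; apply: eq_bigr => i _.
by rewrite !ffunE mulrA.
Qed.

End Rademacher_sums.

Section Comparison.
Variables (R : realType) (n : nat) (r s : R).
Hypothesis n_gt0 : (0 < n)%N.
Hypothesis r0 : 0 < r.
Hypothesis s0 : 0 < s.
Hypothesis rs : s^-1 + 2^-1 = r^-1.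
Notation N := n.+1.
Variable S : seq 'rV[R]_N.

Definition perm_weights (p : 'S_N) : seq 'rV[R]_N :=
  [seq \row_k (t ord0 (p k) * quantile s k) | t : 'rV[R]_N <- S].

Let exponents : r / 2 + r / s = 1.
Proof.
have -> : r / 2 + r / s = r * (s^-1 + 2^-1) by ring.
by rewrite rs mulfV// gt_eqF.
Qed.

Let split_powR (u : R) : 0 < u -> u = u `^ (r / 2) * u `^ (r / s).
Proof.
move=> u0; rewrite -powRD; first by rewrite exponents powRr1// ltW.
by rewrite exponents oner_eq0.
Qed.

Let half_powR (u : R) : 0 < u -> (u `^ (r / 2)) ^+ 2 = u `^ r.
Proof.
by move=> u0; rewrite -powR_mulrn ?powR_ge0// -powRrM divfK.
Qed.

Let s_powR (u : R) : 0 < u -> (u `^ (r / s)) `^ s = u `^ r.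
Proof. by move=> u0; rewrite -powRrM divfK// gt_eqF. Qed.

Let scale_powR (K u : R) : 0 < K -> 0 < u -> (u / K `^ r^-1) `^ r = u `^ r / K.
Proof.
move=> K0 u0; rewrite powRM ?(ltW u0) ?invr_ge0 ?powR_ge0//.
by rewrite -powR_inv1 ?powR_ge0// -powRrM -powRrM mulN1r mulrN mulVf ?gt_eqF// powR_inv1 ?ltW.
Qed.

(** As [u] is the product of [u ^ (r/s)] and [u ^ (r/2)], one factor must reach its share. The first
    event costs one exponential, the second two, with the 64 of [rsum_tail]. *)
Lemma rsum_weight_tail M (u : R) : 0 < u ->
  avg (fun c : 'I_N * {ffun 'I_M.+1 -> bool} =>
    (u <= quantile s c.1 * `|rsum R c.2|)%R%:R : R) <= 3 * expR (- (u `^ r / 64)).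
Proof.
move=> u0; have uh0 : 0 < u `^ (r / 2) by exact: powR_gt0.
have us0 : 0 < u `^ (r / s) by exact: powR_gt0.
apply: le_trans (_ : avg (fun c : 'I_N * {ffun 'I_M.+1 -> bool} =>
   ((u `^ (r / s) <= quantile s c.1)%R%:R + (u `^ (r / 2) <= `|rsum R c.2|)%R%:R)) <= _).
  apply: avg_le => -[i h] /=; case: (lerP u) => hu; last by rewrite addr_ge0.
  case: (lerP (u `^ (r / s))) => h1; first by rewrite lerDl.
  case: (lerP (u `^ (r / 2))) => h2; first by rewrite lerDr.
  exfalso; move: hu; apply/negP; rewrite -ltNge [ltRHS]split_powR// [ltRHS]mulrC.
  by apply: ltr_pM; rewrite ?quantile_ge0.
rewrite avgD (avg_fst [ffun=> true] (fun i => (u `^ (r / s) <= quantile s i)%R%:R)).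
rewrite (avg_snd ord0 (fun h => (u `^ (r / 2) <= `|rsum R h|)%R%:R)).
have /andP[_ h1] := quantile_tail n s0 us0.
have h2 := rsum_tail M uh0.
rewrite s_powR// in h1; rewrite half_powR// in h2.
have : expR (- (u `^ r)) <= expR (- (u `^ r / 64)).
  by rewrite ler_expR; have := powR_ge0 u r; lra.
by lra.
Qed.

(** The constant 16 is 4 from sampling times 4 from the tails ([3 <= 4 * 3/4]), and [64 ^ (1/r)]
    rescales [u] to remove the 64 in the exponent. *)
Lemma comparison_lower M : exists m0, forall m, (m0 <= m)%N ->
  avg (fun p : 'S_N => rademacher_max M (perm_weights p)) <=
  16 * 64 `^ r^-1 *
    avg (fun c : {ffun 'I_N -> 'I_m.+1} => rad S (fun k => quantile r (c k))).
Proof.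
pose A := ('I_N * {ffun 'I_M.+1 -> bool})%type.
pose x (c : A) : R := quantile s c.1 * `|rsum R c.2|.
have x0 c : 0 <= x c by rewrite mulr_ge0// quantile_ge0.
pose b := \sum_c x c.
have xb c : x c <= b by rewrite /b (bigD1 c)//= lerDl sumr_ge0.
have c64 : 0 < 64 `^ r^-1 :> R by exact: powR_gt0.
have q34 : 0 < 3 / 4 :> R by rewrite divr_gt0.
have q341 : 3 / 4 < 1 :> R by lra.
have [m0 hm0] := quantile_tail_eventually (b / 64 `^ r^-1) r0 q34 q341.
exists m0 => m hm.
pose y (i : 'I_m.+1) : R := 64 `^ r^-1 * quantile r i.
have y0 i : 0 <= y i by rewrite mulr_ge0 ?powR_ge0.
pose Phi v := avg (fun w : {ffun 'I_N -> {ffun 'I_M.+1 -> bool}} =>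
  rad S (fun k => v k * `|rsum R (w k)|)).
have sPhi : sublinear Phi.
  exact: (sublinear_avg_scale (z := fun (w : {ffun 'I_N -> {ffun 'I_M.+1 -> bool}}) k =>
    `|rsum R (w k)|) (rad_sublinear S)).
have E1 p : rademacher_max M (perm_weights p) = Phi (fun k => quantile s ((p^-1)%g k)).
  by rewrite rademacher_max_rsum (rad_permute S _ p (@neg_cubeK M) (@rsum_neg R M)).
rewrite (eq_avg E1).
rewrite (avg_bij (fun p : 'S_N => Phi (fun k => quantile s (p k))) (inv_bij (@invgK _))).
apply: le_trans (sampling_lower sPhi (fun i => quantile_ge0 s i)) _.
rewrite /Phi -(avg_pair_ffun (fun (J : {ffun 'I_N -> 'I_N})
    (w : {ffun 'I_N -> {ffun 'I_M.+1 -> bool}}) =>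
  rad S (fun k => quantile s (J k) * `|rsum R (w k)|))).
have K1 : 1 <= 4 :> R by lra.
have tail u : 0 < u -> avg (fun a => (u <= x a)%R%:R : R) <= 4 * avg (fun b => (u <= y b)%R%:R : R).
  move=> u0; have [ub|ub] := lerP u b; last first.
    rewrite (eq_avg (g := fun=> 0)); last first.
      by move=> c; rewrite leNgt (le_lt_trans (xb c) ub).
    rewrite (avg_cst (ord0, [ffun=> true])) mulr_ge0//.
    by apply: avg_ge0 => i; exact: ler0n.
  apply: le_trans (rsum_weight_tail M u0) _.
  have uc : 0 < u / 64 `^ r^-1 by exact: divr_gt0.
  have := hm0 m hm _ uc; rewrite ler_pM2r ?invr_gt0// => /(_ ub).
  rewrite scale_powR//.
  rewrite (eq_avg (g := fun i => (u <= y i)%R%:R)); first by lra.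
  by move=> i; rewrite ler_pdivrMr// mulrC.
have := sublinear_tail_comparison (ord0, [ffun=> true]) ord0 K1 x0 y0 tail (rad_sublinear S).
rewrite (eq_avg (g := fun w : {ffun 'I_N -> A} =>
   rad S (fun k => quantile s ([ffun i => (w i).1] k) * `|rsum R ([ffun i => (w i).2] k)|))); last first.
  by move=> w; apply: sublinear_eq => k; rewrite !ffunE.
rewrite (eq_avg (f := fun w : {ffun 'I_N -> 'I_m.+1} => rad S (fun k => y (w k)))
  (g := fun w => 64 `^ r^-1 * rad S (fun k => quantile r (w k)))); last first.
  by move=> w; rewrite -radZ ?powR_ge0.
by rewrite avgZ; lra.
Qed.

Definition signed_quantile m (c : 'I_m.+1 * bool) : R := quantile 2 c.1 * sg R c.2.

Definition neg_sign m (c : 'I_m.+1 * bool) := (c.1, ~~ c.2).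

Lemma neg_signK m : involutive (@neg_sign m).
Proof. by case=> i b; rewrite /neg_sign /= negbK. Qed.

Lemma signed_quantile_neg m (c : 'I_m.+1 * bool) :
  signed_quantile (neg_sign c) = - signed_quantile c.
Proof. by rewrite /signed_quantile /=; case: c.2 => /=; ring. Qed.

Lemma avg_bool (f : bool -> R) : avg f = (f true + f false) / 2.
Proof. by rewrite /avg card_bool big_bool mulrC. Qed.

Lemma cosh_le (z : R) : (expR z + expR (- z)) / 2 <= expR (16 * z ^+ 2).
Proof.
have := avg_expR_lin (fun=> z : R) (I := unit).
rewrite (eq_avg (g := fun w : {ffun unit -> bool} => expR (z * sg R (w tt)))); last first.
  by move=> w; rewrite /lin (bigD1 tt)//= big1 ?addr0// => -[].
rewrite (avg_coord true tt (fun b => expR (z * sg R b))) avg_bool /= mulr1 mulrN1.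
by rewrite sumr_const card_unit mulr1n.
Qed.

(** For [32 * c ^ 2 <= 1], convexity interpolates [expR (16 * (c * q) ^ 2)] between 1 and
    [expR (q ^ 2 / 2)], whose mean is at most 2. For larger [c], [c * q <= c ^ 2 / 2 + q ^ 2 / 2],
    and the factor 2 is absorbed by [expR (32 * c ^ 2)]. *)
Lemma signed_quantile_mgf m (c : R) :
  avg (fun a : 'I_m.+1 * bool => expR (c * signed_quantile a)) <= expR (33 * c ^+ 2).
Proof.
rewrite /signed_quantile (avg_pair (fun i b => expR (c * (quantile 2 i * sg R b)))).
have mom : avg (fun i : 'I_m.+1 => expR (quantile 2 i ^+ 2 / 2)) <= 2 :> R.
  apply: le_trans (quantile_moment m (_ : 0 < 2)) => //; apply: avg_le => i.
  by rewrite powR_mulrn ?quantile_ge0.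
have c2 : 0 <= c ^+ 2 by exact: sqr_ge0.
have [h|h] := lerP (32 * c ^+ 2) 1.
  apply: le_trans (_ : avg (fun i : 'I_m.+1 => (1 - 32 * c ^+ 2) +
    32 * c ^+ 2 * expR (quantile 2 i ^+ 2 / 2)) <= _).
    apply: avg_le => i; rewrite avg_bool /= mulr1 mulrN1 mulrN.
    apply: le_trans (cosh_le _) _.
    have := @expR_convex R (32 * c ^+ 2) 0 (quantile 2 i ^+ 2 / 2).
    rewrite mulr0 add0r expR0 mulr1 => H; apply: le_trans (H _ h); last by lra.
    by rewrite ler_expR exprMn; lra.
  rewrite avgD (avg_cst ord0) avgZ.
  have h1 := ler_wpM2l c2 mom.
  by have := expR_ge1Dx (33 * c ^+ 2); lra.
apply: le_trans (_ : avg (fun i : 'I_m.+1 => expR (c ^+ 2 / 2) * expR (quantile 2 i ^+ 2 / 2)) <= _).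
  apply: avg_le => i; rewrite avg_bool /= mulr1 mulrN1 mulrN.
  rewrite -expRD; set q := quantile 2 i.
  have h1 : expR (c * q) <= expR (c ^+ 2 / 2 + q ^+ 2 / 2).
    by rewrite ler_expR; have := sqr_ge0 (c - q); rewrite sqrrB; lra.
  have h2 : expR (- (c * q)) <= expR (c ^+ 2 / 2 + q ^+ 2 / 2).
    by rewrite ler_expR; have := sqr_ge0 (c + q); rewrite sqrrD; lra.
  by lra.
rewrite avgZ; apply: le_trans (ler_wpM2l (expR_ge0 _) mom) _.
have e2 : 2 <= expR (32 * c ^+ 2) by have := expR_ge1Dx (32 * c ^+ 2); lra.
apply: le_trans (ler_wpM2l (expR_ge0 _) e2) _.
by rewrite -expRD ler_expR; lra.
Qed.

Lemma avg_signed_quantile m : avg (@signed_quantile m) = 0.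
Proof.
rewrite (eq_avg (g := fun a => quantile 2 a.1 * sg R a.2))//.
rewrite (avg_pair (fun i b => quantile 2 i * sg R b)) -[RHS](avg_cst (ord0 : 'I_m.+1)).
by apply: eq_avg => i; rewrite avg_bool /=; ring.
Qed.

Definition signed_process m (u : 'rV[R]_N) (w : {ffun 'I_N -> 'I_m.+1 * bool}) : R :=
  \sum_k u ord0 k * signed_quantile (w k).

Lemma signed_process_subgauss m (u v : 'rV[R]_N) (c : R) :
  avg (fun w : {ffun 'I_N -> 'I_m.+1 * bool} =>
    expR (c * (signed_process u w - signed_process v w))) <=
  expR (33 * (c * d2 u v) ^+ 2).
Proof.
rewrite (eq_avg (g := fun w : {ffun 'I_N -> 'I_m.+1 * bool} =>
  \prod_k expR (c * (u ord0 k - v ord0 k) * signed_quantile (w k)))); last first.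
  move=> w; rewrite -expR_sum; congr expR.
  rewrite /signed_process -sumrB mulr_sumr; apply: eq_bigr => k _; ring.
rewrite (avg_prod (fun k a => expR (c * (u ord0 k - v ord0 k) * signed_quantile a))).
rewrite exprMn sqr_d2 mulr_sumr mulr_sumr expR_sum.
apply: ler_prod => k _; apply/andP; split.
  by apply: avg_ge0 => a; exact: expR_ge0.
by rewrite -exprMn; exact: signed_quantile_mgf.
Qed.

Lemma signed_process_centered m (u : 'rV[R]_N) :
  avg (@signed_process m u) = 0.
Proof.
rewrite /signed_process (avg_sum _ _ (fun k (w : {ffun 'I_N -> 'I_m.+1 * bool}) =>
  u ord0 k * signed_quantile (w k))).
rewrite big1// => k _; rewrite avgZ (avg_coord (ord0, true) k (@signed_quantile m)).
by rewrite avg_signed_quantile mulr0.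
Qed.

Definition sampling_const : R :=
  2 * ((2 * (1 + s^-1)) `^ s^-1) * (2 `^ s^-1 * (1 + 3 / (ln 2) `^ s^-1)).

(** With [v = u / 2 ^ (1/r)], each factor reaches its share of [v] with probability at least
    [expR (- (u ^ r / 2)) / 2]. The product of the two is a quarter of [expR (- (u ^ r))], hence the
    4. *)
Lemma comparison_upper m : exists m',
  avg (fun c : {ffun 'I_N -> 'I_m.+1} => rad S (fun k => quantile r (c k))) <=
  4 * 2 `^ r^-1 * sampling_const *
  avg (fun p : 'S_N => avg (fun w : {ffun 'I_N -> 'I_m'.+1 * bool} =>
    smax (perm_weights p) (fun u => signed_process u w))).
Proof.
pose b := \sum_(i < m.+1) quantile r i.
have xb (i : 'I_m.+1) : quantile r i <= b.
  by rewrite /b (bigD1 i)//= lerDl sumr_ge0// => j _; exact: quantile_ge0.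
pose b' := b / 2 `^ r^-1.
have t0 : 0 < 2 `^ r^-1 :> R by exact: powR_gt0.
have h0 : 0 < 2^-1 :> R by rewrite invr_gt0.
have h1 : 2^-1 < 1 :> R by lra.
have two0 : 0 < 2 :> R by [].
have [m2 hm2] := quantile_tail_eventually (b' `^ (r / 2)) two0 h0 h1.
have [ms hms] := quantile_tail_eventually (b' `^ (r / s)) s0 h0 h1.
exists (maxn m2 ms); set m' := maxn m2 ms.
pose y (c : 'I_m'.+1 * 'I_m'.+1) : R := 2 `^ r^-1 * (quantile s c.1 * quantile 2 c.2).
have y0 c : 0 <= y c by rewrite !mulr_ge0 ?powR_ge0.
have K1 : 1 <= 4 :> R by lra.
have tail u : 0 < u -> avg (fun a : 'I_m.+1 => (u <= quantile r a)%R%:R : R) <=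
    4 * avg (fun b => (u <= y b)%R%:R : R).
  move=> u0; have [ub|ub] := lerP u b; last first.
    rewrite (eq_avg (g := fun=> 0)); last first.
      by move=> c; rewrite leNgt (le_lt_trans (xb c) ub).
    rewrite (avg_cst ord0) mulr_ge0//.
    by apply: avg_ge0 => i; exact: ler0n.
  have /andP[_ h2] := quantile_tail m r0 u0; apply: le_trans h2 _.
  pose v := u / 2 `^ r^-1; have v0 : 0 < v by exact: divr_gt0.
  have vb : v <= b' by rewrite ler_pM2r ?invr_gt0.
  have vE : v `^ r = u `^ r / 2 by exact: scale_powR.
  have b'0 : 0 <= b' by exact: le_trans (ltW v0) vb.
  have v2 : v `^ (r / 2) <= b' `^ (r / 2).
    by apply: ge0_ler_powR; rewrite ?nnegrE ?(ltW v0)// divr_ge0// ltW.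
  have vs : v `^ (r / s) <= b' `^ (r / s).
    by apply: ge0_ler_powR; rewrite ?nnegrE ?(ltW v0)// divr_ge0// ltW.
  have p2 := hm2 m' (leq_maxl _ _) _ (powR_gt0 (r / 2) v0) v2.
  have ps := hms m' (leq_maxr _ _) _ (powR_gt0 (r / s) v0) vs.
  rewrite s_powR// in ps; rewrite powR_mulrn ?powR_ge0// half_powR// in p2.
  have E1 : 2^-1 * expR (- (v `^ r)) * (2^-1 * expR (- (v `^ r))) = 4^-1 * expR (- (u `^ r)).
    have -> : expR (- (u `^ r)) = expR (- (v `^ r)) * expR (- (v `^ r)).
      by rewrite -expRD vE; congr expR; field.
    by field.
  have e0 : 0 <= 2^-1 * expR (- (v `^ r)) by rewrite mulr_ge0 ?expR_ge0// ltW.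
  have := ler_pM e0 e0 ps p2; rewrite E1 => prod_le.
  suff H : avg (fun i : 'I_m'.+1 => (v `^ (r / s) <= quantile s i)%R%:R) *
      avg (fun i : 'I_m'.+1 => (v `^ (r / 2) <= quantile 2 i)%R%:R) <=
      avg (fun c => (u <= y c)%R%:R : R) by lra.
  rewrite -avgZr (eq_avg (g := fun i : 'I_m'.+1 => avg (fun j : 'I_m'.+1 =>
    (v `^ (r / s) <= quantile s i)%R%:R * (v `^ (r / 2) <= quantile 2 j)%R%:R))); last first.
    by move=> i; rewrite avgZ.
  rewrite -(avg_pair (fun i j : 'I_m'.+1 =>
    (v `^ (r / s) <= quantile s i)%R%:R * (v `^ (r / 2) <= quantile 2 j)%R%:R)).
  apply: avg_le => -[i j] /=.
  case: (lerP (v `^ (r / s))) => g1; last by rewrite mul0r.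
  case: (lerP (v `^ (r / 2))) => g2; last by rewrite mulr0.
  rewrite mulr1; suff -> : u <= y (i, j) by [].
  rewrite /y /= mulrC -ler_pdivrMr// -/v [leLHS]split_powR// mulrC.
  by apply: ler_pM; rewrite ?powR_ge0.
have := sublinear_tail_comparison ord0 (ord0, ord0) K1
  (fun i => quantile_ge0 r i) y0 tail (rad_sublinear S).
move=> /le_trans; apply.
pose Phi v := avg (fun w : {ffun 'I_N -> 'I_m'.+1} => rad S (fun k => v k * quantile 2 (w k))).
have sPhi : sublinear Phi.
  apply: (sublinear_avg_scale (z := fun (w : {ffun 'I_N -> 'I_m'.+1}) k =>
    quantile 2 (w k)) (rad_sublinear S)) => w k; exact: quantile_ge0.
rewrite (eq_avg (g := fun w : {ffun 'I_N -> 'I_m'.+1 * 'I_m'.+1} => 2 `^ r^-1 *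
   rad S (fun k => quantile s ([ffun i => (w i).1] k) * quantile 2 ([ffun i => (w i).2] k)))); last first.
  move=> w; rewrite -radZ ?powR_ge0//; apply: sublinear_eq => k.
  by rewrite !ffunE.
rewrite avgZ (avg_pair_ffun (fun (c w : {ffun 'I_N -> 'I_m'.+1}) =>
   rad S (fun k => quantile s (c k) * quantile 2 (w k)))).
have sup := sampling_upper ord0 s0 (fun i : 'I_m'.+1 => quantile_ge0 s i)
  (quantile_moment m' s0) sPhi n_gt0.
suff -> : avg (fun p : 'S_N => avg (fun w : {ffun 'I_N -> 'I_m'.+1 * bool} =>
    smax (perm_weights p) (fun u => signed_process u w))) =
    avg (fun p : 'S_N => Phi (fun k => quantile s (p k))).
  by rewrite mulrA -[leRHS]mulrA ler_pM2l ?mulr_gt0.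
rewrite -(avg_bij (fun p : 'S_N => Phi (fun k => quantile s (p k)))
  (h := fun p : 'S_N => (p^-1)%g) (inv_bij (@invgK _))).
apply: eq_avg => p.
rewrite /signed_process (rad_permute S _ p (@neg_signK m') (@signed_quantile_neg m')) /Phi.
rewrite (eq_avg (g := fun w : {ffun 'I_N -> 'I_m'.+1 * bool} =>
  rad S (fun k => quantile s ((p^-1)%g k) * quantile 2 ([ffun i => (w i).1] k)))
  (f := fun w : {ffun 'I_N -> 'I_m'.+1 * bool} =>
  rad S (fun k => quantile s ((p^-1)%g k) * `|signed_quantile (w k)|))).
  rewrite (avg_pair_ffun (fun (c : {ffun 'I_N -> 'I_m'.+1}) (_ : {ffun 'I_N -> bool}) =>
    rad S (fun k => quantile s ((p^-1)%g k) * quantile 2 (c k)))).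
  by apply: eq_avg => c; rewrite (avg_cst [ffun=> true]).
move=> w; apply: sublinear_eq => k; rewrite ffunE; congr (_ * _).
rewrite /signed_quantile normrM ger0_norm ?quantile_ge0//.
by case: (w k).2; rewrite /= ?normrN normr1 mulr1.
Qed.

End Comparison.

(** * The two bounds *)

Section Finite_suprema.
Context {d : measure_display} {O : measurableType d} {R : realType}.
Variables (P : probability O R) (V : choiceType) (T : set V) (X : V -> O -> R).

Lemma sup_smax (S : seq V) (f : V -> R) : S != [::] ->
  sup [set f t | t in [set` S]] = smax S f.
Proof.
move=> S0; have [x xS fx] := smax_ex f S0.
apply/eqP; rewrite eq_le; apply/andP; split.
  by apply: ge_sup => [|_ [t tS <-]]; [exists (f x), x|exact: smax_ge].
apply: ub_le_sup; last by exists x.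
by exists (smax S f) => _ [t tS <-]; exact: smax_ge.
Qed.

Lemma Esup_ge (S : seq V) : S != [::] -> (forall t, t \in S -> T t) ->
  ('E_P[fun w => smax S (X^~ w)] <= Esup P T X)%E.
Proof.
move=> S0 ST; apply: ereal_sup_ubound; exists [set` S].
  split; [exact: ST|by apply/finite_seqP; exists S|].
  by case: S S0 {ST} => // x S _; exists x; rewrite /= mem_head.
by congr expectation; apply/funext => w; rewrite sup_smax.
Qed.

Lemma Esup_le (B : \bar R) :
  (forall S : seq V, S != [::] -> (forall t, t \in S -> T t) ->
    ('E_P[fun w => smax S (X^~ w)] <= B)%E) ->
  (Esup P T X <= B)%E.
Proof.
move=> h; apply: ge_ereal_sup => _ [A [AT /finite_seqP[S AS] [x Ax]] <-].
rewrite {A}AS in AT Ax *.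
have S0 : S != [::] by case: S Ax {AT}.
rewrite (_ : (fun w => _) = fun w => smax S (X^~ w)); last first.
  by apply/funext => w; rewrite sup_smax.
by apply: h => // t tS; exact: AT.
Qed.

End Finite_suprema.

Section Permutation_average.
Variables (R : realType) (n : nat).
Implicit Types (f : 'S_n -> R) (g : 'S_n -> \bar R).

Lemma avg_le_Eperm f g (K : R) : 0 < K ->
  (forall p, ((f p)%:E <= K%:E * g p)%E) -> ((avg f)%:E <= K%:E * Eperm g)%E.
Proof.
move=> K0 fg; rewrite -lee_pdivrMl// /Eperm /avg -!EFinM mulrCA EFinM.
rewrite lee_wpmul2l ?lee_fin ?invr_ge0// mulr_sumr -sumEFin.
by apply: lee_sum => p _; rewrite EFinM lee_pdivrMl.
Qed.

Lemma Eperm_le_avg f g : (forall p, (g p <= (f p)%:E)%E) ->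
  (Eperm g <= (avg f)%:E)%E.
Proof.
move=> gf; rewrite /Eperm /avg EFinM lee_wpmul2l ?lee_fin ?invr_ge0// -sumEFin.
by apply: lee_sum => p _; exact: gf.
Qed.

End Permutation_average.

Section Upper_bound.
Context {d : measure_display} {O : measurableType d} {R : realType}.
Variables (P : probability O R) (r s : R) (n : nat) (X : 'I_n.+1 -> {RV P >-> R}).
Hypothesis n_gt0 : (0 < n)%N.
Hypothesis r0 : 0 < r.
Hypothesis s0 : 0 < s.
Hypothesis rs : s^-1 + 2^-1 = r^-1.
Hypothesis X_ind : independent_RVs X.
Hypothesis X_sym : forall k, symmetric_RV (X k).
Hypothesis X_tail : forall k (u : R), 0 < u ->
  P [set w | u < `|X k w|] = (expR (- (u `^ r)))%:E.
Variable T : set 'rV[R]_n.+1.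

(** 37 is [33 + 4]: the subgaussian constant of [signed_quantile_mgf] and the 4 added by
    [chaining]. *)
Definition upper_const : R := 4 * 2 `^ r^-1 * sampling_const s * 37.

Lemma upper_const_gt0 : 0 < upper_const.
Proof.
have a0 : 0 < 2 * (1 + s^-1) by rewrite mulr_gt0// addr_gt0// invr_gt0.
have b0 : 0 < 1 + 3 / ln 2 `^ s^-1 :> R by rewrite ltr_wpDr// divr_ge0 ?powR_ge0.
by rewrite /upper_const /sampling_const !mulr_gt0// powR_gt0.
Qed.

Lemma perm_weights_Tperm (S : seq 'rV[R]_n.+1) p : (forall t, t \in S -> T t) ->
  forall u, u \in perm_weights s S p -> Tperm s T p u.
Proof. by move=> ST u /mapP[t tS ->]; exists t => //; exact: ST. Qed.

Lemma Esup_le_gamma :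
  (Esup P T (linear_process X) <=
   upper_const%:E * Eperm (fun p => gamma 2 (Tperm s T p) (@d2 R n.+1)))%E.
Proof.
apply: Esup_le => S S0 ST.
apply: (cvge_to_le (process_cvg r0 X_ind X_sym X_tail (S := S))).
apply: nearW => m; have [m' h] := comparison_upper n_gt0 r0 s0 rs S m.
apply: le_trans (_ : (upper_const / 37)%:E * (avg (fun p : 'S_n.+1 =>
  avg (fun w : {ffun 'I_n.+1 -> 'I_m'.+1 * bool} =>
    smax (perm_weights s S p) (fun u => signed_process u w))))%:E <= _)%E.
  by rewrite -EFinM lee_fin /upper_const mulfK.
rewrite [in leRHS](_ : upper_const = upper_const / 37 * 37); last by rewrite divfK.
rewrite (EFinM (upper_const / 37)) -muleA; apply: lee_wpmul2l.
  by rewrite lee_fin divr_ge0// ltW// upper_const_gt0.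
apply: avg_le_Eperm => // p.
have := @gamma_ge_chaining R 'rV[R]_n.+1 _ [ffun=> (ord0, true)]
  (@signed_process R n m') (@d2 R n.+1) (perm_weights s S p) (Tperm s T p) 33.
rewrite (_ : 33 + 4 = 37 :> R); last by ring.
apply => //.
- by case: (S) S0.
- exact: perm_weights_Tperm.
- exact: d2xx.
- exact: d2_ge0.
- by move=> x y; exact: d2_eq0.
- exact: signed_process_subgauss.
- exact: signed_process_centered.
Qed.

End Upper_bound.

Section Gaussian_majorization.
Variables (R : realType) (n : nat) (T : set 'rV[R]_n) (B : R).
Hypothesis T0 : T !=set0.
Hypothesis TB : forall N S, S != [::] -> (forall t, t \in S -> T t) ->
  rademacher_max N S <= B.

(** The smaller of the constants of [gauss_sup_diam] and [gauss_sup_growth], so that one constant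
    serves for the diameter and for the growth. *)
Definition growth_const : R :=
  Num.min (expR (- 4) / (2 + 2 * expR 16)) (expR (- 4) / 32).

Lemma growth_const_gt0 : 0 < growth_const.
Proof.
by rewrite lt_min !divr_gt0 ?expR_gt0.
Qed.

Definition majorizing_const : R := 95 + 680 / (expR (- 4) / 128).

Lemma majorizing_const_gt0 : 0 < majorizing_const.
Proof.
have e0 := expR_gt0 (- 4 : R); apply: addr_gt0; first by rewrite ltr0n.
by apply: divr_gt0; [rewrite ltr0n|apply: divr_gt0 => //; rewrite ltr0n].
Qed.

(** The scale [D] must dominate both the diameter and [F T / c], and be positive even when [T] is a
    single point and [gauss_sup T] vanishes; [e] provides the positivity. *)
Lemma gamma_le_gauss_sup (e : R) : 0 < e ->
  (gamma 2 T (@d2 R n) <=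
    (majorizing_const * (gauss_sup T / growth_const + e))%:E)%E.
Proof.
move=> e0; have c0 := growth_const_gt0.
pose F : set 'rV[R]_n -> R := @gauss_sup R n.
have F_ge0 A : A !=set0 -> A `<=` T -> 0 <= F A.
  move=> [a Aa] AT; apply: (gauss_sup_ge TB AT (S := [:: a]) (N0 := 0%N)) => //.
    by move=> t; rewrite inE => /eqP ->.
  by move=> N _; exact: rademacher_max_ge0.
have T_ge0 : 0 <= gauss_sup T by exact: F_ge0.
have D0 : 0 < gauss_sup T / growth_const + e.
  by rewrite ltr_wpDl// divr_ge0// ltW.
have sg0 : 0 < expR (- 4) / 128 :> R by rewrite divr_gt0// expR_gt0.
have diamT x y : T x -> T y -> d2 x y <= gauss_sup T / growth_const + e.
  move=> Tx Ty; apply: le_trans (_ : gauss_sup T / growth_const <= _).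
    rewrite ler_pdivlMr// mulrC; apply: le_trans (gauss_sup_diam TB Tx Ty).
    by rewrite ler_wpM2r ?d2_ge0// ge_min lexx.
  by rewrite lerDl ltW.
have FT : F T <= growth_const * (gauss_sup T / growth_const + e).
  by rewrite mulrDr mulrC divfK ?gt_eqF// lerDl mulr_ge0// ltW.
have growth k (a y : R) (t : 'I_(2 ^ 2 ^ k) -> 'rV[R]_n) (H : 'I_(2 ^ 2 ^ k) -> set 'rV[R]_n) :
    (0 < k)%N -> 0 < a -> (forall l l', l != l' -> a <= d2 (t l) (t l')) ->
    (forall l, H l !=set0) -> (forall l, H l `<=` T) ->
    (forall l x, H l x -> d2 x (t l) <= expR (- 4) / 128 * a) ->
    (forall l, y <= F (H l)) ->
    growth_const * a * Num.sqrt 2 ^+ k + y <= F (\bigcup_l H l).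
  move=> k0 a0 sep H0 HT Hs yle.
  apply: le_trans (gauss_sup_growth TB k0 a0 sep H0 HT Hs yle).
  rewrite lerD2r ler_wpM2r ?exprn_ge0 ?sqrtr_ge0// ler_wpM2r ?(ltW a0)//.
  by rewrite ge_min lexx orbT.
have [l [f [l0 l_lt l_ref l_diam f_sum]]] := majorizing_labels (@d2xx R n)
  (@d2C R n) (@d2_triangle R n) c0 sg0 D0 diamT F_ge0
  (gauss_sup_mono TB) FT growth.
exact: (gamma_le_labels T0 (@d2xx R n) l0 l_lt l_ref l_diam f_sum).
Qed.

End Gaussian_majorization.

Section Lower_bound.
Context {d : measure_display} {O : measurableType d} {R : realType}.
Variables (P : probability O R) (r s : R) (n : nat) (X : 'I_n.+1 -> {RV P >-> R}).
Hypothesis r0 : 0 < r.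
Hypothesis s0 : 0 < s.
Hypothesis rs : s^-1 + 2^-1 = r^-1.
Hypothesis X_ind : independent_RVs X.
Hypothesis X_sym : forall k, symmetric_RV (X k).
Hypothesis X_tail : forall k (u : R), 0 < u ->
  P [set w | u < `|X k w|] = (expR (- (u `^ r)))%:E.
Variable T : set 'rV[R]_n.+1.
Hypothesis T0 : T !=set0.
Notation perm_weights := (perm_weights s).

Lemma Esup_ge0 : (0 <= Esup P T (linear_process X))%E.
Proof.
have [t Tt] := T0.
have S0 : [:: t] != [::] by [].
apply: le_trans (Esup_ge P (linear_process X) S0 _); last first.
  by move=> u; rewrite inE => /eqP ->.
apply: (cvge_to_ge (process_cvg r0 X_ind X_sym X_tail (S := [:: t]))).
apply: nearW => m; rewrite lee_fin; apply: avg_ge0 => c.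
by apply: sublinear_ge0 (rad_sublinear _) _ => k; exact: quantile_ge0.
Qed.

Definition comparison_const : R := 16 * 64 `^ r^-1.

Let comparison_const_gt0 : 0 < comparison_const.
Proof. by rewrite mulr_gt0// powR_gt0. Qed.

Section Finite_supremum.
Variable B : R.
Hypothesis TB : Esup P T (linear_process X) = B%:E.

Lemma avg_rademacher_max_le N (S : seq 'rV[R]_n.+1) : S != [::] ->
  (forall t, t \in S -> T t) ->
  avg (fun p => rademacher_max N (perm_weights S p)) <= comparison_const * B.
Proof.
move=> S0 ST; have [m0 h] := comparison_lower r0 s0 rs S N.
rewrite mulrC -ler_pdivrMr// -lee_fin -TB.
apply: le_trans (Esup_ge P (linear_process X) S0 ST).
apply: (cvge_to_ge (process_cvg r0 X_ind X_sym X_tail (S := S))).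
exists m0 => // m /= m0m; rewrite lee_fin ler_pdivrMr// mulrC.
exact: h.
Qed.

(** The last weight is 0, so the map from [T] to [Tperm s T p] need not be injective and preimages
    are chosen. *)
Lemma Tperm_section p : exists h, forall u, Tperm s T p u ->
  T (h u) /\ \row_k (h u ord0 (p k) * quantile s k) = u.
Proof.
suff /choice[h hT] : forall u, exists t, Tperm s T p u ->
    T t /\ \row_k (t ord0 (p k) * quantile s k) = u by exists h.
move=> u.
have [[t Tt <-]|nu] := pselect (Tperm s T p u); first by exists t.
by exists u.
Qed.

(* A crude bound, only needed for the finiteness of [gauss_sup]. *)
Lemma rademacher_max_Tperm_le p N (S : seq 'rV[R]_n.+1) : S != [::] ->
  (forall u, u \in S -> Tperm s T p u) ->
  rademacher_max N S <= #|{: 'S_n.+1}|%:R * (comparison_const * B).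
Proof.
move=> S0 ST; have [h hS] := Tperm_section p.
have <- : perm_weights (map h S) p = S.
  rewrite /perm_weights -map_comp map_id_in// => u uS /=.
  by have [] := hS u (ST u uS).
have S1 : map h S != [::] by case: (S) S0.
have ST1 t : t \in map h S -> T t.
  by move=> /mapP[u uS ->]; have [] := hS u (ST u uS).
have N0 : 0 < #|{: 'S_n.+1}|%:R :> R.
  by rewrite ltr0n; apply/card_gt0P; exists 1%g.
rewrite mulrC -ler_pdivrMr// mulrC.
apply: le_trans (avg_rademacher_max_le N S1 ST1).
rewrite /avg ler_wpM2l ?invr_ge0// (bigD1 p)//= lerDl sumr_ge0// => q _.
by apply: rademacher_max_ge0; case: (S) S0.
Qed.

Lemma Tperm_neq0 p : Tperm s T p !=set0.
Proof. by have [t Tt] := T0; eexists; exists t. Qed.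

Lemma avg_gauss_sup_le :
  avg (fun p => gauss_sup (Tperm s T p)) <= comparison_const * B.
Proof.
apply/ler_addgt0Pr => e e0; rewrite -lerBlDr.
have /choice[S /choice[N0 SN]] p := gauss_sup_approx
  (@rademacher_max_Tperm_le p) (Tperm_neq0 p) (@subset_refl _ _) e0.
have /choice[h hS] := Tperm_section.
(* The preimages of near-optimal sets for all permutations, taken together,
   are near-optimal for every permutation at once. *)
pose U := flatten [seq map (h p) (S p) | p : 'S_n.+1].
pose N := \max_p N0 p.
have SU p : {subset map (h p) (S p) <= U}.
  by move=> u uS; apply/flattenP; exists (map (h p) (S p)) => //; apply: map_f; rewrite mem_enum.
have U0 : U != [::].
  have [S1 _ _] := SN 1%g; case E : (S 1%g) S1 => [//|x t] _.
  have : h 1%g x \in U by apply: (SU 1%g); rewrite E mem_head.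
  by case: (U).
have UT t : t \in U -> T t.
  move=> /flattenP[_ /mapP[p _ ->] /mapP[u uS ->]].
  by have [_ /(_ _ uS)/hS[]] := SN p.
apply: le_trans (avg_rademacher_max_le N U0 UT).
rewrite -[X in _ - X](avg_cst (1%g : 'S_n.+1)) -avgB; apply: avg_le => p.
have [S1 ST h1] := SN p.
apply: le_trans (h1 N (leq_bigmax p)) _; apply: rademacher_max_sub => // u uS.
have [_ <-] := hS p u (ST u uS).
apply: (map_f (fun t : 'rV[R]_n.+1 => \row_k (t ord0 (p k) * quantile s k))).
by apply: (SU p); exact: map_f.
Qed.

End Finite_supremum.

Definition lower_const : R := majorizing_const R / growth_const R * comparison_const.

Lemma lower_const_gt0 : 0 < lower_const.
Proof.
by rewrite mulr_gt0// divr_gt0 ?majorizing_const_gt0 ?growth_const_gt0.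
Qed.

Lemma gamma_le_Esup :
  (Eperm (fun p => gamma 2 (Tperm s T p) (@d2 R n.+1)) <=
   lower_const%:E * Esup P T (linear_process X))%E.
Proof.
have := Esup_ge0; case TB : (Esup P T (linear_process X)) => [B| |]//= _; last first.
  by rewrite gt0_muley ?lte_fin ?lower_const_gt0// leey.
have K0 := majorizing_const_gt0 R.
apply/lee_addgt0Pr => e e0.
have e1 : 0 < e / majorizing_const R by exact: divr_gt0.
apply: le_trans (Eperm_le_avg (fun p => gamma_le_gauss_sup (Tperm_neq0 p)
  (@rademacher_max_Tperm_le _ TB p) e1)) _.
rewrite avgZ avgD avgZr (avg_cst 1%g) mulrDr [_ * (e / _)]mulrC divfK ?gt_eqF//.
rewrite -EFinM -EFinD lee_fin lerD2r.
rewrite (_ : lower_const * B =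
  majorizing_const R * (comparison_const * B / growth_const R)); last first.
  by rewrite /lower_const; ring.
rewrite ler_pM2l// ler_pM2r ?invr_gt0 ?growth_const_gt0//.
exact: avg_gauss_sup_le TB.
Qed.

End Lower_bound.

Unset Implicit Arguments.

Theorem theorem2p1 (R : realType) (r : R) (hr0 : 0 < r) (hr2 : r < 2) :
  exists L : R, 0 < L /\
    forall (s : R), 0 < s -> s^-1 + 2^-1 = r^-1 ->
    forall (n : nat), (2 <= n)%N ->
    forall (T : set 'rV[R]_n), T !=set0 ->
    forall (d : measure_display) (Omega : measurableType d)
      (P : probability Omega R) (X : 'I_n -> {RV P >-> R}),
    independent_RVs X ->
    (forall k, symmetric_RV (X k)) ->
    (forall k (u : R), 0 < u ->
      P [set w | u < `|X k w|] = (expR (- (u `^ r)))%:E) ->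
    ((L^-1)%:E * Eperm (fun p : 'S_n => gamma 2 (Tperm s T p) (@d2 R n))
       <= Esup P T (linear_process X))%E /\
    (Esup P T (linear_process X)
       <= L%:E * Eperm (fun p : 'S_n => gamma 2 (Tperm s T p) (@d2 R n)))%E.
Proof.
(* [s] is determined by [r], so the constants can be fixed at [s0] before [s] is introduced; [r < 2]
   makes [s0] positive. *)
pose s0 := (r^-1 - 2^-1)^-1.
have s0_gt0 : 0 < s0.
  by rewrite invr_gt0 subr_gt0 ltf_pV2// posrE.
have u0 : 0 < upper_const r s0 by exact: upper_const_gt0.
have l0 : 0 < lower_const r by exact: lower_const_gt0.
have L0 : 0 < upper_const r s0 + lower_const r by exact: addr_gt0.
exists (upper_const r s0 + lower_const r); split => // s s_gt0 rs.
have -> : s = s0 by rewrite /s0 -rs addrK invrK.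
have {s s_gt0} rs : s0^-1 + 2^-1 = r^-1 by rewrite invrK subrK.
case=> [//|n] n2 T T0 d Omega P X X_ind X_sym X_tail.
have U := Esup_le_gamma n2 hr0 s0_gt0 rs X_ind X_sym X_tail T.
have Lo := gamma_le_Esup hr0 s0_gt0 rs X_ind X_sym X_tail T0.
have E0 := Esup_ge0 hr0 X_ind X_sym X_tail T0.
(* Enlarging the upper constant requires the average of [gamma] to be nonnegative; this follows from
   [0 <= Esup] and the upper bound itself. *)
have G0 := le_trans E0 U; rewrite pmule_rge0 ?lte_fin// in G0.
split.
  rewrite lee_pdivrMl//; apply: le_trans Lo _.
  by rewrite lee_wpmul2r// lee_fin lerDr ltW.
by apply: le_trans U _; rewrite lee_wpmul2r// lee_fin lerDl ltW.
Qed.
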